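(* Let $d\ge 2$ and let $0<\alpha_1<\alpha_2$ be constants. Let $a_0=0$ and $a_{n+1}=2^{a_n}$ for $n\ge 0$. Let $\tau=(\tau_e)_{e\in\mathbb{E}^d}$ be i.i.d. non-negative random variables with distribution $$\mathbb{P}(\tau_e\in dx)=\begin{cases} c_3\exp(-\alpha_2 x)\,dx, & \text{if } x\in[a_{2n},a_{2n+1}) \text{ for some integer } n\ge 0,\\ c_3\exp(-\alpha_1 x)\,dx, & \text{if } x\in[a_{2n-1},a_{2n}) \text{ for some integer } n\ge 1,\end{cases}$$ where $c_3>0$ is the constant making this a probability distribution on $[0,\infty)$. Then for any $\xi>0$, $$\limsup_{n\to\infty}\frac1n\log\mathbb{P}\big(\mathrm{T}(0,n\mathbf{e}_1)>n(\mu(\mathbf{e}_1)+\xi)\big)=-2d\,\alpha_1\,\xi,$$ $$\liminf_{n\to\infty}\frac1n\log\mathbb{P}\big(\mathrm{T}(0,n\mathbf{e}_1)>n(\mu(\mathbf{e}_1)+\xi)\big)=-2d\,\alpha_2\,\xi.$$ In particular, $$-\infty<\liminf_{n\to\infty}\frac1n\log\mathbb{P}\big(\mathrm{T}(0,n\mathbf{e}_1)>n(\mu(\mathbf{e}_1)+\xi)\big)<\limsup_{n\to\infty}\frac1n\log\mathbb{P}\big(\mathrm{T}(0,n\mathbf{e}_1)>n(\mu(\mathbf{e}_1)+\xi)\big)<0.$$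
   Context: First-passage percolation on $\mathbb{Z}^d$: $\mathbb{E}^d$ is the set of (undirected) nearest-neighbour edges of $\mathbb{Z}^d$ and each edge $e$ carries the weight $\tau_e$. A path is a finite sequence $(x_i)_{i=1}^l$ in $\mathbb{Z}^d$ with $|x_i-x_{i+1}|_1=1$ for all $i$ (also regarded as a set of edges). The passage time of a path $\gamma$ is $\mathrm{T}(\gamma)=\sum_{e\in\gamma}\tau_e$. For $x\in\mathbb{R}^d$, $\lfloor x\rfloor=(\lfloor x_1\rfloor,\dots,\lfloor x_d\rfloor)$. For $x,y\in\mathbb{R}^d$, the first passage time is $\mathrm{T}(x,y)=\inf_\gamma \mathrm{T}(\gamma)$, the infimum over all finite paths $\gamma$ from $\lfloor x\rfloor$ to $\lfloor y\rfloor$. $\mathbf{e}_1$ is the first standard basis vector. Since $\mathbb{E}\tau_e<\infty$, by Kingman's subadditive ergodic theorem for each $x\in\mathbb{R}^d$ there is a non-random constant $\mu(x)\ge 0$ (the time constant) with $\mu(x)=\lim_{t\to\infty}t^{-1}\mathrm{T}(0,tx)=\lim_{t\to\infty}t^{-1}\mathbb{E}[\mathrm{T}(0,tx)]$ almost surely. *)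

(* Defs.v *)
From mathcomp Require Import all_boot all_order all_algebra finmap.
From mathcomp Require Import all_classical all_reals all_analysis.

Set Implicit Arguments.
Unset Strict Implicit.
Unset Printing Implicit Defensive.

Import Order.TTheory GRing.Theory Num.Theory.
Import numFieldNormedType.Exports.

Local Open Scope classical_set_scope.
Local Open Scope ring_scope.

Definition adjacent (d : nat) : rel 'rV[int]_d :=
  fun x y => \sum_(i < d) `|x 0 i - y 0 i| == 1.

(* An undirected edge is the finite set of its two end points; a weight
   configuration is a function on all finite sets of vertices, of which only
   the values on [edges d] are ever used. *)
Definition edges (d : nat) : set {fset 'rV[int]_d} :=
  [set e | exists x y, adjacent x y /\ e = [fset x; y]%fset].

Arguments edges d : clear implicits.

Definition path_edges (d : nat) (x : 'rV[int]_d) (p : seq 'rV[int]_d) :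
    seq {fset 'rV[int]_d} :=
  pairmap (fun u v => [fset u; v]%fset) x p.

(* The path x :: p is regarded as a set of edges: each edge counts once. *)
Definition path_time (R : realType) (d : nat) (w : {fset 'rV[int]_d} -> R)
    (x : 'rV[int]_d) (p : seq 'rV[int]_d) : R :=
  \sum_(e <- undup (path_edges x p)) w e.

Definition floor_rV (R : realType) (d : nat) (x : 'rV[R]_d) : 'rV[int]_d :=
  \row_(i < d) Num.floor (x 0 i).

(* For non-negative weights the infimum is over a non-empty set bounded below
   by 0, so [inf] does not take its default value. *)
Definition passage_time (R : realType) (d : nat) (w : {fset 'rV[int]_d} -> R)
    (x y : 'rV[R]_d) : R :=
  inf [set path_time w (floor_rV x) p | p in
        [set p | path (@adjacent d) (floor_rV x) p
                 /\ last (floor_rV x) p = floor_rV y]].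

Definition e1 (R : realType) (d : nat) : 'rV[R]_d :=
  \row_(i < d) (i == 0 :> nat)%:R.

(* mu(x) = lim_t E[T(0, tx)] / t, which by Kingman's theorem is also the almost
   sure limit of T(0, tx) / t when the weights are i.i.d. and integrable. *)
Definition time_constant (R : realType) (dO : measure_display)
    (Omega : measurableType dO) (P : probability Omega R) (d : nat)
    (tau : {fset 'rV[int]_d} -> {RV P >-> R}) (x : 'rV[R]_d) : R :=
  fine (lim (((t^-1)%:E *
    'E_P[fun w => passage_time (fun e => tau e w) 0 (t *: x)])%E
      @[t --> +oo%R])).

Definition independent_family (R : realType) (dO : measure_display)
    (Omega : measurableType dO) (P : probability Omega R)
    (I : choiceType) (D : set I) (X : I -> {RV P >-> R}) : Prop :=
  forall (J : {fset I}) (B : I -> set R),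
    (forall i, i \in J -> D i) -> (forall i, measurable (B i)) ->
    P (\bigcap_(i in [set` J]) (X i @^-1` B i)) =
    (\prod_(i <- J) P (X i @^-1` B i))%E.

Fixpoint tower (n : nat) : nat :=
  if n is m.+1 then (2 ^ tower m)%N else 0%N.

Definition alternating_density (R : realType) (alpha1 alpha2 c3 : R) (x : R) : R :=
  if `[< exists n : nat,
           (tower (2 * n))%:R <= x < (tower (2 * n).+1)%:R >]
  then c3 * expR (- (alpha2 * x))
  else if `[< exists n : nat, (1 <= n)%N /\
                (tower (2 * n).-1)%:R <= x < (tower (2 * n))%:R >]
  then c3 * expR (- (alpha1 * x))
  else 0.

(* (1/n) log P(T(0, n e_1) > n (mu(e_1) + xi)), with log 0 = -oo. *)
Definition upper_tail_rate (R : realType) (dO : measure_display)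
    (Omega : measurableType dO) (P : probability Omega R) (d : nat)
    (tau : {fset 'rV[int]_d} -> {RV P >-> R}) (xi : R) (n : nat) : \bar R :=
  ((n%:R^-1)%:E *
   lne (P [set w | (n%:R * (time_constant tau (e1 R d) + xi) <
              passage_time (fun e => tau e w) 0 (n%:R *: e1 R d))%R]))%E.

(* Main.v *)
From HB Require Import structures.
Require Import Defs.
From mathcomp Require Import all_boot all_order all_algebra finmap.
From mathcomp Require Import all_classical all_reals all_analysis.
From mathcomp Require Import measurable_realfun lra zify ring.
Import Order.TTheory GRing.Theory Num.Theory.
Import numFieldNormedType.Exports.
Local Open Scope classical_set_scope.
Local Open Scope ring_scope.

(** The cheapest way to delay the passage from 0 to n e_1 by n xi is to give
    weight n xi to each of the 2d edges at an end point. A single weight exceeds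
    x with probability about exp(- alpha x), where alpha is alpha1 or alpha2
    according to the stretch of the tower on which x lies; hence the rate
    2d alpha xi, with an alpha that keeps oscillating because the stretches grow
    so fast that each of them dominates everything before it.

    Lower bound. If the 2d weights at the origin exceed n (xi + e), and if the
    passage time computed with these weights set to 0 exceeds n (mu - e), then
    the passage time exceeds n (mu + xi). The two events are independent, and
    the second one has probability bounded away from 0, because the mean of the
    passage time is at least n mu while the passage time is dominated by a sum
    of n weights ([T_not_small], [lower_tail_general]).

    Upper bound. At both ends, 2d edge-disjoint arms of bounded length start in
    the 2d directions, and each of them meets many disjoint tubes parallel to
    the first axis. A tube is crossed in time at most n (mu + e) but for an
    exponentially small probability ([tube_crossing]): it is cut into blocks
    crossed along finitely many paths, which makes distant blocks independent,
    and Chernoff's bound applies. With sufficiently many tubes, the event that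
    all tubes of an arm are slow is negligible. Off this event a passage time
    above n (mu + xi) makes, for each direction, the total weight of the two
    arms in that direction exceed n (xi - e). These 2d events are independent,
    and a sum of boundedly many weights has the same exponential rate as one of
    them ([upper_tail_general], [sum_tail]).

    Choice of the times. The density lies between those of rates alpha2 and
    alpha1, which gives one bound for the limit superior and one for the limit
    inferior. For the others, at n = (tower 2k) ^ 2 the scale n lies deep inside
    a stretch of rate alpha2 ([sum_rate_light]), and when n (xi + e) is just
    above tower (2k + 1), the level to be exceeded lies at the beginning of a
    stretch of rate alpha1 ([heavy_times], [tail_lower_odd]).

    The time constant is handled as the infimum of the mean slopes E T(0, n e_1)
    / n, by subadditivity and translation invariance ([time_constantE]). *)

Set Implicit Arguments.
Unset Strict Implicit.
Unset Printing Implicit Defensive.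
Local Notation adjacent := Defs.adjacent.

(** * Independence of disjoint families of coordinates *)

(** Finite intersections of events on single coordinates: a pi-system, so that
    laws and independence need only be checked on it. *)
Definition cylinders (R : realType) (T : Type) (I : choiceType)
    (X : I -> T -> R) (J : set I) : set (set T) :=
  [set A | exists (K : {fset I}) (B : I -> set R),
     [/\ forall i, i \in K -> J i, forall i, measurable (B i)
       & A = \bigcap_(i in [set` K]) (X i @^-1` B i)]].

Section cylinders.
Context (R : realType) (T : Type) (I : choiceType).
Implicit Types (X : I -> T -> R) (J : set I).

Lemma cylinders_setI X J : setI_closed (cylinders X J).
Proof.
move=> _ _ [K1 [B1 [K1J mB1 ->]]] [K2 [B2 [K2J mB2 ->]]].
exists (K1 `|` K2)%fset.
exists (fun i => (if i \in K1 then B1 i else setT) `&`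
                 (if i \in K2 then B2 i else setT)); split.
- by move=> i; rewrite in_fsetU => /orP[/K1J|/K2J].
- by move=> i; apply: measurableI; case: ifP.
- apply/seteqP; split=> [t [t1 t2] i /= _|t tK]; split => //.
  + by case: ifPn => // iK1; apply: t1.
  + by case: ifPn => // iK2; apply: t2.
  + move=> i /= iK1; have := tK i; rewrite /= in_fsetU iK1 => /(_ isT)[].
    by [].
  + move=> i /= iK2; have := tK i; rewrite /= in_fsetU iK2 orbT => /(_ isT)[].
    by [].
Qed.

Lemma cylinders_setT X J : cylinders X J setT.
Proof.
exists fset0, (fun=> setT); split => //.
by apply/seteqP; split => // t _ i /=; rewrite inE.
Qed.

Lemma cylinders1 X J i (B : set R) : J i -> measurable B ->
  cylinders X J (X i @^-1` B).
Proof.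
move=> Ji mB; exists [fset i]%fset, (fun=> B); split => //.
  by move=> j; rewrite in_fset1 => /eqP ->.
apply/seteqP; split=> [t Bt j|t /(_ i)] /=; rewrite in_fset1 ?eqxx; last exact.
by move=> /eqP ->.
Qed.

Lemma sub_cylinders X J J' : J `<=` J' -> cylinders X J `<=` cylinders X J'.
Proof.
by move=> JJ' A [K [B [KJ mB ->]]]; exists K, B; split => // i /KJ /JJ'.
Qed.

End cylinders.

(** A type, so that measurability with respect to the coordinates in J can be
    proved with the lemmas on measurable functions. *)
Notation sigma_of X J := (g_sigma_algebraType (cylinders X J)).

Section meas.
Context (R : realType) (T : pointedType) (I : choiceType).
Implicit Types (X : I -> T -> R) (J : set I).

Lemma measurable_coord X J i : J i -> measurable_fun setT (X i : sigma_of X J -> R).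
Proof.
move=> Ji _ B mB; rewrite setTI; apply: sub_sigma_algebra.
exact: cylinders1.
Qed.

Lemma sub_measurable_fun d (U : measurableType d) X J J' (f : T -> U) :
  J `<=` J' -> measurable_fun setT (f : sigma_of X J -> U) ->
  measurable_fun setT (f : sigma_of X J' -> U).
Proof.
move=> JJ' mf _ B mB; have := mf measurableT B mB; rewrite !setTI.
by apply: sub_sigma_algebra2; apply: sub_cylinders.
Qed.

End meas.

Section indep.
Context (R : realType) (dO : measure_display)
    (Omega : measurableType dO) (P : probability Omega R)
    (I : choiceType) (D : set I) (X : I -> {RV P >-> R}).
Hypothesis indX : independent_family D X.

Lemma cylinders_measurable J : cylinders X J `<=` measurable.
Proof.
move=> A [K [B [KJ mB ->]]]; apply: fin_bigcap_measurable => // i _.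
exact: measurable_funPTI.
Qed.

Lemma sigma_of_measurable J (A : set Omega) :
  <<s cylinders X J >> A -> measurable A.
Proof.
exact: (smallest_sub (@sigma_algebra_measurable _ Omega)
  (@cylinders_measurable J)).
Qed.

Lemma sigma_of_measurable_fun d (U : measurableType d) J (f : Omega -> U) :
  measurable_fun setT (f : sigma_of X J -> U) -> measurable_fun setT f.
Proof.
move=> mf _ B mB; have := mf measurableT B mB; rewrite !setTI.
exact: sigma_of_measurable.
Qed.

Lemma indep_cylinders J1 J2 A1 A2 : J1 `<=` D -> J2 `<=` D -> J1 `&` J2 = set0 ->
  cylinders X J1 A1 -> cylinders X J2 A2 -> P (A1 `&` A2) = (P A1 * P A2)%E.
Proof.
move=> J1D J2D J120 [K1 [B1 [K1J mB1 ->]]] [K2 [B2 [K2J mB2 ->]]].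
have dis i : i \in K1 -> i \in K2 -> False.
  by move=> /K1J i1 /K2J i2; have : (J1 `&` J2) i by []; rewrite J120.
pose B i := if i \in K1 then B1 i else B2 i.
have BK2 i : i \in K2 -> B i = B2 i.
  by move=> iK2; rewrite /B; case: ifPn => // /dis /(_ iK2).
have -> : \bigcap_(i in [set` K1]) X i @^-1` B1 i `&`
          \bigcap_(i in [set` K2]) X i @^-1` B2 i =
          \bigcap_(i in [set` (K1 `|` K2)%fset]) X i @^-1` B i.
  apply/seteqP; split=> [t [t1 t2] i /=|t tK].
    rewrite in_fsetU /B; case: ifPn => [iK1 _|_ /=]; first exact: t1.
    exact: t2.
  split=> i /= iK.
    by have := tK i; rewrite /= in_fsetU iK => /(_ isT); rewrite /B iK.
  by have := tK i; rewrite /= in_fsetU iK orbT BK2//; exact.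
rewrite !indX//.
- have dK : [disjoint K1 & K2]%fset.
    by apply/fdisjointP => i iK1; apply/negP => /(dis _ iK1).
  have -> : (\prod_(i <- (K1 `|` K2)%fset) P (X i @^-1` B i) =
    \prod_(i <- K1 ++ K2) P (X i @^-1` B i))%E.
    apply: perm_big; apply: uniq_perm.
    + exact: fset_uniq.
    + rewrite cat_uniq !fset_uniq andbT /=; apply/hasPn => i iK2.
      by apply/negP => iK1; exact: (dis i).
    + by move=> i; rewrite in_fsetU mem_cat.
  rewrite big_cat/=; congr (_ * _)%E; apply: eq_big_seq => i iK.
    by rewrite /B iK.
  by rewrite BK2.
- by move=> i /K2J /J2D.
- by move=> i /K1J /J1D.
- by move=> i; rewrite in_fsetU => /orP[/K1J /J1D|/K2J /J2D].
- by move=> i; rewrite /B; case: ifP.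
Qed.

(** One half of the pi-lambda argument: once A1 is independent of the cylinders,
    the two finite measures A |-> P (A1 /\ A) and A |-> P A1 * P A agree on a
    pi-system, hence on the sigma-algebra that it generates. *)
Lemma indep_half J1 J2 A1 A2 : J1 `<=` D -> J2 `<=` D ->
  measurable A1 ->
  (forall A, cylinders X J2 A -> P (A1 `&` A) = (P A1 * P A)%E) ->
  <<s cylinders X J2 >> A2 -> P (A1 `&` A2) = (P A1 * P A2)%E.
Proof.
move=> J1D J2D mA1 ind mA2.
have PA1 : P A1 \is a fin_num by exact: fin_num_measure.
have fA0 : 0 <= fine (P A1) by exact: fine_ge0.
pose m1 : {measure set Omega -> \bar R} := mrestr P mA1.
pose m2 : {measure set Omega -> \bar R} := mscale (NngNum fA0) P.
have := @g_sigma_algebra_measure_unique _ _ _ (cylinders X J2)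
  (@cylinders_measurable _) (fun=> setT) _ _ m1 m2.
have -> : P (A1 `&` A2) = m1 A2 by rewrite /m1/= /mrestr setIC.
have -> : (P A1 * P A2)%E = m2 A2 by rewrite /m2/= /mscale/= fineK.
apply => //.
- by move=> _; exact: cylinders_setT.
- by rewrite bigcup_const//; exists 0%N.
- exact: cylinders_setI.
- by move=> A /ind PA; rewrite /m1 /m2/= /mrestr/= /mscale/= fineK// setIC.
- by move=> _; rewrite /m1/= /mrestr setTI ltey_eq PA1.
Qed.

(** The product rule extends from cylinders to generated sigma-algebras one side
    at a time. *)
Lemma indep_sigma J1 J2 A1 A2 : J1 `<=` D -> J2 `<=` D -> J1 `&` J2 = set0 ->
  <<s cylinders X J1 >> A1 -> <<s cylinders X J2 >> A2 ->
  P (A1 `&` A2) = (P A1 * P A2)%E.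
Proof.
move=> J1D J2D J120 mA1 mA2.
apply: (indep_half J1D J2D _ _ mA2); first exact: sigma_of_measurable mA1.
move=> A cA; rewrite setIC muleC; apply: (indep_half J2D J1D _ _ mA1).
  exact: cylinders_measurable cA.
move=> B cB; rewrite setIC muleC.
exact: (indep_cylinders J1D J2D).
Qed.

(** By independence the law of (f, g) is the product of the laws of f and g, so
    that Fubini factors the integral of the product. *)
Lemma expectation_mul J1 J2 (f g : Omega -> R) :
  J1 `<=` D -> J2 `<=` D -> J1 `&` J2 = set0 ->
  measurable_fun setT (f : sigma_of X J1 -> R) ->
  measurable_fun setT (g : sigma_of X J2 -> R) ->
  (forall w, 0 <= f w) -> (forall w, 0 <= g w) ->
  (\int[P]_w (f w * g w)%:E = (\int[P]_w (f w)%:E) * \int[P]_w (g w)%:E)%E.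
Proof.
move=> J1D J2D J120 mf mg f0 g0.
have mf' := sigma_of_measurable_fun mf; have mg' := sigma_of_measurable_fun mg.
pose h w := (f w, g w).
have mh : measurable_fun setT h by exact: measurable_fun_pair.
pose F : {RV P >-> R} := HB.pack f (isMeasurableFun.Build _ _ _ _ f mf').
pose G : {RV P >-> R} := HB.pack g (isMeasurableFun.Build _ _ _ _ g mg').
pose H : {RV P >-> (R * R)%type} :=
  HB.pack h (isMeasurableFun.Build _ _ _ _ h mh).
pose k (z : R * R) : \bar R := (`|z.1 * z.2|)%:E.
have mk : measurable_fun [set: (R * R)%type] k.
  apply/measurable_EFinP; apply: measurableT_comp => //.
  by apply: measurable_funM.
have k0 z : (0 <= k z)%E by rewrite lee_fin.
have -> : (\int[P]_w (f w * g w)%:E = \int[distribution P H]_z k z)%E.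
  rewrite ge0_integral_distribution//; apply: eq_integral => w _ /=.
  by rewrite /k/= ger0_norm// mulr_ge0.
have E : forall A, measurable A ->
   (distribution P F \x distribution P G)%E A = distribution P H A.
  apply: product_measure_unique => A B mA mB.
  rewrite /distribution /pushforward.
  rewrite -(indep_sigma J1D J2D J120).
  - by congr (P _); apply/seteqP; split.
  - by have := mf measurableT A mA; rewrite setTI.
  - by have := mg measurableT B mB; rewrite setTI.
transitivity (\int[(distribution P F \x distribution P G)%E]_z k z)%E.
  by apply: eq_measure_integral => A mA _; rewrite /= E.
rewrite fubini_tonelli1//.
have e1 x : (0 <= x)%R -> (\int[distribution P G]_y k (x, y) =
   x%:E * \int[P]_w (g w)%:E)%E.
  move=> x0; rewrite ge0_integral_distribution//; last first.
    exact: measurableT_comp mk (measurable_pair1 _).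
  rewrite -(@ge0_integralZl _ _ _ P _ measurableT (EFin \o g))//.
  - by apply: eq_integral => w _; rewrite /k/= ger0_norm ?EFinM// mulr_ge0.
  - exact/measurable_EFinP.
  - by move=> w _; rewrite lee_fin.
have mF : measurable_fun setT (fubini_F (distribution P G) k).
  exact: measurable_fun_fubini_tonelli_F.
rewrite ge0_integral_distribution//; last first.
  by move=> x; apply: integral_ge0.
rewrite -(@ge0_integralZr _ _ _ P _ measurableT (EFin \o f))//.
- by apply: eq_integral => w _ /=; rewrite /fubini_F e1.
- exact/measurable_EFinP.
- by move=> w _; rewrite lee_fin.
- by apply: integral_ge0 => w _; rewrite lee_fin.
Qed.

Section iterated.
Variables (J : nat -> set I).
Hypothesis JD : forall n, J n `<=` D.
Hypothesis tJ : forall m n, m != n -> J m `&` J n = set0.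

Let JU n := \bigcup_(k < n) J k.

Let JUD n : JU n `<=` D.
Proof. by move=> i [k _ /JD]. Qed.

Let JU_disj n : JU n `&` J n = set0.
Proof.
apply/seteqP; split=> // i [[k /= kn ik] In].
by have : (J k `&` J n) i by []; rewrite tJ// ltn_eqF.
Qed.

(** A product of functions of J 0, ..., J (n - 1) is a function of their union,
    which is disjoint from J n: the two-factor case applies repeatedly. *)
Lemma expectation_prod (f : nat -> Omega -> R) n :
  (forall k, measurable_fun setT (f k : sigma_of X (J k) -> R)) ->
  (forall k w, 0 <= f k w) ->
  (\int[P]_w (\prod_(k < n) f k w)%:E = \prod_(k < n) \int[P]_w (f k w)%:E)%E.
Proof.
move=> mf f0; elim: n => [|n IH].
  rewrite big_ord0; under eq_integral do rewrite big_ord0.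
  by rewrite integral_cst//= probability_setT mule1.
rewrite big_ord_recr/= -IH -(@expectation_mul (JU n) (J n))//.
- by apply: eq_integral => w _; rewrite big_ord_recr.
- rewrite [X in measurable_fun _ X](_ : _ =
      (fun w => \prod_(k <- index_iota 0 n) f k w)); last first.
    by apply/funext => w; rewrite big_mkord.
  apply: (@measurable_prod _ (sigma_of X (JU n))) => k.
  rewrite mem_index_iota => kn.
  by apply: sub_measurable_fun (mf k) => i ik; exists k.
- by move=> w; exact: prodr_ge0.
Qed.

Lemma probability_bigcap (A : nat -> set Omega) n :
  (forall k, <<s cylinders X (J k) >> (A k)) ->
  P (\bigcap_(k < n) A k) = (\prod_(k < n) P (A k))%E.
Proof.
move=> mA; elim: n => [|n IH].
  by rewrite big_ord0 bigcap_mkord big_ord0 probability_setT.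
rewrite big_ord_recr/= -IH bigcap_mkord big_ord_recr -bigcap_mkord/=.
apply: (@indep_sigma (JU n) (J n)) => //.
apply: (@fin_bigcap_measurable _ (sigma_of X (JU n))) => [|k /= kn].
  exact: finite_II.
have := mA k.
by apply: sub_sigma_algebra2; apply: sub_cylinders => i ik; exists k.
Qed.

End iterated.
End indep.

Section law.
Context (R : realType) (dO : measure_display)
    (Omega : measurableType dO) (P : probability Omega R)
    (I : choiceType) (D : set I) (X Y : I -> {RV P >-> R}).
Hypothesis indX : independent_family D X.
Hypothesis indY : independent_family D Y.
Hypothesis XY : forall i, D i -> forall B, measurable B ->
  P (X i @^-1` B) = P (Y i @^-1` B).

Let coord (i : I) (f : I -> R) := f i.

Let measurable_config (Z : I -> {RV P >-> R}) :
  measurable_fun setT ((fun w => Z^~ w) : Omega -> sigma_of coord D).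
Proof.
apply: (@measurability _ _ Omega (sigma_of coord D) setT
  (fun w => Z^~ w) (cylinders coord D) erefl).
move=> _ [_ [K [B [KD mB ->]]] <-]; rewrite setTI preimage_bigcap.
by apply: fin_bigcap_measurable => // i _; exact: measurable_funPTI.
Qed.

(** The laws of X and Y on configurations agree on cylinders, where they are the
    same products of marginals, hence on all events. The hypotheses of sign are
    only on the configurations that occur, because passage times of general
    configurations may be negative. *)
Lemma integral_same_law (f : (I -> R) -> R) :
  measurable_fun setT (f : sigma_of coord D -> R) ->
  (forall w, 0 <= f (X^~ w)) -> (forall w, 0 <= f (Y^~ w)) ->
  (\int[P]_w (f (X^~ w))%:E = \int[P]_w (f (Y^~ w))%:E)%E.
Proof.
move=> mf fX0 fY0.
pose g (c : I -> R) : \bar R := (Num.max (f c) 0)%:E.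
have mg : measurable_fun setT (g : sigma_of coord D -> \bar R).
  by apply/measurable_EFinP; exact: measurable_maxr.
have g0 c : (0 <= g c)%E by rewrite lee_fin le_max lexx orbT.
pose LX : {RV P >-> sigma_of coord D} := HB.pack
  ((fun w => X^~ w) : Omega -> sigma_of coord D)
  (isMeasurableFun.Build _ _ _ _ _ (measurable_config X)).
pose LY : {RV P >-> sigma_of coord D} := HB.pack
  ((fun w => Y^~ w) : Omega -> sigma_of coord D)
  (isMeasurableFun.Build _ _ _ _ _ (measurable_config Y)).
transitivity (\int[distribution P LX]_c g c)%E.
  rewrite ge0_integral_distribution//; apply: eq_integral => w _ /=.
  by rewrite /g max_l.
transitivity (\int[distribution P LY]_c g c)%E; last first.
  rewrite ge0_integral_distribution//; apply: eq_integral => w _ /=.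
  by rewrite /g max_l.
apply: eq_measure_integral => A mA _.
apply: (@measure_unique _ R (sigma_of coord D) (cylinders coord D) (fun=> setT)) => //.
- exact: cylinders_setI.
- by move=> _; exact: cylinders_setT.
- by rewrite bigcup_const//; exists 0%N.
- move=> _ [K [B [KD mB ->]]]; rewrite /distribution /pushforward.
  transitivity (\prod_(i <- K) P (X i @^-1` B i))%E.
    by rewrite -(indX KD mB); congr (P _); apply/seteqP; split.
  transitivity (\prod_(i <- K) P (Y i @^-1` B i))%E.
    by apply: eq_big_seq => i /KD Di; exact: XY.
  by rewrite -(indY KD mB); congr (P _); apply/seteqP; split.
- by move=> _; rewrite (le_lt_trans (probability_le1 _ _)) ?ltry.
Qed.

End law.

(** * Lattice paths *)

Section lattice.
Context (d : nat).
Local Notation V := 'rV[int]_d.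
Implicit Types (x y z v : V) (p q : seq V).

Lemma adjacentC x y : adjacent x y = adjacent y x.
Proof.
by rewrite /adjacent; under eq_bigr do rewrite distrC.
Qed.

Lemma adjacent_translate x y v : adjacent (x + v) (y + v) = adjacent x y.
Proof.
rewrite /adjacent; congr (_ == _); apply: eq_bigr => i _.
by rewrite !mxE opprD addrACA subrr addr0.
Qed.

Lemma adjacentE x v : adjacent x (x + v) = (\sum_(i < d) `|v 0 i| == 1).
Proof.
rewrite /adjacent; congr (_ == _); apply: eq_bigr => i _.
by rewrite !mxE opprD addrA subrr sub0r normrN.
Qed.

(** The 2d directions; the boolean is true for the negative ones. *)
Definition unit_vec (a : 'I_d * bool) : V :=
  if a.2 then - delta_mx 0 a.1 else delta_mx 0 a.1.

Lemma unit_vecE a i :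
  unit_vec a 0 i = if i == a.1 then (if a.2 then -1 else 1) else 0.
Proof.
by rewrite /unit_vec; case: a => j [] /=; rewrite !mxE eqxx /= eq_sym;
  case: eqVneq; rewrite ?oppr0.
Qed.

Lemma unit_vec_inj : injective unit_vec.
Proof.
move=> [j s] [k t] E.
have Ej : j = k.
  have := congr1 (fun m : V => m 0 j) E; rewrite !unit_vecE/= eqxx.
  by case: eqVneq => // _; case: s {E}.
subst k; congr (_, _).
have := congr1 (fun m : V => m 0 j) E; rewrite !unit_vecE/= eqxx.
by case: s t {E} => [] [].
Qed.

Lemma adjacent_unit_vec x a : adjacent x (x + unit_vec a).
Proof.
rewrite adjacentE (bigD1 a.1)//= big1 => [|i ij].
  by rewrite unit_vecE eqxx; case: a.2.
by rewrite unit_vecE (negPf ij) normr0.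
Qed.

(** Integers whose absolute values sum to 1 are all 0 but for one, equal to 1
    or -1. *)
Lemma adjacent_ex x y : adjacent x y -> exists a, y = x + unit_vec a.
Proof.
pose v := y - x; have -> : y = x + v by rewrite addrC subrK.
rewrite adjacentE => /eqP v1.
have [j vj] : exists j, v 0 j != 0.
  apply/existsP; rewrite -negb_forall; apply/negP => /forallP v0.
  by move: v1; rewrite big1 // => i _; rewrite (eqP (v0 i)).
have vj1 : 1 <= `|v 0 j| by rewrite -gtz0_ge1 normr_gt0.
have rest0 i : i != j -> v 0 i = 0.
  move=> ij; apply/normr0_eq0.
  move: v1; rewrite (bigD1 j)//= (bigD1 i)//= => v1.
  have S0 : 0 <= \sum_(i0 < d | (i0 != j) && (i0 != i)) `|v 0 i0|.
    by apply: sumr_ge0.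
  have := normr_ge0 (v 0 i); move: S0 v1 vj1.
  move: `|v 0 i| `|v 0 j| (\sum_(_ < d | _) _) => a b S.
  lia.
have vj1' : `|v 0 j| = 1.
  move: v1; rewrite (bigD1 j)//= big1 ?addr0// => i ij.
  by rewrite rest0.
exists (j, v 0 j < 0); congr (_ + _); apply/rowP => i; rewrite unit_vecE /=.
have [->|/rest0//] := eqVneq i j.
case: ltrP vj1' => vj0; first by rewrite ltr0_norm// => <-; rewrite opprK.
by rewrite ger0_norm.
Qed.

Lemma edges_adj x y : adjacent x y -> edges d [fset x; y]%fset.
Proof. by exists x, y. Qed.

Lemma path_edges_edges x p : path (@adjacent d) x p ->
  forall e, e \in path_edges x p -> edges d e.
Proof.
elim: p x => [//|y p IH] x /= /andP[xy yp] e.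
by rewrite inE => /orP[/eqP ->|/IH]; [exact: edges_adj | exact].
Qed.

Lemma path_edges_cat x p q :
  path_edges x (p ++ q) = path_edges x p ++ path_edges (last x p) q.
Proof. by rewrite /path_edges pairmap_cat. Qed.

Lemma path_edges_vertices x p e u : e \in path_edges x p -> u \in e ->
  u \in x :: p.
Proof.
elim: p x => [//|y p IH] x /=; rewrite inE => /orP[/eqP ->|/IH yp ue].
  by rewrite !inE => /orP[] ->; rewrite ?orbT.
by rewrite inE yp ?orbT.
Qed.

Definition shift_edge v (e : {fset V}) : {fset V} := [fset (u + v)%R | u : V in e]%fset.

Lemma shift_edge2 v x y : shift_edge v [fset x; y]%fset = [fset (x + v)%R; (y + v)%R]%fset.
Proof.
apply/fsetP => u; apply/imfsetP/idP => /= [[t]|]; rewrite !inE.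
  by move=> /orP[] /eqP -> ->; rewrite eqxx ?orbT.
by move=> /orP[] /eqP ->; [exists x|exists y]; rewrite // !inE eqxx ?orbT.
Qed.

Lemma shift_edgeK v : cancel (shift_edge v) (shift_edge (- v)).
Proof.
move=> e; apply/fsetP => u; apply/imfsetP/idP => /= [[_ /imfsetP[t te ->] ->]|ue].
  by rewrite addrK.
by exists (u + v); rewrite ?addrK//; apply/imfsetP; exists u.
Qed.

Lemma shift_edge_inj v : injective (shift_edge v).
Proof. exact: can_inj (shift_edgeK v). Qed.

Lemma mem_shift_edge v e u : (u \in shift_edge v e) = (u - v \in e).
Proof.
apply/imfsetP/idP => /= [[t te ->]|ue]; first by rewrite addrK.
by exists (u - v); rewrite ?subrK.
Qed.

Lemma edges_shift v e : edges d e -> edges d (shift_edge v e).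
Proof.
move=> [x [y [xy ->]]]; exists (x + v), (y + v).
by rewrite adjacent_translate shift_edge2.
Qed.

Lemma path_edges_shift v x p :
  path_edges (x + v) [seq u + v | u <- p] = [seq shift_edge v e | e <- path_edges x p].
Proof. by elim: p x => [//|y p IH] x /=; rewrite IH shift_edge2. Qed.

Lemma path_shift v x p :
  path (@adjacent d) (x + v) [seq u + v | u <- p] = path (@adjacent d) x p.
Proof. by elim: p x => [//|y p IH] x /=; rewrite IH adjacent_translate. Qed.

End lattice.

Section passage.
Context (R : realType) (d : nat).
Local Notation V := 'rV[int]_d.
Implicit Types (w : {fset V} -> R) (x y z v : V) (p q : seq V) (c : R).

Definition valid_path x y p := path (@adjacent d) x p && (last x p == y).

Definition ptime w x y : R :=
  inf [set path_time w x p | p in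
        [set p | path (@adjacent d) x p /\ last x p = y]].

Lemma passage_timeE w (x y : 'rV[R]_d) :
  passage_time w x y = ptime w (floor_rV x) (floor_rV y).
Proof. by []. Qed.

(** Upper bounds on passage times are proved through this relation, which
    composes along concatenated paths. *)
Definition reach w x y c := exists2 p, valid_path x y p & path_time w x p <= c.

Lemma path_time_shift w v x p :
  path_time w (x + v) [seq u + v | u <- p] = path_time (w \o shift_edge v) x p.
Proof.
rewrite /path_time path_edges_shift undup_map_inj; last exact: shift_edge_inj.
by rewrite big_map.
Qed.

Lemma reach_shift w v x y c :
  reach (w \o shift_edge v) x y c -> reach w (x + v) (y + v) c.
Proof.
move=> [p /andP[xp /eqP <-] pc]; exists [seq u + v | u <- p].
  by rewrite /valid_path path_shift xp/= (last_map (fun u => u + v)).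
by rewrite path_time_shift.
Qed.

(** Translation is a bijection between the paths from x to y and those from
    x + v to y + v. *)
Lemma ptime_shift w v x y :
  ptime (w \o shift_edge v) x y = ptime w (x + v) (y + v).
Proof.
congr inf; apply/seteqP; split => [_ [p [xp <-] <-]|_ [p [xp py] <-]].
  exists [seq u + v | u <- p]; last exact: path_time_shift.
  by split; rewrite ?path_shift// (last_map (fun u => u + v)).
have E : p = [seq u + v | u <- [seq u - v | u <- p]].
  by rewrite -map_comp map_id_in// => u _ /=; rewrite subrK.
exists [seq u - v | u <- p]; last by rewrite -path_time_shift -E.
split; first by rewrite -(path_shift v) -E.
by rewrite -{1}(addrK v x) (last_map (fun u => u - v)) py addrK.
Qed.

Lemma path_time_eq w w' x p : path (@adjacent d) x p ->
  (forall e, edges d e -> w e = w' e) -> path_time w x p = path_time w' x p.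
Proof.
move=> xp ww'; apply: eq_big_seq => e; rewrite mem_undup.
by move=> /(path_edges_edges xp); exact: ww'.
Qed.

Lemma ptime_eq w w' x y :
  (forall e, edges d e -> w e = w' e) -> ptime w x y = ptime w' x y.
Proof.
move=> ww'; congr inf; apply/seteqP; split => _ [p [xp py] <-]; exists p => //.
  by rewrite (path_time_eq xp ww').
by rewrite (path_time_eq xp ww').
Qed.

Lemma sum_sub_seq w (s t : seq {fset V}) : uniq s -> {subset s <= t} ->
  (forall e, e \in t -> 0 <= w e) -> \sum_(e <- s) w e <= \sum_(e <- t) w e.
Proof.
elim: s t => [|a s IH] t /=.
  by move=> _ _ t0; rewrite big_nil big_seq sumr_ge0.
move=> /andP[ans us] st t0; rewrite big_cons.
have at_ : a \in t by apply: st; rewrite inE eqxx.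
rewrite (perm_big _ (perm_to_rem at_)) big_cons lerD2l; apply: IH => //.
  move=> b bs; have := st b; rewrite inE bs orbT => /(_ isT) bt.
  have := perm_mem (perm_to_rem at_) b; rewrite bt inE => /esym/orP[/eqP ba|//].
  by rewrite -ba bs in ans.
by move=> e /mem_rem; exact: t0.
Qed.

Section nonneg.
Variable w : {fset V} -> R.
Hypothesis w0 : forall e, edges d e -> 0 <= w e.

Lemma path_time_ge0 x p : path (@adjacent d) x p -> 0 <= path_time w x p.
Proof.
move=> xp; rewrite /path_time big_seq sumr_ge0// => e; rewrite mem_undup.
by move=> /(path_edges_edges xp); exact: w0.
Qed.

(** Only an inequality, because an edge common to both paths counts once in
    their concatenation. *)
Lemma path_time_cat x p q : path (@adjacent d) x (p ++ q) ->
  path_time w x (p ++ q) <= path_time w x p + path_time w (last x p) q.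
Proof.
move=> pq; rewrite /path_time -big_cat; apply: sum_sub_seq.
- exact: undup_uniq.
- by move=> e; rewrite path_edges_cat mem_cat !mem_undup mem_cat.
- move=> e; rewrite mem_cat !mem_undup -mem_cat -path_edges_cat.
  by move=> /(path_edges_edges pq); exact: w0.
Qed.

Lemma reach_trans x y z c c' : reach w x y c -> reach w y z c' ->
  reach w x z (c + c').
Proof.
move=> [p /andP[xp /eqP py] pc] [q /andP[yq /eqP qz] qc].
have pq : path (@adjacent d) x (p ++ q) by rewrite cat_path xp py yq.
exists (p ++ q); first by rewrite /valid_path pq last_cat py qz /=.
by rewrite (le_trans (path_time_cat pq))// py lerD.
Qed.

Lemma reach_refl x : reach w x x 0.
Proof. by exists [::]; rewrite /valid_path ?eqxx// /path_time big_nil. Qed.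

Lemma reach_adjacent x y : adjacent x y -> reach w x y (w [fset x; y]%fset).
Proof.
move=> xy; exists [:: y]; first by rewrite /valid_path /= xy eqxx.
by rewrite /path_time /= big_seq1.
Qed.

Lemma reach_le x y c c' : c <= c' -> reach w x y c -> reach w x y c'.
Proof. by move=> cc' [p vp pc]; exists p => //; exact: le_trans cc'. Qed.

Lemma reach_sum (z : nat -> V) (c : nat -> R) k :
  (forall j, (j < k)%N -> reach w (z j) (z j.+1) (c j)) ->
  reach w (z 0%N) (z k) (\sum_(j < k) c j).
Proof.
elim: k => [_|k IH zc]; first by rewrite big_ord0; exact: reach_refl.
rewrite big_ord_recr/=; apply: reach_trans (zc k (ltnSn _)).
by apply: IH => j jk; apply: zc; rewrite ltnS ltnW.
Qed.

Let has_lb x y : lbound [set path_time w x p | p in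
        [set p | path (@adjacent d) x p /\ last x p = y]] 0.
Proof. by move=> _ [p [xp _] <-]; exact: path_time_ge0. Qed.

Lemma ptime_le x y c : reach w x y c -> ptime w x y <= c.
Proof.
move=> [p /andP[xp /eqP py] pc]; apply: le_trans pc; apply: ge_inf.
  by exists 0; exact: has_lb.
by exists p.
Qed.

Lemma ptime_ge x y c : (exists c', reach w x y c') ->
  (forall p, valid_path x y p -> c <= path_time w x p) -> c <= ptime w x y.
Proof.
move=> [c' [p /andP[xp /eqP py] pc]] cp; apply: lb_le_inf.
  by exists (path_time w x p), p.
by move=> _ [q [xq qy] <-]; apply: cp; rewrite /valid_path xq qy eqxx.
Qed.

Lemma ptime_ge0 x y : 0 <= ptime w x y.
Proof.
rewrite /ptime; set S := [set _ | _ in _].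
have [->|/set0P S0] := eqVneq S set0; first by rewrite inf0.
by apply: lb_le_inf => //; exact: has_lb.
Qed.

Lemma ptime_reach x y c : (exists c', reach w x y c') ->
  ptime w x y < c -> reach w x y c.
Proof.
move=> [c' [p /andP[xp /eqP py] _]] /inf_lt[].
  by exists (path_time w x p), p.
move=> _ [q [xq qy] <-] qc; exists q; last exact: ltW.
by rewrite /valid_path xq qy eqxx.
Qed.

Lemma ptime_triangle x y z : (exists c, reach w x y c) -> (exists c, reach w y z c) ->
  ptime w x z <= ptime w x y + ptime w y z.
Proof.
move=> xy yz; apply/ler_addgt0Pr => e e0; apply: ptime_le.
apply: (@reach_le _ _ (ptime w x y + e / 2 + (ptime w y z + e / 2))).
  by lra.
have e20 : 0 < e / 2 by rewrite divr_gt0.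
by apply: (@reach_trans x y z); apply: ptime_reach => //; rewrite ltrDl.
Qed.

End nonneg.
End passage.

(** * Measurability of passage times and invariance under translations *)

Section measurable_passage.
Context (R : realType) (d : nat) (dT : measure_display) (T : measurableType dT).
Local Notation V := 'rV[int]_d.
Variable X : {fset V} -> T -> R.

Lemma measurable_sum_in (s : seq {fset V}) :
  (forall e, e \in s -> measurable_fun setT (X e)) ->
  measurable_fun setT (fun t => \sum_(e <- s) X e t).
Proof.
elim: s => [|a s IH] Xs.
  by under eq_fun do rewrite big_nil; exact: measurable_cst.
under eq_fun do rewrite big_cons; apply: measurable_funD.
  by apply: Xs; rewrite inE eqxx.
by apply: IH => e es; apply: Xs; rewrite inE es orbT.
Qed.

Lemma measurable_path_time x p :
  (forall e, e \in path_edges x p -> measurable_fun setT (X e)) ->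
  measurable_fun setT (fun t => path_time (X^~ t) x p).
Proof.
by move=> mX; apply: measurable_sum_in => e; rewrite mem_undup; exact: mX.
Qed.

Lemma valid_path_enum (x y : V) p0 : valid_path x y p0 ->
  exists u : nat -> seq V, [/\ u 0%N = p0, forall n, valid_path x y (u n) &
    forall p, valid_path x y p -> exists n, u n = p].
Proof.
move=> p0v.
pose u n := if n is m.+1 then
    if choice.unpickle m is Some p then if valid_path x y p then p else p0 else p0
  else p0.
exists u; split=> [//|[//|n]|p pv].
  by rewrite /u; case: choice.unpickle => // p; case: ifP.
by exists (choice.pickle p).+1; rewrite /u (choice.pickleK p) pv.
Qed.

(** There are only countably many paths, so that the infimum is that of a
    sequence of measurable functions. *)
Lemma measurable_ptime x y :
  (forall e, edges d e -> measurable_fun setT (X e)) ->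
  (forall e, edges d e -> forall t, 0 <= X e t) ->
  measurable_fun setT (fun t => ptime (X^~ t) x y).
Proof.
move=> mX X0.
have [[p0 p0v]|np] := pselect (exists p, valid_path x y p); last first.
  rewrite (_ : (fun _ => _) = cst 0); first exact: measurable_cst.
  apply/funext => t /=; rewrite /ptime (_ : image _ _ = set0) ?inf0//.
  apply/seteqP; split => [r [p [xp py] _]|//]; exfalso; apply: np.
  by exists p; rewrite /valid_path xp py eqxx.
have [u [_ uv us]] := valid_path_enum p0v.
pose h n t := path_time (X^~ t) x (u n).
rewrite (_ : (fun _ => _) = (fun t => infs (h ^~ t) 0%N)); last first.
  apply/funext => t; rewrite /ptime /infs /sdrop; congr inf.
  apply/seteqP; split => [_ [p [xp py] <-]|_ [n _ <-]].
    have [|n un] := us p; first by rewrite /valid_path xp py eqxx.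
    by exists n => //; rewrite /h un.
  by have /andP[xp /eqP py] := uv n; exists (u n).
apply: measurable_fun_infs.
  by move=> t _; exists 0 => _ [n _ <-]; apply: path_time_ge0 => [e /X0//|];
     have /andP[] := uv n.
move=> n; apply: measurable_path_time => e; have /andP[xp _] := uv n.
by move=> /(path_edges_edges xp); exact: mX.
Qed.

End measurable_passage.

(** What the estimates for first-passage percolation use: independent, equally
    distributed, non-negative weights whose law has an exponential moment. The
    alternating law enters only at the end. *)
Record iid_weights (R : realType) (dO : measure_display)
    (Omega : measurableType dO) (P : probability Omega R) (d : nat)
    (tau : {fset 'rV[int]_d} -> {RV P >-> R}) (th0 K0 : R) : Prop := IidWeights {
  weight_ge0 : forall e, edges d e -> forall w, 0 <= tau e w ;
  weight_indep : independent_family (edges d) tau ;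
  weight_id : forall e e', edges d e -> edges d e' ->
    forall B : set R, measurable B -> P (tau e @^-1` B) = P (tau e' @^-1` B) ;
  th0_gt0 : 0 < th0 ;
  weight_exp : forall e, edges d e ->
    (\int[P]_w (expR (th0 * tau e w))%:E <= K0%:E)%E }.

Section translation.
Context (R : realType) (dO : measure_display)
    (Omega : measurableType dO) (P : probability Omega R) (d : nat)
    (tau : {fset 'rV[int]_d} -> {RV P >-> R}) (th0 K0 : R).
Hypothesis H : iid_weights tau th0 K0.
Local Notation V := 'rV[int]_d.

(** A finite family of translated edges is a finite family of edges. *)
Lemma shift_indep v :
  independent_family (edges d) (fun e => tau (shift_edge v e)).
Proof.
move=> J B JD mB.
pose J' := [fset shift_edge v e | e in J]%fset.
have := weight_indep H (J := J') (B := fun e => B (shift_edge (- v) e)).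
rewrite big_imfset/=; last by move=> e e' _ _; exact: shift_edge_inj.
under eq_bigr do rewrite shift_edgeK.
move=> <- //.
- congr (P _); apply/seteqP; split => w wJ e /=.
    by move=> /imfsetP[f fJ ->]; rewrite shift_edgeK; exact: wJ.
  move=> eJ; have := wJ (shift_edge v e); rewrite /= shift_edgeK; apply.
  by apply/imfsetP; exists e.
- by move=> e /imfsetP[f fJ ->]; apply: edges_shift; exact: JD.
Qed.

(** Translated weights are again independent with the same marginals, so that
    they have the same law as the weights. *)
Lemma integral_shift v (f : ({fset V} -> R) -> R) :
  measurable_fun setT
    (f : sigma_of (fun (e : {fset V}) (c : {fset V} -> R) => c e) (edges d) -> R) ->
  (forall c, (forall e, edges d e -> 0 <= c e) -> 0 <= f c) ->
  (\int[P]_w (f (tau^~ w \o shift_edge v))%:E = \int[P]_w (f (tau^~ w))%:E)%E.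
Proof.
move=> mf f0.
apply: (integral_same_law (X := fun e => tau (shift_edge v e)) (D := edges d)) => //.
- exact: shift_indep.
- exact: weight_indep H.
- by move=> e eD B mB; apply: (weight_id H) => //; exact: edges_shift.
- by move=> w; apply: f0 => e eD; apply: (weight_ge0 H); exact: edges_shift.
- by move=> w; apply: f0 => e eD; exact: (weight_ge0 H).
Qed.

End translation.

(** * The time constant *)

Section subadditive.
Context (R : realType) (a : nat -> R) (C : R).
Hypothesis a_ge0 : forall n, 0 <= a n.
Hypothesis a_le : forall n, a n <= n%:R * C.
Hypothesis a_sub : forall m n, a (m + n)%N <= a m + a n.

(** By Fekete's lemma this is the limit of a n / n. *)
Definition inf_slope : R := inf [set a n / n%:R | n in [set n | (0 < n)%N]].

Lemma inf_slope_le n : n%:R * inf_slope <= a n.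
Proof.
case: n => [|n]; first by rewrite mul0r.
rewrite mulrC -ler_pdivlMr ?ltr0n//; apply: ge_inf; last by exists n.+1.
by exists 0 => _ [k _ <-]; rewrite divr_ge0.
Qed.

Lemma inf_slope_ge0 : 0 <= inf_slope.
Proof.
apply: lb_le_inf; first by exists (a 1 / 1%:R), 1%N.
by move=> _ [k _ <-]; rewrite divr_ge0.
Qed.

Lemma inf_slope_approx e : 0 < e ->
  exists2 M, (0 < M)%N & a M <= M%:R * (inf_slope + e).
Proof.
move=> e0; have : inf_slope < inf_slope + e by rewrite ltrDl.
move=> /inf_lt[]; first by exists (a 1 / 1%:R), 1%N.
move=> _ [M /= M0 <-] /ltW; rewrite ler_pdivrMr ?ltr0n// mulrC => aM.
by exists M.
Qed.

Lemma subadditive_mul q M : a (q * M) <= q%:R * a M.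
Proof.
elim: q => [|q IH]; first by rewrite mul0n mul0r (le_trans (a_le 0))// mul0r.
by rewrite mulSn (le_trans (a_sub _ _))// -natr1 mulrDl mul1r addrC lerD2r.
Qed.

(** Fekete's lemma along real times. The lower bound is the definition of the
    infimum; for the upper one, n is divided by an M with a M / M close to the
    infimum, and the remainder costs at most M C. *)
Lemma subadditive_cvg e : 0 < e -> exists t0 : R, 0 < t0 /\
  forall t, t0 <= t -> `|inf_slope - t^-1 * a (Num.truncn t)| <= e.
Proof.
move=> e0; have e20 : 0 < e / 2 by rewrite divr_gt0.
have [M M0 aM] := inf_slope_approx e20.
have C0 : 0 <= C by have := le_trans (a_ge0 1) (a_le 1); rewrite mul1r.
have mu0 := inf_slope_ge0.
exists (1 + (inf_slope + M%:R * C) * 2 / e); split.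
  by rewrite ltr_wpDr// !mulr_ge0 ?invr_ge0 ?addr_ge0 ?mulr_ge0// ltW.
move=> t tge.
have t1 : 1 <= t.
  by rewrite (le_trans _ tge)// lerDl !mulr_ge0 ?invr_ge0 ?addr_ge0 ?mulr_ge0// ltW.
have t0 : 0 < t by rewrite (lt_le_trans ltr01).
have te : (inf_slope + M%:R * C) <= t * (e / 2).
  have : (inf_slope + M%:R * C) * 2 / e <= t.
    by move: tge; set Y := _ * 2 / e; lra.
  by rewrite ler_pdivrMr// => ?; lra.
set n := Num.truncn t.
have /andP[nt tn] := truncn_itv (ltW t0).
have low : t * inf_slope - inf_slope <= a n.
  apply: le_trans (inf_slope_le n).
  have : t * inf_slope <= n.+1%:R * inf_slope by rewrite ler_wpM2r// ltW.
  by rewrite -natr1 mulrDl mul1r; lra.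
have upp : a n <= t * (inf_slope + e / 2) + M%:R * C.
  rewrite {1}(divn_eq n M); apply: le_trans (a_sub _ _) _; apply: lerD.
    apply: le_trans (subadditive_mul _ _) _.
    apply: (@le_trans _ _ ((n %/ M)%:R * (M%:R * (inf_slope + e / 2)))).
      by rewrite ler_wpM2l.
    rewrite mulrA -natrM ler_wpM2r//; first by rewrite addr_ge0// ltW.
    by apply: le_trans nt; rewrite ler_nat leq_divM.
  apply: le_trans (a_le _) _; rewrite ler_wpM2r// ler_nat ltnW//.
  by rewrite ltn_mod.
have te0 := mulVf (lt0r_neq0 t0).
have -> : inf_slope - t^-1 * a n = t^-1 * (t * inf_slope - a n).
  by rewrite mulrBr mulrA te0 mul1r.
rewrite normrM gtr0_norm ?invr_gt0// mulrC ler_pdivrMr// ler_norml.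
have := mulr_ge0 (ler0n R M) C0.
move=> MC; apply/andP; split; lra.
Qed.

End subadditive.

Section time_constant.
Context (R : realType) (dO : measure_display)
    (Omega : measurableType dO) (P : probability Omega R) (d : nat)
    (tau : {fset 'rV[int]_d} -> {RV P >-> R}) (th0 K0 : R).
Hypothesis H : iid_weights tau th0 K0.
Local Notation V := 'rV[int]_d.
Variables (i0 : 'I_d).
Hypothesis i00 : i0 = 0%N :> nat.

Definition axis_pt (n : nat) : V := delta_mx 0 i0 *+ n.
Local Notation pt := axis_pt.

Lemma axis_ptD m n : pt (m + n) = pt m + pt n.
Proof. exact: mulrnDr. Qed.

Lemma axis_ptE n i : pt n 0 i = if i == i0 then n%:Z else 0.
Proof.
rewrite /axis_pt mulmxnE mxE eqxx /=.
by case: eqVneq => _; rewrite ?mul0rn ?natz.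
Qed.

Lemma axis_pt_adj x n : adjacent (x + pt n) (x + pt n.+1).
Proof.
rewrite -[n.+1]addn1 axis_ptD addrA.
exact: (adjacent_unit_vec (x + pt n) (i0, false)).
Qed.

Definition axis_edge (x : V) n : {fset V} := [fset (x + pt n)%R; (x + pt n.+1)%R]%fset.

Lemma axis_edge_edges x n : edges d (axis_edge x n).
Proof. exact/edges_adj/axis_pt_adj. Qed.

Lemma floor_axis t : 0 <= t -> floor_rV (t *: e1 R d) = pt (Num.truncn t).
Proof.
move=> t0; apply/rowP => i; rewrite !mxE axis_ptE.
have [->|ii0] := eqVneq i i0.
  by rewrite i00 eqxx mulr1 /= truncn_floor t0 gez0_abs// floor_ge0.
rewrite (_ : (i == 0%N :> nat) = false) ?mulr0 ?floor0//.
by rewrite -i00; apply/negbTE.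
Qed.

Lemma floor_rV0 : floor_rV (0 : 'rV[R]_d) = 0.
Proof. by apply/rowP => i; rewrite !mxE floor0. Qed.

Lemma weight_nneg w e : edges d e -> 0 <= tau e w.
Proof. by move=> eD; apply: (weight_ge0 H). Qed.

Lemma reach_axis w x n :
  reach (tau^~ w) x (x + pt n) (\sum_(j < n) tau (axis_edge x j) w).
Proof.
rewrite -{1}[x]addr0.
apply: (reach_sum (@weight_nneg w) (z := fun n => x + pt n)
  (c := fun j => tau (axis_edge x j) w)) => j _.
by apply: reach_adjacent; exact: axis_pt_adj.
Qed.

Definition T_axis n w := ptime (tau^~ w) 0 (pt n).

Lemma measurable_T_axis n : measurable_fun setT (T_axis n).
Proof.
apply: (measurable_ptime (X := tau)) => //.
by move=> e eD w; exact: weight_nneg.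
Qed.

Lemma T_axis_ge0 n w : 0 <= T_axis n w.
Proof. by apply: ptime_ge0 => e; exact: weight_nneg. Qed.

Lemma K0_ge0 : 0 <= K0.
Proof.
have := weight_exp H (axis_edge_edges 0 0); rewrite -lee_fin; apply: le_trans.
by apply: integral_ge0 => w _; rewrite lee_fin expR_ge0.
Qed.

(** x <= exp (th0 x) / th0. *)
Lemma mean_weight e : edges d e -> (\int[P]_w (tau e w)%:E <= (K0 / th0)%:E)%E.
Proof.
move=> eD; have th00 := th0_gt0 H.
rewrite mulrC EFinM.
apply: (@le_trans _ _ ((th0^-1)%:E * \int[P]_w (expR (th0 * tau e w))%:E)%E); last first.
  by rewrite lee_pmul2l ?lte_fin ?invr_gt0//; exact: weight_exp H _ eD.
have mexp : measurable_fun setT (fun w => (expR (th0 * tau e w))%:E).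
  by apply/measurable_EFinP; apply: measurableT_comp => //; apply: measurable_funM.
rewrite -(@ge0_integralZl _ _ _ P _ measurableT _ mexp); last 2 first.
- by move=> w _; rewrite lee_fin expR_ge0.
- by rewrite lee_fin invr_ge0 ltW.
apply: ge0_le_integral => //.
- by move=> w _; rewrite lee_fin; exact: weight_nneg.
- exact/measurable_EFinP.
- exact: measurable_funeM.
move=> w _; rewrite -EFinM lee_fin ler_pdivlMl//.
by rewrite (le_trans _ (expR_ge1Dx _))// lerDr.
Qed.

End time_constant.

Section time_constant_limit.
Context (R : realType) (dO : measure_display)
    (Omega : measurableType dO) (P : probability Omega R) (d : nat)
    (tau : {fset 'rV[int]_d} -> {RV P >-> R}) (th0 K0 : R).
Hypothesis H : iid_weights tau th0 K0.
Local Notation V := 'rV[int]_d.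
Variables (i0 : 'I_d).
Hypothesis i00 : i0 = 0%N :> nat.
Local Notation pt := (axis_pt i0).
Local Notation T := (T_axis tau i0).
Local Notation axis_edge := (axis_edge i0).
Local Notation weight_nneg := (weight_nneg H).

Definition mean_T n : R := fine (\int[P]_w (T n w)%:E).

Lemma integral_sum_weights (es : seq {fset V}) (f : R -> R) :
  measurable_fun setT f -> (forall e w, e \in es -> 0 <= f (tau e w)) ->
  (\int[P]_w (\sum_(e <- es) f (tau e w))%:E =
   \sum_(e <- es) \int[P]_w (f (tau e w))%:E)%E.
Proof.
move=> mf; elim: es => [|e es IH] f0.
  by rewrite big_nil; apply: integral0_eq => w _; rewrite big_nil.
rewrite big_cons -IH; last by move=> e' w ees; apply: f0; rewrite inE ees orbT.
have me' : measurable_fun setT (fun w => (f (tau e w))%:E).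
  by apply/measurable_EFinP; exact: measurableT_comp.
rewrite -ge0_integralD//.
- by apply: eq_integral => w _; rewrite big_cons.
- by move=> w _; rewrite lee_fin f0// inE eqxx.
- move=> w _; rewrite lee_fin big_seq sumr_ge0// => e' ees.
  by rewrite f0// inE ees orbT.
- apply/measurable_EFinP.
  apply: (measurable_sum_in (X := fun e w => f (tau e w))) => e' _.
  exact: measurableT_comp.
Qed.

Lemma integral_T_le n : (\int[P]_w (T n w)%:E <= (n%:R * (K0 / th0))%:E)%E.
Proof.
pose es := [seq axis_edge 0 j | j <- iota 0 n].
have esE w : \sum_(j < n) tau (axis_edge 0 j) w = \sum_(e <- es) tau e w.
  by rewrite big_map /index_iota -(big_mkord xpredT (fun j => tau (axis_edge 0 j) w))
    /index_iota subn0.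
apply: (@le_trans _ _ (\int[P]_w (\sum_(e <- es) tau e w)%:E)%E).
  apply: ge0_le_integral => //.
  - by move=> w _; rewrite lee_fin; exact: (T_axis_ge0 H).
  - by apply/measurable_EFinP; exact: (measurable_T_axis H).
  - apply/measurable_EFinP; exact: (measurable_sum_in (X := tau)).
  move=> w _; rewrite lee_fin -esE; apply: (ptime_le (weight_nneg w)).
  by have := reach_axis H i0 w 0 n; rewrite add0r.
rewrite (integral_sum_weights (f := id))//; last first.
  by move=> e w /mapP[j _ ->]; apply: weight_nneg; exact: axis_edge_edges.
rewrite big_map.
apply: (@le_trans _ _ (\sum_(j <- iota 0 n) (K0 / th0)%:E)%E).
  apply: lee_sum => j _; apply: (mean_weight H); exact: axis_edge_edges.
by rewrite sumEFin lee_fin big_const_seq count_predT size_iota iter_addr_0 mulr_natl.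
Qed.

Lemma integral_T_ge0 n : (0 <= \int[P]_w (T n w)%:E)%E.
Proof. by apply: integral_ge0 => w _; rewrite lee_fin (T_axis_ge0 H). Qed.

Lemma mean_TE n : (\int[P]_w (T n w)%:E = (mean_T n)%:E)%E.
Proof.
rewrite /mean_T fineK// ge0_fin_numE ?integral_T_ge0//.
exact: le_lt_trans (integral_T_le n) (ltry _).
Qed.

Lemma mean_T_ge0 n : 0 <= mean_T n.
Proof. by apply: fine_ge0; exact: integral_T_ge0. Qed.

Lemma mean_T_le n : mean_T n <= n%:R * (K0 / th0).
Proof. by rewrite -lee_fin -mean_TE integral_T_le. Qed.

(** Passing through pt m is one way to go from 0 to pt (m + n), and by
    translation invariance the second stage has the same mean as T n. *)
Lemma mean_T_sub m n : mean_T (m + n) <= mean_T m + mean_T n.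
Proof.
rewrite -lee_fin EFinD -!mean_TE.
(* passage times are measurable only in non-negative weights *)
pose f (c : {fset V} -> R) := ptime (fun e => Num.max (c e) 0) 0 (pt n).
have max0 w e : edges d e -> Num.max (tau e w) 0 = tau e w.
  by move=> eD; rewrite max_l// weight_nneg.
have ET w : f (tau^~ w) = T n w by apply: ptime_eq => e; exact: max0.
have mf : measurable_fun setT
    (f : sigma_of (fun (e : {fset V}) (c : {fset V} -> R) => c e) (edges d) -> R).
  apply: (measurable_ptime (T := sigma_of _ _)
    (X := fun e (c : {fset V} -> R) => Num.max (c e) 0)).
    by move=> e eD; apply: measurable_maxr => //; exact: measurable_coord.
  by move=> e _ c; rewrite le_max lexx orbT.
have f0 c : 0 <= f c by apply: ptime_ge0 => e _; rewrite le_max lexx orbT.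
have -> : (\int[P]_w (T n w)%:E =
    \int[P]_w (f (tau^~ w \o shift_edge (pt m)))%:E)%E.
  rewrite (integral_shift H)//.
  by apply: eq_integral => w _; rewrite ET.
have fE w : f (tau^~ w \o shift_edge (pt m)) = ptime (tau^~ w) (pt m) (pt (m + n)).
  rewrite /f (_ : ptime _ _ _ = ptime (tau^~ w \o shift_edge (pt m)) 0 (pt n)).
    by rewrite ptime_shift add0r addrC axis_ptD.
  by apply: ptime_eq => e eD; apply: max0; exact: edges_shift.
under [X in (_ <= _ + X)%E]eq_integral do rewrite fE.
have mS : measurable_fun setT (fun w => ptime (tau^~ w) (pt m) (pt (m + n))).
  by apply: (measurable_ptime (X := tau)) => // e eD w; exact: weight_nneg.
have mT k := measurable_T_axis H i0 k.
rewrite -ge0_integralD//.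
- apply: ge0_le_integral => //.
  + by move=> w _; rewrite lee_fin (T_axis_ge0 H).
  + exact/measurable_EFinP.
  + by apply: emeasurable_funD; exact/measurable_EFinP.
  move=> w _; rewrite -EFinD lee_fin; apply: (ptime_triangle (weight_nneg w)).
    by exists (\sum_(j < m) tau (axis_edge 0 j) w); have := reach_axis H i0 w 0 m;
      rewrite add0r.
  exists (\sum_(j < n) tau (axis_edge (pt m) j) w).
  by have := reach_axis H i0 w (pt m) n; rewrite -axis_ptD.
- by move=> w _; rewrite lee_fin (T_axis_ge0 H).
- exact/measurable_EFinP.
- by move=> w _; rewrite lee_fin; apply: ptime_ge0 => e; exact: weight_nneg.
- exact/measurable_EFinP.
Qed.

(** The means of the passage times along the axis are subadditive, so that the
    limit defining the time constant exists, and is their smallest slope. *)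
Lemma time_constantE : time_constant tau (e1 R d) = inf_slope mean_T.
Proof.
have cvg_mean : (((t^-1)%:E *
    'E_P[fun w => passage_time (fun e => tau e w) 0 (t *: e1 R d)])%E
      @[t --> +oo%R] --> (inf_slope mean_T)%:E)%E.
  apply: (@cvg_trans _ ((t^-1 * mean_T (Num.truncn t))%:E @[t --> +oo%R])).
    apply: near_eq_cvg; near=> t.
    have t0 : 0 <= t by near: t; exact: nbhs_pinfty_ge.
    rewrite unlock EFinM -mean_TE; congr (_ * _)%E.
    apply: eq_integral => w _.
    by rewrite passage_timeE floor_rV0 (floor_axis i00)//.
  apply: cvg_EFin; first by near=> t.
  apply/cvgrPdist_le => e e0.
  have [t0 [_ t0e]] := subadditive_cvg mean_T_ge0 mean_T_le mean_T_sub e0.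
  near=> t; apply: t0e; near: t; apply: nbhs_pinfty_ge; exact: num_real.
by rewrite /time_constant (cvg_lim _ cvg_mean).
Unshelve. all: end_near. Qed.

Local Notation mu := (time_constant tau (e1 R d)).

Lemma time_constant_ge0 : 0 <= mu.
Proof. by rewrite time_constantE; apply: inf_slope_ge0; exact: mean_T_ge0. Qed.

Lemma time_constant_le n : ((n%:R * mu)%:E <= \int[P]_w (T n w)%:E)%E.
Proof.
by rewrite time_constantE mean_TE lee_fin; apply: inf_slope_le; exact: mean_T_ge0.
Qed.

Lemma time_constant_approx e : 0 < e -> exists2 M, (0 < M)%N &
  (\int[P]_w (T M w)%:E <= (M%:R * (mu + e))%:E)%E.
Proof.
move=> e0; have [M M0 aM] := inf_slope_approx mean_T e0.
by exists M => //; rewrite mean_TE lee_fin time_constantE.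
Qed.

End time_constant_limit.

(** * Exponential Chebyshev bounds *)

Section exponential_bounds.
Context (R : realType) (dO : measure_display)
    (Omega : measurableType dO) (P : probability Omega R).

Lemma markov_event (A : set Omega) (f : Omega -> R) c : measurable A ->
  measurable_fun setT f -> (forall w, 0 <= f w) -> 0 < c ->
  (forall w, A w -> c <= f w) -> (P A <= (c^-1)%:E * \int[P]_w (f w)%:E)%E.
Proof.
move=> mA mf f0 c0 cf.
rewrite -(@ge0_integralZl _ _ _ P _ measurableT (EFin \o f))//; last 3 first.
- exact/measurable_EFinP.
- by move=> w _; rewrite lee_fin.
- by rewrite lee_fin invr_ge0 ltW.
rewrite -[P A]mul1e -integral_cst//.
rewrite integral_mkcond; apply: ge0_le_integral => //.
- by move=> w _; rewrite patchE; case: ifP.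
- by apply/measurable_restrict => //; exact: measurable_cst.
- by apply: measurable_funeM; exact/measurable_EFinP.
move=> w _; rewrite patchE -EFinM; case: ifPn => [|_].
  by rewrite inE => Aw; rewrite lee_fin mulrC ler_pdivlMr// mul1r cf.
by rewrite lee_fin mulr_ge0// invr_ge0 ltW.
Qed.

(** Equivalent to exp(y) (1 - y) <= 1, which is 1 - y <= exp(- y). *)
Lemma expR_le_quadratic (y : R) : 0 <= y -> expR y <= 1 + y + y ^+ 2 * expR y.
Proof.
move=> y0; have := expR_ge1Dx (- y); rewrite expRN => /(ler_wpM2r (expR_ge0 y)).
rewrite mulVf ?gt_eqF ?expR_gt0// => h.
have := ler_wpM2l (addr_ge0 ler01 y0) h; nra.
Qed.

(** To first order at 0 the Laplace transform of X is 1 + th E X, and the error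
    is of order th ^ 2, uniformly in X once an exponential moment is bounded.
    So a small th gives E exp(th X) <= exp(th (m + eta)), which is what makes
    Chernoff's bound effective above the mean m. *)
Lemma laplace_le (m eta th1 K1 : R) : 0 < eta -> 0 < th1 -> 0 <= K1 ->
  exists2 th, 0 < th & forall X : Omega -> R, measurable_fun setT X ->
    (forall w, 0 <= X w) -> (\int[P]_w (X w)%:E <= m%:E)%E ->
    (\int[P]_w (expR (th1 * X w))%:E <= K1%:E)%E ->
    (\int[P]_w (expR (th * X w))%:E <= (expR (th * (m + eta)))%:E)%E.
Proof.
move=> eta0 th10 K10.
(* x ^ 2 <= C exp (th1 x / 2), as y <= exp y at y = th1 x / 4 *)
pose C := (4 / th1) ^+ 2.
have C0 : 0 <= C by rewrite sqr_ge0.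
pose th := Num.min (th1 / 2) (eta / (C * K1 + 1)).
have D0 : 0 < C * K1 + 1 by rewrite ltr_wpDl// mulr_ge0.
have th0 : 0 < th by rewrite lt_min !divr_gt0.
exists th => // X mX X0 Xm XK.
have th_th1 : th <= th1 / 2 by rewrite ge_min lexx.
have th_eta : th * (C * K1) <= eta.
  have : th <= eta / (C * K1 + 1) by rewrite ge_min lexx orbT.
  rewrite ler_pdivlMr// => h; apply: le_trans h.
  by rewrite ler_wpM2l ?(ltW th0)// lerDl.
have pt x : 0 <= x -> expR (th * x) <= 1 + th * x + th ^+ 2 * C * expR (th1 * x).
  move=> x0; have tx0 : 0 <= th * x by rewrite mulr_ge0// ltW.
  apply: le_trans (expR_le_quadratic tx0) _; rewrite lerD2l.
  suff h : x ^+ 2 * expR (th * x) <= C * expR (th1 * x).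
    rewrite exprMn -(mulrA (th ^+ 2) (x ^+ 2)) -(mulrA (th ^+ 2) C).
    by rewrite ler_wpM2l ?sqr_ge0.
  have -> : th1 * x = th1 / 4 * x + th1 / 4 * x + th1 / 2 * x by lra.
  rewrite !expRD.
  have e4 : th1 / 4 * x <= expR (th1 / 4 * x).
    by rewrite (le_trans _ (expR_ge1Dx _))// lerDr.
  have e40 : 0 <= th1 / 4 * x by rewrite mulr_ge0// divr_ge0// ltW.
  have -> : x ^+ 2 = C * (th1 / 4 * x) ^+ 2.
    by rewrite /C; field; rewrite gt_eqF.
  rewrite -(mulrA C); apply: ler_wpM2l => //.
  apply: ler_pM; rewrite ?sqr_ge0 ?expR_ge0//.
  - by rewrite expr2; apply: ler_pM.
  - by rewrite ler_expR ler_wpM2r.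
pose g w := 1 + th * X w + th ^+ 2 * C * expR (th1 * X w).
have mE : measurable_fun setT (fun w => expR (th1 * X w)).
  by apply: measurableT_comp => //; exact: measurable_funM.
apply: (@le_trans _ _ (\int[P]_w (g w)%:E)%E).
  apply: ge0_le_integral => //.
  - by apply/measurable_EFinP; apply: measurableT_comp => //; exact: measurable_funM.
  - apply/measurable_EFinP; apply: measurable_funD; last exact: measurable_funM.
    by apply: measurable_funD => //; exact: measurable_funM.
  by move=> w _; rewrite lee_fin; exact: pt.
have -> : (\int[P]_w (g w)%:E = 1 + th%:E * \int[P]_w (X w)%:E +
   (th ^+ 2 * C)%:E * \int[P]_w (expR (th1 * X w))%:E)%E.
  have th2C : 0 <= th ^+ 2 * C by rewrite mulr_ge0// sqr_ge0.
  rewrite -(@ge0_integralZl _ _ _ P _ measurableT (EFin \o X))//; last 3 first.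
  - exact/measurable_EFinP.
  - by move=> w _; rewrite lee_fin.
  - by rewrite lee_fin ltW.
  rewrite -(@ge0_integralZl _ _ _ P _ measurableT (EFin \o (fun w => expR (th1 * X w))))//;
    last 2 first.
  - exact/measurable_EFinP.
  - by move=> w _; rewrite lee_fin expR_ge0.
  have one : (\int[P]_w (1 : R)%:E = 1%:E)%E.
    by rewrite integral_cst//= probability_setT mule1.
  rewrite -[X in _ = (X + _ + _)%E]one.
  rewrite -ge0_integralD//; last 2 first.
  - by move=> w _; rewrite mule_ge0// lee_fin// ltW.
  - by apply: measurable_funeM; exact/measurable_EFinP.
  rewrite -ge0_integralD//.
  - by move=> w _; rewrite adde_ge0// mule_ge0// lee_fin// ltW.
  - by apply: emeasurable_funD => //; apply: measurable_funeM; exact/measurable_EFinP.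
  - by move=> w _; rewrite mule_ge0// lee_fin// expR_ge0.
  - by apply: measurable_funeM; exact/measurable_EFinP.
apply: (@le_trans _ _ (1 + th%:E * m%:E + (th ^+ 2 * C)%:E * K1%:E)%E).
  apply: leeD; first by rewrite leeD2l// lee_pmul2l// lte_fin.
  by apply: lee_wpmul2l => //; rewrite lee_fin mulr_ge0// sqr_ge0.
rewrite -!EFinM -!EFinD lee_fin -addrA; apply: le_trans (expR_ge1Dx _) _.
have -> : th ^+ 2 * C * K1 = th * (th * (C * K1)) by rewrite expr2 !mulrA.
by rewrite ler_expR mulrDr lerD2l; apply: ler_wpM2l => //; exact: ltW.
Qed.

End exponential_bounds.

Lemma measurable_gt_event (R : realType) dT (T : measurableType dT) (f : T -> R) s :
  measurable_fun setT f -> measurable [set w | s < f w].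
Proof.
move=> mf; rewrite (_ : [set _ | _] = f @^-1` `]s, +oo[).
  by rewrite -[X in measurable X]setTI; exact: mf.
by apply/seteqP; split => w /=; rewrite in_itv/= andbT.
Qed.

Section chernoff.
Context (R : realType) (dO : measure_display)
    (Omega : measurableType dO) (P : probability Omega R)
    (I : choiceType) (D : set I) (X : I -> {RV P >-> R}).
Hypothesis indX : independent_family D X.

Lemma prode_le (n : nat) (a : nat -> \bar R) (rho : R) :
  (forall k, (k < n)%N -> (0 <= a k)%E) ->
  (forall k, (k < n)%N -> (a k <= rho%:E)%E) ->
  (\prod_(k < n) a k <= (rho ^+ n)%:E)%E.
Proof.
elim: n => [|n IH] a0 ar; first by rewrite big_ord0.
rewrite big_ord_recr exprSr EFinM/=; apply: lee_pmul.
- by apply: prode_ge0 => k _; apply: a0; rewrite ltnS ltnW.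
- exact: a0.
- by apply: IH => k kn; [apply: a0|apply: ar]; rewrite ltnS ltnW.
- exact: ar.
Qed.

Lemma markov_prod (J : nat -> set I) (g : nat -> Omega -> R) (A : set Omega) q c rho :
  (forall n, J n `<=` D) -> (forall m n, m != n -> J m `&` J n = set0) ->
  (forall k, measurable_fun setT (g k : sigma_of X (J k) -> R)) ->
  (forall k w, 0 <= g k w) ->
  (forall k, (k < q)%N -> (\int[P]_w (g k w)%:E <= rho%:E)%E) ->
  measurable A -> 0 < c -> (forall w, A w -> c <= \prod_(k < q) g k w) ->
  (P A <= (c^-1 * rho ^+ q)%:E)%E.
Proof.
move=> JD tJ mg g0 gr mA c0 cA.
apply: (@le_trans _ _ ((c^-1)%:E * \int[P]_w (\prod_(k < q) g k w)%:E)%E).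
  apply: markov_event => //; last by move=> w; exact: prodr_ge0.
  rewrite [X in measurable_fun _ X](_ : _ =
      (fun w => \prod_(k <- index_iota 0 q) g k w)); last first.
    by apply/funext => w; rewrite big_mkord.
  apply: measurable_prod => k _; exact: sigma_of_measurable_fun (mg k).
rewrite (expectation_prod indX JD tJ q mg g0) EFinM lee_pmul2l ?lte_fin ?invr_gt0//.
apply: (prode_le (a := fun k => \int[P]_w (g k w)%:E)%E) => // k kq.
by apply: integral_ge0 => w _; rewrite lee_fin.
Qed.

Lemma chernoff (J : nat -> set I) (Y : nat -> Omega -> R) th q rho s :
  (forall n, J n `<=` D) -> (forall m n, m != n -> J m `&` J n = set0) ->
  (forall k, measurable_fun setT (Y k : sigma_of X (J k) -> R)) -> 0 < th ->
  (forall k, (\int[P]_w (expR (th * Y k w))%:E <= rho%:E)%E) ->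
  (P [set w | (s < \sum_(k < q) Y k w)%R] <= (expR (- (th * s)) * rho ^+ q)%:E)%E.
Proof.
move=> JD tJ mY th0 Yr; rewrite expRN.
apply: (markov_prod (J := J) (g := fun k w => expR (th * Y k w))) => [//|//|k|k w||||w /= sY].
- apply: (measurableT_comp (T1 := sigma_of X (J k))) => //.
  exact: (measurable_funM (T := sigma_of X (J k))).
- exact: expR_ge0.
- by move=> k _; exact: Yr.
- have mS : measurable_fun setT (fun w => \sum_(k < q) Y k w).
    apply: (@measurable_sum _ _ R setT _ _ (fun k : 'I_q => Y k)) => k.
    exact: sigma_of_measurable_fun (mY k).
  exact: measurable_gt_event.
- exact: expR_gt0.
- rewrite -expR_sum ler_expR -mulr_sumr ler_wpM2l//; exact: ltW.
Qed.

End chernoff.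

Section sum_tail.
Context (R : realType) (dO : measure_display)
    (Omega : measurableType dO) (P : probability Omega R) (d : nat)
    (tau : {fset 'rV[int]_d} -> {RV P >-> R}) (th0 K0 : R).
Hypothesis H : iid_weights tau th0 K0.
Local Notation V := 'rV[int]_d.

Lemma measurable_sum_event (F : seq {fset V}) s :
  measurable [set w | s < \sum_(e <- F) tau e w].
Proof.
have mS : measurable_fun setT (fun w => \sum_(e <- F) tau e w).
  exact: (measurable_sum_in (X := tau)).
exact: measurable_gt_event.
Qed.

(** Chebyshev's inequality for the product of the exponentials of the weights,
    on the event that all of them lie in B: a law whose tail becomes
    heavier beyond some scale can thus be treated as light up to that scale. *)
Lemma sum_tail (th beta K s : R) (B : set R) (F : seq {fset V}) : 0 < th ->
  measurable B -> uniq F -> (forall e, e \in F -> edges d e) ->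
  (forall e, edges d e -> (P (tau e @^-1` (~` B)) <= beta%:E)%E) ->
  (forall e, edges d e ->
     (\int[P]_w (expR (th * tau e w) * \1_B (tau e w))%:E <= K%:E)%E) ->
  (P [set w | (s < \sum_(e <- F) tau e w)%R] <=
    ((size F)%:R * beta + expR (- (th * s)) * K ^+ size F)%:E)%E.
Proof.
move=> th_gt0 mB uF FD Pb EK.
pose S := [set w | s < \sum_(e <- F) tau e w].
have mS : measurable S by exact: measurable_sum_event.
pose U := \bigcup_(e in [set` F]) (tau e @^-1` (~` B)).
have mU : measurable U.
  apply: fin_bigcup_measurable; first exact: finite_seq.
  by move=> e _; apply: measurable_funPTI => //; exact: measurableC.
have PU : (P U <= ((size F)%:R * beta)%:E)%E.
  rewrite /U {mU U mS S uF}; elim: F FD => [|e F IH] FD.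
    by rewrite mul0r (_ : \bigcup_(_ in _) _ = set0) ?measure0//; apply/seteqP; split => // w [].
  rewrite (_ : \bigcup_(_ in _) _ = tau e @^-1` (~` B) `|`
     \bigcup_(f in [set` F]) tau f @^-1` (~` B)); last first.
    apply/seteqP; split => w.
      move=> [f /=]; rewrite inE => /orP[/eqP ->|fF] fB; first by left.
      by right; exists f.
    case=> [wB|[f fF fB]]; first by exists e => //=; rewrite inE eqxx.
    by exists f => //=; rewrite inE /= (fF : f \in F) orbT.
  have mUe f : measurable (tau f @^-1` (~` B)).
    by apply: measurable_funPTI => //; exact: measurableC.
  apply: (le_trans (measureU2 _ _ _)) => //.
    by apply: fin_bigcup_measurable => //; exact: finite_seq.
  have -> : (size (e :: F))%:R * beta = beta + (size F)%:R * beta.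
    by rewrite /= -natr1 mulrDl mul1r addrC.
  rewrite EFinD; apply: leeD.
    by apply: Pb; apply: FD; rewrite inE eqxx.
  by apply: IH => f fF; apply: FD; rewrite inE fF orbT.
pose g (x : R) := expR (th * x) * \1_B x.
have g0 x : 0 <= g x by rewrite mulr_ge0// expR_ge0.
have mg : measurable_fun setT g.
  apply: measurable_funM => //.
  by apply: measurableT_comp => //; exact: measurable_funM.
pose e0 : {fset V} := fset0.
pose J k := if (k < size F)%N then [set nth e0 F k] else set0.
pose G k w := if (k < size F)%N then g (tau (nth e0 F k) w) else 0.
have PSU : (P (S `\` U) <= (expR (- (th * s)) * K ^+ size F)%:E)%E.
  rewrite expRN; apply: (markov_prod (weight_indep H) (J := J) (g := G)) => //.
  - move=> k e; rewrite /J; case: ifP => // kF ->; apply: FD; exact: mem_nth.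
  - move=> k l kl; rewrite /J; case: ifPn => kF; case: ifPn => lF;
      rewrite ?setI0 ?set0I//.
    apply/seteqP; split=> // e []; rewrite /set1/= => -> E.
    by move: kl; rewrite -(nth_uniq e0 kF lF uF) E eqxx.
  - move=> k; rewrite /G; case kF: (k < size F)%N; last exact: measurable_cst.
    apply: (measurableT_comp mg).
    by apply: measurable_coord; rewrite /J kF.
  - by move=> k w; rewrite /G; case: ifP.
  - by move=> k kF; rewrite /G kF; apply: EK; apply: FD; exact: mem_nth.
  - exact: measurableD.
  - exact: expR_gt0.
  - move=> w [/= sw nU].
    have -> : \prod_(k < size F) G k w = \prod_(e <- F) g (tau e w).
      rewrite (big_nth e0) big_mkord; apply: eq_bigr => k _.
      by rewrite /G ltn_ord.
    have -> : \prod_(e <- F) g (tau e w) = \prod_(e <- F) expR (th * tau e w).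
      apply: eq_big_seq => e eF; rewrite /g indicE mem_set ?mulr1//.
      by apply: contrapT => nB; apply: nU; exists e.
    by rewrite -expR_sum ler_expR -mulr_sumr ler_wpM2l// ltW.
apply: (@le_trans _ _ (P (U `|` (S `\` U)))).
  apply: le_measure; rewrite ?inE//.
    by apply: measurableU => //; exact: measurableD.
  by move=> w Sw; have [Uw|nUw] := pselect (U w); [left|right].
apply: (le_trans (measureU2 _ _ _)) => //; first exact: measurableD.
by rewrite EFinD leeD.
Qed.

End sum_tail.

(** * Passage times along finitely many paths *)

Section block.
Context (R : realType) (d : nat).
Local Notation V := 'rV[int]_d.
Implicit Types (u : nat -> seq V) (c : {fset V} -> R).

(** The infimum over the paths u 0, ..., u n: unlike the passage time it depends
    on finitely many edges only. *)
Fixpoint min_time c x u n : R :=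
  if n is m.+1 then Num.min (min_time c x u m) (path_time c x (u n))
  else path_time c x (u 0%N).

Lemma min_time_le0 c x u n : min_time c x u n <= path_time c x (u 0%N).
Proof. by elim: n => [//|n IH] /=; rewrite ge_min IH. Qed.

Lemma min_time_le c x u k n : (k <= n)%N -> min_time c x u n <= path_time c x (u k).
Proof.
elim: n => [|n IH]; first by rewrite leqn0 => /eqP ->.
by rewrite leq_eqVlt => /orP[/eqP ->|/IH kn] /=; rewrite ge_min ?lexx ?orbT// kn.
Qed.

Lemma min_time_ex c x u n : exists2 k, (k <= n)%N & min_time c x u n = path_time c x (u k).
Proof.
elim: n => [|n [k kn E]]; first by exists 0%N.
rewrite /= minElt; case: ifP => _; last by exists n.+1.
by exists k => //; rewrite ltnW.
Qed.

Lemma reach_min_time c x y u n : (forall k, valid_path x y (u k)) ->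
  reach c x y (min_time c x u n).
Proof. by move=> uv; have [k _ ->] := min_time_ex c x u n; exists (u k). Qed.

Lemma min_time_ge0 c x y u n : (forall e, edges d e -> 0 <= c e) ->
  (forall k, valid_path x y (u k)) -> 0 <= min_time c x u n.
Proof.
move=> c0 uv; have [k _ ->] := min_time_ex c x u n.
by apply: path_time_ge0 => //; have /andP[] := uv k.
Qed.

Lemma measurable_min_time dT (T : measurableType dT) (X : {fset V} -> T -> R) x u n :
  (forall k e, (k <= n)%N -> e \in path_edges x (u k) -> measurable_fun setT (X e)) ->
  measurable_fun setT (fun t => min_time (X^~ t) x u n).
Proof.
elim: n => [|n IH] mX /=; first by apply: measurable_path_time => e; exact: mX.
apply: measurable_minr; last by apply: measurable_path_time => e; exact: mX.
by apply: IH => k e kn; apply: mX; rewrite (leq_trans kn).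
Qed.

(** A decreasing sequence that eventually uses any given path. *)
Lemma min_time_cvg c x y u : (forall e, edges d e -> 0 <= c e) ->
  (forall k, valid_path x y (u k)) ->
  (forall p, valid_path x y p -> exists n, u n = p) ->
  min_time c x u @ \oo --> ptime c x y.
Proof.
move=> c0 uv us; apply/cvgrPdist_le => e e0.
have [p pv pe] : reach c x y (ptime c x y + e).
  apply: ptime_reach; last by rewrite ltrDl.
  by exists (path_time c x (u 0%N)), (u 0%N).
have [n un] := us p pv.
exists n => // k /= nk; rewrite distrC ger0_norm ?subr_ge0.
  rewrite lerBlDl; apply: le_trans pe; rewrite -un; exact: min_time_le.
by apply: (ptime_le c0); exact: reach_min_time.
Qed.

Lemma paths_bounded (x : V) u n : exists L : nat, forall k e t i, (k <= n)%N ->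
  e \in path_edges x (u k) -> t \in e -> `|t 0 i| <= L%:Z.
Proof.
have bnd (s : seq V) : exists L : nat, forall t i, t \in s -> `|t 0 i| <= L%:Z.
  elim: s => [|a s [L sL]]; first by exists 0%N.
  exists (L + \sum_(j < d) `|a ord0 j|)%N => t i; rewrite inE => /orP[/eqP ->|ts].
    by rewrite (bigD1 i)//= -abszE lez_nat addnCA leq_addr.
  by apply: le_trans (sL t i ts) _; rewrite lez_nat leq_addr.
have [L sL] := bnd (flatten [seq x :: u k | k <- iota 0 n.+1]).
exists L => k e t i kn eu te; apply: sL; apply/flattenP; exists (x :: u k).
  by apply: map_f; rewrite mem_iota.
exact: path_edges_vertices eu te.
Qed.

End block.

Section block_mean.
Context (R : realType) (dO : measure_display)
    (Omega : measurableType dO) (P : probability Omega R) (d : nat)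
    (tau : {fset 'rV[int]_d} -> {RV P >-> R}) (th0 K0 : R).
Hypothesis H : iid_weights tau th0 K0.
Variables (i0 : 'I_d).
Hypothesis i00 : i0 = 0%N :> nat.
Local Notation pt := (axis_pt i0).
Local Notation T := (T_axis tau i0).
Local Notation mu := (time_constant tau (e1 R d)).
Local Notation axis_edge := (axis_edge i0).

(** A sum of n terms is at most n times its largest term. So an
    exponential moment of a sum is controlled by those of its terms. *)
Lemma expR_sum_le (n : nat) (x : 'I_n -> R) : (0 < n)%N ->
  expR (\sum_j x j) <= \sum_j expR (n%:R * x j).
Proof.
move=> n0; have [j xj] : exists j, \sum_k x k <= n%:R * x j.
  apply/existsP; apply/contraT; rewrite negb_exists => /forallP h.
  have : \sum_(j < n) n%:R * x j < \sum_(j < n) \sum_k x k.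
    apply: ltr_sum; first by apply/hasP; exists (Ordinal n0); rewrite ?mem_index_enum.
    by move=> j _; rewrite ltNge.
  by rewrite -mulr_sumr [X in _ < X]sumr_const card_ord mulr_natl ltxx.
rewrite [leRHS](bigD1 j)//= ler_wpDr ?ler_expR//.
by apply: sumr_ge0 => k _; exact: expR_ge0.
Qed.

(** Fix M with E T(0, pt M) close to M mu, and enumerate the paths from 0 to
    pt M, starting with the straight one. By dominated convergence the mean of
    the minimum over the first n of them is close to E T(0, pt M) for n large.
    The exponential moment comes from the straight path. *)
Lemma block_exists e : 0 < e -> exists M u n,
  [/\ (0 < M)%N, forall k, valid_path 0 (pt M) (u k),
   (\int[P]_w (min_time (tau^~ w) 0 u n)%:E <= (M%:R * (mu + e))%:E)%E &
   (\int[P]_w (expR (th0 / M%:R * min_time (tau^~ w) 0 u n))%:E <=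
      (M%:R * K0)%:E)%E].
Proof.
move=> e0; have e20 : 0 < e / 2 by rewrite divr_gt0.
have [M M0 ETM] := time_constant_approx H i00 e20.
have M0' : 0 < M%:R :> R by rewrite ltr0n.
pose p0 := [seq pt j.+1 | j <- iota 0 M].
have p0_path m x : path (@adjacent d) (pt m) [seq pt j.+1 | j <- iota m x].
  elim: x m => [//|x IH] m /=; rewrite IH andbT.
  by have := axis_pt_adj i0 0 m; rewrite !add0r.
have p0_last m x : last (pt m) [seq pt j.+1 | j <- iota m x] = pt (m + x).
  elim: x m => [|x IH] m /=; first by rewrite addn0.
  by rewrite IH addSnnS.
have p0_edges m x : path_edges (pt m) [seq pt j.+1 | j <- iota m x] =
    [seq axis_edge 0 j | j <- iota m x].
  by elim: x m => [//|x IH] m /=; rewrite IH /axis_edge !add0r.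
have p0v : valid_path 0 (pt M) p0.
  have := p0_path 0%N M; rewrite /valid_path /axis_pt mulr0n => -> /=.
  by have := p0_last 0%N M; rewrite /axis_pt mulr0n => ->.
have [u [u0 uv us]] := valid_path_enum p0v.
pose X n w := min_time (tau^~ w) 0 u n.
have mX n : measurable_fun setT (X n).
  exact: (measurable_min_time (X := tau)).
have X0 n w : 0 <= X n w.
  by apply: (min_time_ge0 _ _ uv) => e'; exact: (weight_nneg H).
have Xle n w : X n w <= \sum_(j < M) tau (axis_edge 0 j) w.
  apply: le_trans (min_time_le0 _ _ _ _) _; rewrite u0.
  apply: (@le_trans _ _ (\sum_(e <- path_edges 0 p0) tau e w)).
    apply: sum_sub_seq; rewrite ?undup_uniq//.
      by move=> f; rewrite mem_undup.
    move=> f fp; apply: (weight_nneg H); apply: path_edges_edges fp.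
    by have /andP[] := p0v.
  have := p0_edges 0%N M; rewrite {1}/axis_pt mulr0n => ->.
  rewrite big_map -(big_mkord xpredT (fun j => tau (axis_edge 0 j) w)).
  by rewrite /index_iota subn0.
have mS : measurable_fun setT (fun w => \sum_(j < M) tau (axis_edge 0 j) w).
  exact: measurable_sum.
have cvgX : (\int[P]_w (X n w)%:E @[n --> \oo] --> \int[P]_w (T M w)%:E)%E.
  have := @dominated_convergence _ _ _ P setT measurableT (fun n w => (X n w)%:E)
    (fun w => (T M w)%:E) (fun w => (X 0%N w)%:E).
  case.
  - by move=> n; exact/measurable_EFinP.
  - by apply/measurable_EFinP; exact: (measurable_T_axis H).
  - apply/aeW => w _; apply: cvg_EFin; first by near=> n.
    by apply: min_time_cvg uv us => e'; exact: (weight_nneg H).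
  - apply/integrableP; split; first exact/measurable_EFinP.
    apply: (@le_lt_trans _ _ (\int[P]_w (\sum_(j < M) tau (axis_edge 0 j) w)%:E)%E).
      apply: ge0_le_integral => //.
      + by apply: measurableT_comp => //; exact/measurable_EFinP.
      + exact/measurable_EFinP.
      + by move=> w _; rewrite /= ger0_norm// lee_fin.
    pose es := [seq axis_edge 0 j | j <- iota 0 M].
    under eq_integral => w _ do
      rewrite -(big_mkord xpredT (fun j => tau (axis_edge 0 j) w)) /index_iota subn0
        -(big_map (axis_edge 0) xpredT (fun e => tau e w)).
    rewrite (integral_sum_weights (f := id))//; last first.
      by move=> f w /mapP[j _ ->]; apply: (weight_nneg H); exact: axis_edge_edges.
    rewrite big_map big_seq; apply: lte_sum_pinfty => j _.
    exact: le_lt_trans (mean_weight H (axis_edge_edges i0 0 j)) (ltry _).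
  - apply/aeW => w n _; rewrite /= ger0_norm// lee_fin.
    exact: min_time_le0.
  by move=> _ _ ; apply.
have [n Xn] : exists n, (\int[P]_w (X n w)%:E <= (M%:R * (mu + e))%:E)%E.
  have lt : (\int[P]_w (T M w)%:E < (M%:R * (mu + e))%:E)%E.
    by apply: le_lt_trans ETM _; rewrite lte_fin ltr_pM2l// ltrD2l ltr_pdivrMr// ltr_pMr// ltr1n.
  apply: contrapT => /forallNP Xn; move: lt; rewrite ltNge => /negP; apply.
  rewrite -(cvg_lim _ cvgX)//; apply: lime_ge.
    by apply/cvg_ex; eexists; exact: cvgX.
  by near=> k; have /negP := Xn k; rewrite -ltNge => /ltW.
exists M, u, n; split => //.
apply: (@le_trans _ _ (\int[P]_w (\sum_(j < M) expR (th0 * tau (axis_edge 0 j) w))%:E)%E).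
  apply: ge0_le_integral => //.
  - apply/measurable_EFinP; apply: measurableT_comp => //.
    by apply: measurable_funM => //; exact: (mX n).
  - apply/measurable_EFinP; apply: measurable_sum => j.
    by apply: measurableT_comp => //; exact: measurable_funM.
  move=> w _; rewrite lee_fin.
  apply: (@le_trans _ _ (expR (\sum_(j < M) th0 / M%:R * tau (axis_edge 0 j) w))).
    rewrite ler_expR -mulr_sumr ler_wpM2l ?Xle// divr_ge0// ltW//.
    exact: th0_gt0 H.
  apply: le_trans (expR_sum_le _ M0) _; rewrite le_eqVlt; apply/orP; left; apply/eqP.
  apply: eq_bigr => j _; congr expR; field; exact: lt0r_neq0.
under eq_integral => w _ do
  rewrite -(big_mkord xpredT (fun j => expR (th0 * tau (axis_edge 0 j) w))) /index_iota subn0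
        -(big_map (axis_edge 0) xpredT (fun e => expR (th0 * tau e w))).
rewrite (integral_sum_weights (f := fun x => expR (th0 * x))); last 2 first.
- by apply: measurableT_comp => //; exact: measurable_funM.
- by move=> f w _; exact: expR_ge0.
rewrite big_map.
apply: (@le_trans _ _ (\sum_(j <- iota 0 M) K0%:E)%E).
  apply: lee_sum => j _; apply: (weight_exp H); exact: axis_edge_edges.
by rewrite sumEFin lee_fin big_const_seq count_predT size_iota iter_addr_0 mulr_natl.
Unshelve. all: end_near. Qed.

End block_mean.

(** * Fast crossings of thin tubes *)

Lemma multiples_apart (L a r l l' : nat) : (L + L < a)%N -> l != l' ->
  (L + L)%:Z < `|(l * a + r)%:Z - (l' * a + r)%:Z|.
Proof.
move=> La; wlog ll' : l l' / (l < l')%N => [h|_].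
  by rewrite neq_ltn => /orP[] ll'; [|rewrite distrC];
    apply: h; rewrite // ?neq_ltn ll'.
have -> : l' = (l + (l' - l.+1).+1)%N by lia.
move: (l' - l.+1)%N => k.
have -> : ((l + k.+1) * a + r = (l * a + r) + (a + k * a))%N.
  by rewrite mulnDl mulSn addnAC.
rewrite [X in _ - X]PoszD opprD addrA subrr sub0r normrN ger0_norm// ltz_nat.
by rewrite (leq_trans La)// leq_addr.
Qed.

Section tube.
Context (R : realType) (dO : measure_display)
    (Omega : measurableType dO) (P : probability Omega R) (d : nat)
    (tau : {fset 'rV[int]_d} -> {RV P >-> R}) (th0 K0 : R).
Local Notation V := 'rV[int]_d.
Variables (i0 : 'I_d).
Local Notation pt := (axis_pt i0).
Local Notation mu := (time_constant tau (e1 R d)).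
Local Notation axis_edge := (axis_edge i0).

(** Edges within distance L of the line through y parallel to the axis. *)
Definition tube (L : nat) (y : V) : set {fset V} :=
  [set e | edges d e /\
     forall t i, t \in e -> i != i0 -> `|t 0 i - y 0 i| <= L%:Z].

Definition cube (L : nat) (y : V) : set {fset V} :=
  [set e | edges d e /\ forall t i, t \in e -> `|t 0 i - y 0 i| <= L%:Z].

Lemma edges_neq0 (e : {fset V}) : edges d e -> exists t, t \in e.
Proof. by move=> [x [y [_ ->]]]; exists x; rewrite !inE eqxx. Qed.

Lemma tube_disjoint L (y y' : V) i : i != i0 -> (L + L)%:Z < `|y 0 i - y' 0 i| ->
  tube L y `&` tube L y' = set0.
Proof.
move=> ii0 yy'; apply/seteqP; split=> // e [[eD ey] [_ ey']].
have [t te] := edges_neq0 eD.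
by have := ey t i te ii0; have := ey' t i te ii0; move: yy'; lia.
Qed.

Lemma cube_disjoint L (y y' : V) i : (L + L)%:Z < `|y 0 i - y' 0 i| ->
  cube L y `&` cube L y' = set0.
Proof.
move=> yy'; apply/seteqP; split=> // e [[eD ey] [_ ey']].
have [t te] := edges_neq0 eD.
by have := ey t i te; have := ey' t i te; move: yy'; lia.
Qed.

Lemma cube_tube L y m : cube L (y + pt m) `<=` tube L y.
Proof.
move=> e [eD ey]; split => // t i te ii0.
by have := ey t i te; rewrite mxE axis_ptE (negPf ii0) addr0.
Qed.

Lemma axis_edge_inj (x : V) : injective (axis_edge x).
Proof.
move=> a b /fsetP ab.
have inE' j f : (x + pt j)%R \in axis_edge x f -> (j = f) \/ (j = f.+1).
  by rewrite !inE => /orP[] /eqP /addrI /rowP /(_ i0); rewrite !axis_ptE eqxx => -[];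
    [left|right].
have aa j : (x + pt j)%R \in axis_edge x j by rewrite !inE eqxx.
have := ab (x + pt a); rewrite aa => /esym/inE'.
have := ab (x + pt b); rewrite aa => /inE'; lia.
Qed.

Lemma axis_edge_tube L y m k : tube L y (axis_edge (y + pt m) k).
Proof.
split; first exact: axis_edge_edges.
by move=> t i; rewrite !inE => /orP[] /eqP -> ii0;
  rewrite !mxE !axis_ptE (negPf ii0) !addr0 subrr normr0.
Qed.

Lemma probability_bigcup_le (B : nat -> set Omega) m b :
  (forall k, (k < m)%N -> measurable (B k)) ->
  (forall k, (k < m)%N -> (P (B k) <= b%:E)%E) ->
  (P (\bigcup_(k < m) B k) <= (m%:R * b)%:E)%E.
Proof.
elim: m => [|m IH] mB Pb.
  by rewrite bigcup_mkord big_ord0 measure0 mul0r.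
rewrite bigcup_mkord big_ord_recr/= -bigcup_mkord.
have mU : measurable (\bigcup_(k < m) B k).
  apply: fin_bigcup_measurable; first exact: finite_II.
  by move=> k /= km; apply: mB; rewrite ltnS ltnW.
apply: (le_trans (measureU2 _ _ _)) => //; first exact: mB.
rewrite -natr1 mulrDl mul1r EFinD; apply: leeD; last exact: Pb.
by apply: IH => k km; [apply: mB|apply: Pb]; rewrite ltnS ltnW.
Qed.

(** Multiplicative constants are absorbed by any loss in the exponential rate. *)
Lemma exp_absorb (C c c1 c2 : R) : c < c1 -> c < c2 -> 0 <= C -> exists n0,
  forall n : nat, (n0 <= n)%N ->
   C * expR (- (c1 * n%:R)) + C * expR (- (c2 * n%:R)) <= expR (- (c * n%:R)).
Proof.
move=> cc1 cc2 C0; pose dl := Num.min (c1 - c) (c2 - c).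
have dl0 : 0 < dl by rewrite lt_min !subr_gt0 cc1.
exists (Num.truncn (dl^-1 * (2 * C))).+1 => n nn0.
have nC : 2 * C * expR (- (dl * n%:R)) <= 1.
  rewrite expRN ler_pdivrMr ?expR_gt0// mul1r.
  apply: le_trans (_ : dl * n%:R <= _); last first.
    by rewrite (le_trans _ (expR_ge1Dx _))// lerDr.
  rewrite -ler_pdivrMl//; apply: ltW; apply: lt_le_trans (truncnS_gt _) _.
  by rewrite ler_nat.
have h ci : dl <= ci - c ->
    C * expR (- (ci * n%:R)) <= C * expR (- (dl * n%:R)) * expR (- (c * n%:R)).
  move=> dci; rewrite -mulrA -expRD ler_wpM2l// ler_expR -opprD lerN2 -mulrDl.
  by rewrite ler_wpM2r// -lerBrDr.
have h1 : dl <= c1 - c by rewrite ge_min lexx.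
have h2 : dl <= c2 - c by rewrite ge_min lexx orbT.
apply: le_trans (lerD (h _ h1) (h _ h2)) _.
rewrite -mulrDl -[leRHS]mul1r ler_wpM2r ?expR_ge0//.
by move: nC; rewrite -mulrA mulr2n mulrDl !mul1r.
Qed.

Hypothesis H : iid_weights tau th0 K0.
Hypothesis i00 : i0 = 0%N :> nat.

(** Cut the segment into blocks of length M, and cross each of them along the
    best of the finitely many translated paths of [block_exists]. These stay
    within distance L, whence the tube, and blocks whose indices agree modulo
    m = 2L + 1 use disjoint cubes. If the crossing is slow, then so is one of the
    m classes of blocks, or the remainder of the division of n by m M, which is
    crossed along the axis. Chernoff's bound applies to each class, whose terms
    are independent with mean close to M mu. *)
Lemma tube_crossing e : 0 < e -> exists c (L n0 : nat) (Z : nat -> V -> Omega -> R),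
  [/\ 0 < c,
   forall n y, measurable_fun setT (Z n y : sigma_of tau (tube L y) -> R),
   forall n y w, reach (tau^~ w) y (y + pt n) (Z n y w) &
   forall n y, (n0 <= n)%N ->
     (P [set w | (n%:R * (mu + e) < Z n y w)%R] <= (expR (- (c * n%:R)))%:E)%E].
Proof.
move=> e0; have e80 : 0 < e / 8 by rewrite divr_gt0.
have [M [u [k [M0 uv EX EE]]]] := block_exists H i00 e80.
have [L uL] := paths_bounded 0 u k.
have M0R : 0 < M%:R :> R by rewrite ltr0n.
have mu0 : 0 <= mu := time_constant_ge0 H i00.
pose X z w := min_time (tau^~ w \o shift_edge z) 0 u k.
have X0 z w : 0 <= X z w.
  by apply: (min_time_ge0 _ _ uv) => f fD; apply: (weight_nneg H); exact: edges_shift.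
have u_edges j f : f \in path_edges 0 (u j) -> edges d f.
  by apply: path_edges_edges; have /andP[] := uv j.
have mX z : measurable_fun setT (X z : sigma_of tau (cube L z) -> R).
  apply: (measurable_min_time (T := sigma_of tau (cube L z))
     (X := fun f => tau (shift_edge z f))) => j f jk fj.
  apply: measurable_coord; split; first by apply: edges_shift; exact: u_edges fj.
  move=> t i; rewrite mem_shift_edge => tf.
  by have := uL j f (t - z) i jk fj tf; rewrite !mxE.
have mX' z : measurable_fun setT (X z) := sigma_of_measurable_fun (mX z).
have Xreach z w : reach (tau^~ w) z (z + pt M) (X z w).
  have := reach_shift (reach_min_time (tau^~ w \o shift_edge z) k uv).
  by rewrite add0r addrC.
have EfX (f : R -> R) z : measurable_fun setT f -> (forall x, 0 <= x -> 0 <= f x) ->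
    (\int[P]_w (f (X z w))%:E = \int[P]_w (f (min_time (tau^~ w) 0 u k))%:E)%E.
  move=> mf f0; apply: (integral_shift H z (f := fun c => f (min_time c 0 u k))).
    apply: (measurableT_comp mf).
    apply: (measurable_min_time (T := sigma_of _ _) (X := fun f c => c f)) => j g jk gj.
    by apply: measurable_coord; exact: u_edges gj.
  by move=> c c0; apply: f0; exact: (min_time_ge0 _ c0 uv).
have [th th_gt0 thP] := laplace_le P (M%:R * (mu + e / 8))
  (mulr_gt0 M0R e80) (divr_gt0 (th0_gt0 H) M0R) (mulr_ge0 (ler0n R M) (K0_ge0 H i0)).
pose rho := expR (th * (M%:R * (mu + e / 8) + M%:R * (e / 8))).
have Erho z : (\int[P]_w (expR (th * X z w))%:E <= rho%:E)%E.
  apply: thP; [exact: mX'|exact: X0|by rewrite (EfX id)|].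
  rewrite (EfX (fun x => expR (th0 / M%:R * x)))//.
  by apply: measurableT_comp => //; exact: measurable_funM.
pose m := (L + L).+1.
pose q n := (n %/ (m * M))%N.
pose rem n := (n %% (m * M))%N.
pose Rem n y w := \sum_(j < rem n) tau (axis_edge (y + pt (q n * (m * M))) j) w.
pose Z n y w := \sum_(l < q n) \sum_(r < m) X (y + pt ((l * m + r) * M)) w + Rem n y w.
have mRem n y : measurable_fun setT (Rem n y : sigma_of tau (tube L y) -> R).
  apply: (@measurable_sum _ (sigma_of tau (tube L y))) => j.
  by apply: measurable_coord; exact: axis_edge_tube.
have mZ n y : measurable_fun setT (Z n y : sigma_of tau (tube L y) -> R).
  apply: (measurable_funD (T := sigma_of tau (tube L y))); last exact: mRem.
  apply: (@measurable_sum _ (sigma_of tau (tube L y))) => l.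
  apply: (@measurable_sum _ (sigma_of tau (tube L y))) => r.
  by apply: sub_measurable_fun (mX _); exact: cube_tube.
have Zreach n y w : reach (tau^~ w) y (y + pt n) (Z n y w).
  have nE : (n = q n * (m * M) + rem n)%N by exact: divn_eq.
  have -> : y + pt n = y + pt (q n * (m * M)) + pt (rem n).
    by rewrite -addrA -axis_ptD -nE.
  apply: reach_trans; last exact: (reach_axis H).
    by move=> f; exact: (weight_nneg H).
  have := reach_sum (weight_nneg H w) (z := fun l => y + pt (l * (m * M)))
    (c := fun l => \sum_(r < m) X (y + pt ((l * m + r) * M)) w) (k := q n).
  have pt0 : pt 0 = 0 by exact: mulr0n.
  rewrite /= mul0n pt0 addr0; apply=> l _.
  have := reach_sum (weight_nneg H w) (z := fun r => y + pt ((l * m + r) * M))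
    (c := fun r => X (y + pt ((l * m + r) * M)) w) (k := m).
  have -> : ((l * m + 0) * M = l * (m * M))%N by rewrite addn0 mulnA.
  have -> : ((l * m + m) * M = l.+1 * (m * M))%N by rewrite mulnA mulSn addnC.
  apply=> r _.
  have := Xreach (y + pt ((l * m + r) * M)) w.
  rewrite -addrA -axis_ptD (_ : ((l * m + r) * M + M = (l * m + r.+1) * M)%N)//.
  by rewrite addnS mulSn addnC.
pose c1 := th * (e / 4) / m%:R.
pose c2 := th0 * (e / 2).
pose K := Num.max K0 1.
pose C := m%:R + K ^+ (m * M).
have K1 : 1 <= K by rewrite le_max lexx orbT.
have C0 : 0 <= C by rewrite addr_ge0// exprn_ge0// (le_trans ler01).
have m0 : 0 < m%:R :> R by rewrite ltr0n.
have c10 : 0 < c1 by rewrite divr_gt0// mulr_gt0// divr_gt0.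
have c20 : 0 < c2 by rewrite mulr_gt0 ?divr_gt0//; exact: th0_gt0 H.
pose c := Num.min c1 c2 / 2.
have c0 : 0 < c by rewrite divr_gt0// lt_min c10.
have [cc1 cc2] : c < c1 /\ c < c2.
  have [m1 m2] : Num.min c1 c2 <= c1 /\ Num.min c1 c2 <= c2.
    by rewrite !ge_min !lexx orbT.
  by move: c0; rewrite /c; move: (Num.min c1 c2) m1 m2 => z; lra.
have [n0 cP] := exp_absorb cc1 cc2 C0.
exists c, L, n0, Z; split => // n y nn0.
pose S r w := \sum_(l < q n) X (y + pt ((l * m + r) * M)) w.
pose B r := [set w | n%:R / m%:R * (mu + e / 2) < S r w].
have mS r : measurable_fun setT (S r) by exact: measurable_sum.
have mB r : measurable (B r) by exact: measurable_gt_event.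
have qn : (q n)%:R * M%:R <= n%:R / m%:R :> R.
  rewrite ler_pdivlMr// -!natrM ler_nat -mulnA [(M * m)%N]mulnC; exact: leq_divM.
have PB r : (r < m)%N -> (P (B r) <= (expR (- (c1 * n%:R)))%:E)%E.
  move=> rm.
  apply: le_trans (chernoff (J := fun l => cube L (y + pt ((l * m + r) * M)))
     (Y := fun l => X (y + pt ((l * m + r) * M))) (weight_indep H) (q n)
      _ _ _ _ th_gt0 (fun l => Erho _)) _ => //.
  - by move=> l f [].
  - move=> l l' ll'; apply: (cube_disjoint (i := i0)).
    rewrite !mxE !axis_ptE eqxx opprD addrACA subrr add0r.
    rewrite !mulnDl -!mulnA; apply: multiples_apart => //.
    by rewrite (leq_trans (ltnSn _))// leq_pmulr.
  rewrite lee_fin /rho -expRM_natl -expRD ler_expR.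
  have -> : c1 * n%:R = th * (n%:R / m%:R) * (e / 4).
    by rewrite /c1; field; exact: lt0r_neq0.
  have : th * ((q n)%:R * M%:R) * (mu + e / 4) <= th * (n%:R / m%:R) * (mu + e / 4).
    by rewrite ler_wpM2r ?ler_wpM2l ?(ltW th_gt0)// addr_ge0// divr_ge0// ltW.
  have -> : (q n)%:R * (th * (M%:R * (mu + e / 8) + M%:R * (e / 8))) =
    th * ((q n)%:R * M%:R) * (mu + e / 4) by field.
  move: (n%:R / m%:R) => a; lra.
pose BR := [set w | n%:R * (e / 2) < Rem n y w].
have mBR : measurable BR.
  apply: measurable_gt_event; exact: sigma_of_measurable_fun (mRem n y).
have PBR : (P BR <= (C * expR (- (c2 * n%:R)))%:E)%E.
  pose F := [seq axis_edge (y + pt (q n * (m * M))) j | j <- iota 0 (rem n)].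
  have FE w : Rem n y w = \sum_(f <- F) tau f w.
    rewrite big_map /Rem
     -(big_mkord xpredT (fun j => tau (axis_edge (y + pt (q n * (m * M))) j) w)).
    by rewrite /index_iota subn0.
  rewrite /BR (_ : [set w | _] = [set w | n%:R * (e / 2) < \sum_(f <- F) tau f w]); last first.
    by apply/seteqP; split => w /=; rewrite FE.
  have uF : uniq F.
    by rewrite map_inj_uniq ?iota_uniq//; exact: axis_edge_inj.
  have FD f : f \in F -> edges d f by move=> /mapP[j _ ->]; exact: axis_edge_edges.
  apply: le_trans (sum_tail H (th := th0) (beta := 0) (K := K) (B := setT)
    (n%:R * (e / 2)) (th0_gt0 H) measurableT uF FD _ _) _.
  - by move=> f _; rewrite setCT preimage_set0 measure0.
  - move=> f fD; under eq_integral do rewrite indicT mulr1.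
    by apply: le_trans (weight_exp H fD) _; rewrite lee_fin le_max lexx.
  rewrite mulr0 add0r lee_fin mulrC /c2.
  have -> : th0 * (e / 2) * n%:R = th0 * (n%:R * (e / 2)) by ring.
  rewrite ler_wpM2r ?expR_ge0//.
  rewrite size_map size_iota (@le_trans _ _ (K ^+ (m * M)))//; last by rewrite /C lerDr.
  by rewrite ler_weXn2l// ltnW// ltn_mod muln_gt0.
apply: (@le_trans _ _ (P (\bigcup_(r < m) B r `|` BR))).
  apply: le_measure; rewrite ?inE.
  - apply: measurable_gt_event; exact: sigma_of_measurable_fun (mZ n y).
  - apply: measurableU => //.
    by apply: fin_bigcup_measurable => //; exact: finite_II.
  move=> w /= Zw; apply: contrapT => /not_orP[nB nBR].
  have Sr r : (r < m)%N -> S r w <= n%:R / m%:R * (mu + e / 2).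
    by move=> rm; rewrite leNgt; apply/negP => rB; apply: nB; exists r.
  have Rr : Rem n y w <= n%:R * (e / 2) by rewrite leNgt; apply/negP.
  have : \sum_(r < m) S r w <= n%:R * (mu + e / 2).
    apply: (@le_trans _ _ (\sum_(r < m) n%:R / m%:R * (mu + e / 2))).
      by apply: ler_sum => r _; exact: Sr.
    rewrite sumr_const card_ord -mulr_natr le_eqVlt; apply/orP; left; apply/eqP.
    by field; exact: lt0r_neq0.
  move: Zw; rewrite /Z exchange_big/= -/(S _ _) => Zw Sw.
  suff : n%:R * (mu + e) < n%:R * (mu + e) by rewrite ltxx.
  apply: lt_le_trans Zw _; apply: le_trans (lerD Sw Rr) _.
  by rewrite -mulrDr ler_wpM2l//; lra.
apply: le_trans (measureU2 _ _ _) _ => //.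
  by apply: fin_bigcup_measurable => //; exact: finite_II.
apply: le_trans (leeD (probability_bigcup_le (fun r _ => mB r) PB) PBR) _.
rewrite -EFinD lee_fin; apply: le_trans (cP _ nn0); rewrite lerD2r ler_wpM2r ?expR_ge0//.
by rewrite lerDl exprn_ge0// (le_trans ler01).
Qed.

End tube.

(** * Disjoint arms around the end points *)

Section arms.
Context (d : nat).
Local Notation V := 'rV[int]_d.
Variables (i0 i1 : 'I_d).
Hypothesis i01 : i1 != i0.
Local Notation pt := (axis_pt i0).

Let i10 : (i0 == i1) = false. Proof. by rewrite eq_sym (negPf i01). Qed.

(** The tubes are parallel to the first axis i0. An arm in another direction
    goes straight and meets them at right angles; the two arms along i0 turn
    into direction i1 after their first edge. *)
Definition arm_dir (a : 'I_d * bool) := if a.1 == i0 then (i1, false) else a.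

Definition arm (a : 'I_d * bool) (t : nat) : V :=
  if t is s.+1 then unit_vec a + unit_vec (arm_dir a) *+ s else 0.

Lemma arm_adjacent x a t : adjacent (x + arm a t) (x + arm a t.+1).
Proof.
case: t => [|t]; first by rewrite /= mulr0n !addr0; exact: adjacent_unit_vec.
by rewrite /= mulrSr !addrA; exact: adjacent_unit_vec.
Qed.

Lemma arm_neq0 a t : arm a t.+1 != 0.
Proof.
case: a => j x; apply/eqP => /rowP E.
have [ji|ji] := eqVneq j i0.
  have := E i0; rewrite /arm /arm_dir /= ji eqxx !mxE mulmxnE !unit_vecE /= eqxx.
  by rewrite i10 mul0rn addr0; case: x {E}.
have := E j; rewrite /arm /arm_dir /= (negPf ji) !mxE mulmxnE !unit_vecE /= eqxx.
by case: x {E}; lia.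
Qed.

Lemma arm_axis a t : `|arm a t 0 i0| <= 1.
Proof.
case: t => [|t]; first by rewrite mxE.
case: a => j x; rewrite /arm /arm_dir /= !mxE mulmxnE !unit_vecE /=.
have [ji|ji] := eqVneq j i0.
  by rewrite -?ji ?eqxx /= ?ji ?eqxx i10 mul0rn addr0; case: x.
by rewrite /= [i0 == j]eq_sym (negPf ji) mul0rn.
Qed.

(** The coordinate i0 of a vertex of a bent arm is 1 or -1, and that of a
    straight arm is 0. *)
Lemma arm_inj a b t s : arm a t.+1 = arm b s.+1 -> a = b /\ t = s.
Proof.
case: a b => [j x] [k y] /rowP E.
have {}E i := E i.
move: E; rewrite /arm /arm_dir /= => E.
have [ji|ji] := eqVneq j i0; have [ki|ki] := eqVneq k i0; subst.
- have := E i0; have := E i1.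
  rewrite !eqxx !mxE !mulmxnE !unit_vecE /= !eqxx (negPf i01) i10.
  rewrite !mul0rn !natz !add0r !addr0 => ts xy.
  split; last by move: ts; lia.
  by congr (_, _); move: xy; case: x y {E} => [] [].
- have := E i0.
  rewrite eqxx (negPf ki) !mxE !mulmxnE !unit_vecE /= eqxx.
  by rewrite i10 [i0 == k]eq_sym (negPf ki) !mul0rn !addr0; case: x {E}.
- have := E i0.
  rewrite eqxx (negPf ji) !mxE !mulmxnE !unit_vecE /= eqxx.
  by rewrite i10 [i0 == j]eq_sym (negPf ji) !mul0rn !addr0; case: y {E}.
- have := E j.
  rewrite (negPf ki) (negPf ji) !mxE !mulmxnE !unit_vecE /= eqxx.
  have [jk|jk] := eqVneq j k; last by rewrite mul0rn addr0; case: x {E}; lia.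
  by subst; case: x y {E} => [] [] h; split=> //; lia.
Qed.

Definition arm_edge (x : V) a t : {fset V} :=
  [fset (x + arm a t)%R; (x + arm a t.+1)%R]%fset.

Lemma arm_edge_edges x a t : edges d (arm_edge x a t).
Proof. exact/edges_adj/arm_adjacent. Qed.

Lemma arm_edgeC x a t :
  arm_edge x a t = [fset (x + arm a t.+1)%R; (x + arm a t)%R]%fset.
Proof. exact: fsetUC. Qed.

(** Each edge has an end point other than the common origin of the arms, and
    such vertices determine the arm and the position. *)
Lemma arm_edge_inj x a t b s : arm_edge x a t = arm_edge x b s -> a = b /\ t = s.
Proof.
move=> /fsetP E.
have mem c r f q : (x + arm c r.+1)%R \in arm_edge x f q -> c = f /\ (r.+1 = q \/ r = q).
  rewrite !inE => /orP[] /eqP /addrI E'.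
    case: q E' => [|q] E'; first by have := arm_neq0 c r; rewrite E' eqxx.
    by have [-> ->] := arm_inj E'; split => //; left.
  by have [-> ->] := arm_inj E'; split => //; right.
have self c r : (x + arm c r.+1)%R \in arm_edge x c r by rewrite !inE eqxx orbT.
have := E (x + arm a t.+1); rewrite self => /esym/mem[ab ts].
have := E (x + arm b s.+1); rewrite self => /mem[_ st].
by split => //; lia.
Qed.

(** Arms stay within distance 1 of the hyperplane through their origin. *)
Lemma arm_edge_far n a t b s : (3 <= n)%N -> arm_edge 0 a t <> arm_edge (pt n) b s.
Proof.
move=> n3 /fsetP /(_ (0 + arm a t)%R); rewrite !inE eqxx /= => /esym.
have ax x r : `|arm x r 0 i0| <= 1 := arm_axis x r.
have coordD (x y : V) : (x + y) 0 i0 = x 0 i0 + y 0 i0 by rewrite mxE.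
move=> /orP[] /eqP /rowP /(_ i0); rewrite (coordD 0) (coordD (pt n)) axis_ptE eqxx mxE add0r => E;
  have := ax a t; rewrite {}E; [have := ax b s; move: (arm b s 0 i0)|
    have := ax b s.+1; move: (arm b s.+1 0 i0)] => z {ax coordD}; lia.
Qed.

Definition arms (n r : nat) a : seq {fset V} :=
  [seq arm_edge 0 a t | t <- iota 0 r] ++ [seq arm_edge (pt n) a t | t <- iota 0 r].

Lemma arms_edges n r a e : e \in arms n r a -> edges d e.
Proof.
by rewrite mem_cat => /orP[] /mapP[t _ ->]; exact: arm_edge_edges.
Qed.

Lemma arms_uniq n r a : (3 <= n)%N -> uniq (arms n r a).
Proof.
move=> n3; rewrite cat_uniq !map_inj_uniq ?iota_uniq ?andbT/=.
- apply/hasPn => e /mapP[t _ ->]; apply/mapP => -[s _] /esym.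
  exact: arm_edge_far.
- by move=> t s /arm_edge_inj[].
- by move=> t s /arm_edge_inj[].
Qed.

Lemma arms_disjoint n r a b e : (3 <= n)%N -> a != b ->
  e \in arms n r a -> e \notin arms n r b.
Proof.
move=> n3 ab; rewrite !mem_cat => /orP[] /mapP[t _ ->]; apply/negP => /orP[] /mapP[s _ E].
- by have [abE _] := arm_edge_inj E; rewrite abE eqxx in ab.
- exact: arm_edge_far E.
- by apply: (arm_edge_far (a := b) (t := s) (b := a) (s := t) n3); rewrite E.
- by have [abE _] := arm_edge_inj E; rewrite abE eqxx in ab.
Qed.

Lemma size_arms n r a : size (arms n r a) = (r + r)%N.
Proof. by rewrite size_cat !size_map size_iota. Qed.

Lemma sum_arms (R : realType) (c : {fset V} -> R) n r a :
  \sum_(e <- arms n r a) c e = \sum_(e <- [seq arm_edge 0 a t | t <- iota 0 r]) c e +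
    \sum_(e <- [seq arm_edge (pt n) a t | t <- iota 0 r]) c e.
Proof. exact: big_cat. Qed.

(** Steps of 2L + 1 along the arm keep the tubes of width L disjoint. They start
    at position 1, where a bent arm turns: from there on it is straight. *)
Definition tube_start (L : nat) a k : V := arm a ((L + L).+1 * k).+1.

Lemma tube_start_apart L a k l : k != l ->
  (L + L)%:Z < `|tube_start L a k 0 (arm_dir a).1 - tube_start L a l 0 (arm_dir a).1|.
Proof.
move=> kl; have h : (L + L < (L + L).+1)%N by [].
have := multiples_apart 0 h kl; rewrite ![(_ * (L + L).+1)%N]mulnC !addn0.
rewrite /tube_start /arm /arm_dir; case: a => j x /=.
rewrite !mxE !mulmxnE !unit_vecE /=.
move: ((L + L).+1 * k)%N ((L + L).+1 * l)%N => y z.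
have [ji|ji] := eqVneq j i0.
  rewrite ji /= (negPf i01) eqxx !add0r !natz. exact.
rewrite /= eqxx; case: x; rewrite ?mulNrn !natz.
  lia.
lia.
Qed.

Lemma arm_dir_neq a : (arm_dir a).1 != i0.
Proof. by rewrite /arm_dir; case: (eqVneq a.1 i0). Qed.

End arms.

(** * The upper bound *)

Section upper_bound.
Context (R : realType) (dO : measure_display)
    (Omega : measurableType dO) (P : probability Omega R) (d : nat)
    (tau : {fset 'rV[int]_d} -> {RV P >-> R}) (th0 K0 : R).
Hypothesis H : iid_weights tau th0 K0.
Local Notation V := 'rV[int]_d.
Variables (i0 i1 : 'I_d).
Hypothesis i00 : i0 = 0%N :> nat.
Hypothesis i01 : i1 != i0.
Local Notation pt := (axis_pt i0).
Local Notation T := (T_axis tau i0).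
Local Notation mu := (time_constant tau (e1 R d)).
Local Notation arm := (arm i0 i1).
Local Notation arm_edge := (arm_edge i0 i1).
Local Notation arms := (arms i0 i1).
Local Notation dir := ('I_d * bool)%type.

(** A path from 0 to pt n: out along an arm up to the start of a tube, through
    the tube, and back along the translated arm. *)
Lemma T_le_arms n r a t w z : (t <= r)%N -> (3 <= n)%N ->
  reach (tau^~ w) (arm a t) (arm a t + pt n) z ->
  T n w <= \sum_(e <- arms n r a) tau e w + z.
Proof.
move=> tr n3 tube_z; have nn := weight_nneg H w.
have sum_le x : \sum_(s < t) tau (arm_edge x a s) w <=
    \sum_(e <- [seq arm_edge x a s | s <- iota 0 r]) tau e w.
  rewrite -(big_mkord xpredT (fun s => tau (arm_edge x a s) w)) /index_iota subn0.
  rewrite -(big_map (arm_edge x a) xpredT (fun e => tau e w)).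
  apply: sum_sub_seq.
  - by rewrite map_inj_uniq ?iota_uniq// => s s' /(arm_edge_inj i01)[].
  - move=> e /mapP[s]; rewrite mem_iota => st ->; apply: map_f.
    by rewrite mem_iota; move: st; lia.
  - by move=> e /mapP[s _ ->]; apply: nn; exact: arm_edge_edges.
have out : reach (tau^~ w) 0 (arm a t) (\sum_(s < t) tau (arm_edge 0 a s) w).
  have := reach_sum nn (z := fun s => 0 + arm a s)
    (c := fun s => tau (arm_edge 0 a s) w) (k := t).
  rewrite !add0r; apply=> s _.
  by apply: reach_adjacent; exact: arm_adjacent.
have back : reach (tau^~ w) (pt n + arm a t) (pt n)
    (\sum_(s < t) tau (arm_edge (pt n) a s) w).
  have := reach_sum nn (z := fun s => pt n + arm a (t - s))
    (c := fun s => tau (arm_edge (pt n) a (t - s.+1)) w) (k := t).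
  rewrite subn0 subnn /= addr0 => h.
  have -> : \sum_(s < t) tau (arm_edge (pt n) a s) w =
      \sum_(s < t) tau (arm_edge (pt n) a (t - s.+1)) w.
    by rewrite (reindex_inj rev_ord_inj).
  apply: h => s st; have -> : (t - s = (t - s.+1).+1)%N by rewrite subnSK.
  rewrite arm_edgeC; apply: reach_adjacent.
  by rewrite adjacentC; exact: arm_adjacent.
rewrite addrC in back.
apply: (@le_trans _ _ (\sum_(s < t) tau (arm_edge 0 a s) w + z +
   \sum_(s < t) tau (arm_edge (pt n) a s) w)).
  by apply: (ptime_le nn); apply: (reach_trans nn) back; exact: (reach_trans nn) tube_z.
by rewrite sum_arms addrAC lerD2r lerD.
Qed.

(** Up to an event of probability 2d exp(- Kc n), each of the 2d arms meets a tube
    that can be crossed in time n (mu + e): D disjoint tubes are slow with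
    probability exp(- c D n) at most. On the complement, T n > n (mu + xi) makes
    the sum of the weights along each pair of arms exceed n (xi - e), and these
    2d events are independent because the arms are disjoint. *)
Lemma upper_tail_general (xi e Kc : R) : 0 < e -> exists m n0 : nat,
  forall n, (n0 <= n)%N -> forall b : R,
  (forall F : seq {fset V}, uniq F -> (size F <= m)%N ->
     (forall e, e \in F -> edges d e) ->
     (P [set w | (n%:R * (xi - e) < \sum_(e <- F) tau e w)%R] <= b%:E)%E) ->
  (P [set w | (n%:R * (mu + xi) < T n w)%R] <=
    ((d * 2)%:R * expR (- (Kc * n%:R)) + b ^+ (d * 2))%:E)%E.
Proof.
move=> e_gt0.
have [c [L [n0 [Z [c0 mZ Zreach PZ]]]]] := tube_crossing H i00 e_gt0.
(* enough tubes for their common failure to have rate Kc *)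
pose D := (Num.truncn (Kc / c)).+1.
have cD : Kc <= c * D%:R.
  by rewrite mulrC -ler_pdivrMr//; apply: ltW; exact: truncnS_gt.
pose r := ((L + L).+1 * D).+1.
pose y a k := tube_start i0 i1 L a k.
exists (r + r)%N, (maxn 3 n0) => n; rewrite geq_max => /andP[n3 nn0] b Pb.
have mZ' x : measurable_fun setT (Z n x) := sigma_of_measurable_fun (mZ n x).
pose G a k := [set w | n%:R * (mu + e) < Z n (y a k) w].
pose A a := [set w | n%:R * (xi - e) < \sum_(f <- arms n r a) tau f w].
have mG a k : measurable (G a k) by exact: measurable_gt_event.
have mA a : measurable (A a) by exact: measurable_sum_event.
have PG a : (P (\bigcap_(k < D) G a k) <= (expR (- (Kc * n%:R)))%:E)%E.
  rewrite (probability_bigcap (weight_indep H) (J := fun k => tube i0 L (y a k))).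
  - apply: le_trans (prode_le (a := fun k => P (G a k)) (rho := expR (- (c * n%:R))) _ _) _.
    + by [].
    + by move=> k _; exact: PZ.
    + rewrite lee_fin -expRM_natl ler_expR mulrN lerN2 mulrA ler_wpM2r//.
      by rewrite mulrC.
  - by move=> k f [].
  - move=> k l kl; apply: (tube_disjoint (arm_dir_neq i01 a)).
    exact: tube_start_apart.
  - move=> k; exact: (measurable_gt_event (T := sigma_of tau (tube i0 L (y a k)))).
pose N := (d * 2)%N.
pose dirs := enum {: dir}.
have size_dirs : size dirs = N by rewrite -cardE card_prod card_ord card_bool.
pose a0 : dir := (i0, false).
pose dr k := nth a0 dirs k.
have dr_inj k l : (k < N)%N -> (l < N)%N -> dr k = dr l -> k = l.
  move=> kN lN E; apply/eqP.
  by rewrite -(nth_uniq a0 (s := dirs)) ?size_dirs ?enum_uniq//; exact/eqP.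
pose J k := if (k < N)%N then [set f | f \in arms n r (dr k)] else set0.
pose A' k := if (k < N)%N then A (dr k) else setT.
have PA : (P (\bigcap_(k < N) A' k) <= (b ^+ N)%:E)%E.
  rewrite (probability_bigcap (weight_indep H) (J := J)).
  - apply: (prode_le (a := fun k => P (A' k))) => k kN; first by [].
    rewrite /A' kN; apply: Pb; first exact: arms_uniq.
      by rewrite size_arms.
    by move=> f; exact: arms_edges.
  - by move=> k f; rewrite /J; case: ifP => // _; exact: arms_edges.
  - move=> k l kl; rewrite /J; case: ifPn => kN; case: ifPn => lN;
      rewrite ?setI0 ?set0I//.
    apply/seteqP; split=> // f [/= fk fl].
    have /(arms_disjoint i01 n3)/(_ fk) : dr k != dr l.
      by apply: contra_neq kl; exact: dr_inj.
    by rewrite fl.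
  - move=> k; rewrite /A' /J; case kN: (k < N)%N; last first.
      exact: (@measurableT _ (sigma_of tau set0)).
    apply: (measurable_gt_event (T := sigma_of tau _)).
    apply: (measurable_sum_in (T := sigma_of tau _) (X := tau)) => f fk.
    exact: measurable_coord.
have PGU : (P (\bigcup_(k < N) \bigcap_(l < D) G (dr k) l) <=
    (N%:R * expR (- (Kc * n%:R)))%:E)%E.
  apply: probability_bigcup_le => k _; last exact: PG.
  by apply: fin_bigcap_measurable => //; exact: finite_II.
have mGU : measurable (\bigcup_(k < N) \bigcap_(l < D) G (dr k) l).
  apply: fin_bigcup_measurable; first exact: finite_II.
  by move=> k _; apply: fin_bigcap_measurable => //; exact: finite_II.
have mAI : measurable (\bigcap_(k < N) A' k).
  apply: fin_bigcap_measurable; first exact: finite_II.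
  by move=> k /= kN; rewrite /A' kN.
rewrite EFinD; apply: le_trans (leeD PGU PA).
apply: le_trans (measureU2 _ mGU mAI).
apply: le_measure; rewrite ?inE.
- apply: measurable_gt_event; exact: (measurable_T_axis H).
- exact: measurableU.
move=> w /= Tw; have [GU|nGU] := pselect ((\bigcup_(k < N) \bigcap_(l < D) G (dr k) l) w).
  by left.
right=> k /= kN; rewrite /A' kN /A /=.
have [l lD Zl] : exists2 l, (l < D)%N & Z n (y (dr k) l) w <= n%:R * (mu + e).
  apply: contrapT => h; apply: nGU; exists k => // l /= lD.
  by rewrite /G /= ltNge; apply/negP => Zl; apply: h; exists l.
have lr : (((L + L).+1 * l).+1 <= r)%N by rewrite /r ltnS leq_mul2l ltnW.
have := T_le_arms lr n3 (Zreach n (y (dr k) l) w) => h.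
have := lt_le_trans Tw h; move: Zl; lra.
Qed.

End upper_bound.

(** * The lower bound *)

Section origin_edges.
Context (d : nat).
Local Notation V := 'rV[int]_d.

Definition origin_edge (a : 'I_d * bool) : {fset V} := [fset 0%R; unit_vec a]%fset.

Lemma origin_edge_edges a : edges d (origin_edge a).
Proof. by apply: edges_adj; rewrite -[unit_vec a]add0r; exact: adjacent_unit_vec. Qed.

Lemma unit_vec_neq0 (a : 'I_d * bool) : unit_vec a != 0.
Proof.
apply/eqP => /rowP /(_ a.1); rewrite unit_vecE eqxx mxE.
by case: a.2.
Qed.

Lemma origin_edge_inj : injective origin_edge.
Proof.
move=> a b /fsetP /(_ (unit_vec a)); rewrite !inE eqxx orbT => /esym/orP[|/eqP/unit_vec_inj//].
by rewrite (negPf (unit_vec_neq0 a)).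
Qed.

Lemma origin_edge_ex e : edges d e -> 0 \in e -> exists a, e = origin_edge a.
Proof.
move=> [x [y [xy ->]]]; rewrite !inE => /orP[] /eqP E; subst.
  by have [a ->] := adjacent_ex xy; exists a; rewrite add0r.
rewrite adjacentC in xy; have [a ->] := adjacent_ex xy; exists a.
by rewrite add0r fsetUC.
Qed.

Lemma origin_edge0 a : 0 \in origin_edge a.
Proof. by rewrite !inE eqxx. Qed.

End origin_edges.

Section lower_bound.
Context (R : realType) (dO : measure_display)
    (Omega : measurableType dO) (P : probability Omega R) (d : nat)
    (tau : {fset 'rV[int]_d} -> {RV P >-> R}) (th0 K0 : R).
Local Notation V := 'rV[int]_d.
Variables (i0 : 'I_d).
Local Notation pt := (axis_pt i0).
Local Notation T := (T_axis tau i0).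
Local Notation mu := (time_constant tau (e1 R d)).
Local Notation axis_edge := (axis_edge i0).
Local Notation dir := ('I_d * bool)%type.
Hypothesis H : iid_weights tau th0 K0.

(** The passage time for these weights is independent of the weights at the
    origin, and differs from the original one by their contribution only. *)
Definition erase (c : {fset V} -> R) (e : {fset V}) : R := if 0 \in e then 0 else c e.

Lemma erase_ge0 w e : edges d e -> 0 <= erase (tau^~ w) e.
Proof. by rewrite /erase; case: ifP => // _; exact: (weight_nneg H). Qed.

Lemma erase_le w e : edges d e -> erase (tau^~ w) e <= tau e w.
Proof. by rewrite /erase; case: ifP => // _; exact: (weight_nneg H). Qed.

Definition T_erased n w := ptime (erase (tau^~ w)) 0 (pt n).

Lemma axis_pt_neq0 n : (0 < n)%N -> pt n != 0.
Proof.
move=> n0; apply/eqP => /rowP /(_ i0); rewrite axis_ptE eqxx mxE.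
by move: n0; lia.
Qed.

(** Every path from 0 uses at least one edge at the origin, which is free for
    the erased weights. *)
Lemma T_ge_erased n w x : (0 < n)%N -> (forall a, x <= tau (origin_edge a) w) ->
  x + T_erased n w <= T n w.
Proof.
move=> n0 xw; apply: ptime_ge.
  by have := reach_axis H i0 w 0 n; rewrite add0r => h; eexists; exact: h.
move=> p pv; have TE : T_erased n w <= path_time (erase (tau^~ w)) 0 p.
  by apply: (ptime_le (@erase_ge0 w)); exists p.
apply: le_trans (lerD (lexx x) TE) _ => {TE}.
have /andP[pp /eqP pl] := pv.
have [z [q pE]] : exists z q, p = z :: q.
  case: p pl {pv pp} => [/= p0|z q _]; last by exists z, q.
  by have := axis_pt_neq0 n0; rewrite -p0 eqxx.
have z0 : adjacent 0 z by move: pp; rewrite pE /= => /andP[].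
have [a fa] : exists a, [fset 0%R; z]%fset = origin_edge a.
  by apply: origin_edge_ex; [exact: edges_adj|rewrite !inE eqxx].
have fp : origin_edge a \in undup (path_edges 0 p).
  by rewrite mem_undup pE /= inE fa eqxx.
rewrite /path_time !(big_rem _ fp)/= /erase origin_edge0 add0r -/(erase _).
apply: lerD => //; rewrite big_seq [leRHS]big_seq.
apply: ler_sum => e /mem_rem; rewrite mem_undup => ep.
by apply: erase_le; exact: path_edges_edges ep.
Qed.

(** A path, regarded as a set of edges, pays each edge at the origin at most
    once. *)
Lemma T_le_erased n w :
  T n w <= T_erased n w + \sum_(e <- [seq origin_edge a | a : dir]) tau e w.
Proof.
apply/ler_addgt0Pr => e e0.
have [p /andP[pp /eqP pl] pe] : reach (erase (tau^~ w)) 0 (pt n) (T_erased n w + e).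
  apply: ptime_reach; last by rewrite ltrDl.
  have [p pv _] := reach_axis H i0 w 0 n; rewrite add0r in pv.
  by exists (path_time (erase (tau^~ w)) 0 p), p.
apply: (@le_trans _ _ (path_time (tau^~ w) 0 p)).
  by apply: (ptime_le (weight_nneg H w)); exists p => //; rewrite /valid_path pp pl eqxx.
rewrite -addrA [_ + e]addrC addrA.
apply: le_trans (lerD pe (lexx _)).
rewrite /path_time (bigID (fun f : {fset V} => 0 \in f) _ (fun f => tau f w))/= addrC.
rewrite (bigID (fun f : {fset V} => 0 \in f) _ (erase (tau^~ w)))/=.
rewrite [X in _ <= X + _ + _]big1 ?add0r; last by move=> f f0; rewrite /erase f0.
apply: lerD.
  rewrite le_eqVlt; apply/orP; left; apply/eqP; apply: eq_bigr => f /negPf f0.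
  by rewrite /erase f0.
rewrite -big_filter; apply: sum_sub_seq.
- by rewrite filter_uniq// undup_uniq.
- move=> f; rewrite mem_filter mem_undup => /andP[f0 fp].
  have [a ->] := origin_edge_ex (path_edges_edges pp fp) f0.
  by apply/mapP; exists a; rewrite ?mem_enum.
- by move=> f /mapP[a _ ->]; apply: (weight_nneg H); exact: origin_edge_edges.
Qed.

Hypothesis i00 : i0 = 0%N :> nat.

(** The mean of T n is at least n mu, and T n is dominated by a sum of n
    weights, which is uniformly integrable after division by n; hence T n / n
    exceeds any number below mu with probability bounded away from 0. *)
Lemma T_not_small e : 0 < e -> exists2 delta, 0 < delta & forall n, (0 < n)%N ->
  (delta%:E <= P [set w | (n%:R * (mu - e) < T n w)%R])%E.
Proof.
move=> e0; have th_gt0 := th0_gt0 H.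
pose C := (2 / th0) ^+ 2.
have C0 : 0 < C by rewrite exprn_gt0// divr_gt0.
have K00 := K0_ge0 H i0.
(* the level above which the weights contribute at most e / 2 to the mean *)
pose K := 2 * (C * K0) / e + 1.
have K_gt0 : 0 < K.
  by rewrite ltr_wpDl// divr_ge0 ?(ltW e0)// mulr_ge0// mulr_ge0// ltW.
pose delta := Num.min 1 (e / 2 / K).
exists delta; first by rewrite lt_min ltr01 /= !divr_gt0//.
move=> n n0; pose A := [set w | n%:R * (mu - e) < T n w].
have n0R : 0 < n%:R :> R by rewrite ltr0n.
have mA : measurable A by apply: measurable_gt_event; exact: (measurable_T_axis H).
have [mue|mue] := ltP mu e.
  rewrite (_ : [set w | _] = setT); first by rewrite probability_setT lee_fin ge_min lexx.
  apply/seteqP; split=> // w _ /=; apply: lt_le_trans (T_axis_ge0 H i0 n w).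
  by rewrite pmulr_rlt0// subr_lt0.
apply: (@le_trans _ _ (e / 2 / K)%:E); first by rewrite lee_fin ge_min lexx orbT.
rewrite -/A.
(* a weight x is at most K + x ^ 2 / K, where x ^ 2 <= C exp (th0 x) *)
pose g w := \sum_(j < n) (mu - e + K * \1_A w + C / K * expR (th0 * tau (axis_edge 0 j) w)).
have quad x : 0 <= x -> x ^+ 2 <= C * expR (th0 * x).
  move=> x0; have hx : th0 / 2 * x <= expR (th0 / 2 * x).
    by rewrite (le_trans _ (expR_ge1Dx _))// lerDr.
  have -> : th0 * x = th0 / 2 * x + th0 / 2 * x by field.
  have -> : x ^+ 2 = C * ((th0 / 2 * x) * (th0 / 2 * x)).
    by rewrite /C; field; exact: lt0r_neq0.
  rewrite expRD ler_wpM2l ?(ltW C0)//.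
  by apply: ler_pM => //; rewrite mulr_ge0// divr_ge0// ltW.
have Tg w : T n w <= g w.
  have CK0 x : 0 <= C / K * expR x by rewrite mulr_ge0 ?expR_ge0// divr_ge0// ltW.
  have [Aw|nAw] := pselect (A w).
    apply: (@le_trans _ _ (\sum_(j < n) tau (axis_edge 0 j) w)).
      apply: (ptime_le (weight_nneg H w)).
      by have := reach_axis H i0 w 0 n; rewrite add0r.
    apply: ler_sum => j _; rewrite indicE mem_set// mulr1.
    set x := tau _ w; have x0 : 0 <= x by apply: (weight_nneg H); exact: axis_edge_edges.
    have := quad x x0 => qx; have mue' : 0 <= mu - e by rewrite subr_ge0.
    have : x <= K + x ^+ 2 / K.
      rewrite -(ler_pM2r K_gt0) mulrDl divfK ?lt0r_neq0//; nra.
    have : x ^+ 2 / K <= C / K * expR (th0 * x).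
      by rewrite [leRHS]mulrAC ler_pM2r ?invr_gt0.
    move: (x ^+ 2 / K) (C / K * expR (th0 * x)) => y z; lra.
  apply: (@le_trans _ _ (n%:R * (mu - e))).
    by rewrite leNgt; apply/negP.
  rewrite -[n in n%:R]card_ord mulr_natl -sumr_const; apply: ler_sum => j _.
  rewrite -addrA lerDl addr_ge0// mulr_ge0// ltW//.
have Ig : (\int[P]_w (g w)%:E <=
    \sum_(j < n) ((mu - e)%:E + K%:E * P A + (C / K * K0)%:E))%E.
  have mE f : measurable_fun setT (fun w => (expR (th0 * tau f w))%:E).
    by apply/measurable_EFinP; apply: measurableT_comp => //; exact: measurable_funM.
  have mI : measurable_fun setT (fun w => (\1_A w)%:E : \bar R).
    by apply/measurable_EFinP; exact: measurable_indic.
  have CK : (0 <= (C / K)%:E)%E by rewrite lee_fin divr_ge0// ltW.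
  have gE w : (g w)%:E = (\sum_(j < n) ((mu - e)%:E + K%:E * (\1_A w)%:E +
      (C / K)%:E * (expR (th0 * tau (axis_edge 0 j) w))%:E))%E.
    by rewrite /g -sumEFin; apply: eq_bigr => j _; rewrite !EFinD !EFinM.
  under eq_integral do rewrite gE.
  have p1 : (0 <= (mu - e)%:E)%E by rewrite lee_fin subr_ge0.
  have p2 w : (0 <= K%:E * (\1_A w)%:E)%E by rewrite mule_ge0// lee_fin// ltW.
  have p3 f w : (0 <= (C / K)%:E * (expR (th0 * tau f w))%:E)%E.
    by rewrite mule_ge0// lee_fin expR_ge0.
  have m2 : measurable_fun setT (fun w => K%:E * (\1_A w)%:E)%E by exact: measurable_funeM.
  have m3 f : measurable_fun setT (fun w => (C / K)%:E * (expR (th0 * tau f w))%:E)%E.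
    exact: measurable_funeM.
  rewrite ge0_integral_sum//; last 2 first.
  - move=> j; apply: emeasurable_funD => //; exact: emeasurable_funD.
  - by move=> j w _; rewrite !adde_ge0.
  apply: lee_sum => j _.
  rewrite ge0_integralD//; last 2 first.
  - by move=> w _; rewrite adde_ge0.
  - exact: emeasurable_funD.
  rewrite ge0_integralD// integral_cst//= probability_setT mule1.
  rewrite ge0_integralZl//; last by rewrite lee_fin ltW.
  rewrite integral_indic// setIT; apply: leeD => //.
  rewrite ge0_integralZl//.
  rewrite (EFinM (C / K)); apply: lee_wpmul2l => //; apply: (weight_exp H).
  exact: axis_edge_edges.
have := time_constant_le H i00 n => muT.
have TgI : (\int[P]_w (T n w)%:E <= \int[P]_w (g w)%:E)%E.
  apply: ge0_le_integral => //.
  - by move=> w _; rewrite lee_fin (T_axis_ge0 H).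
  - by apply/measurable_EFinP; exact: (measurable_T_axis H).
  - apply/measurable_EFinP; apply: measurable_sum => j; apply: measurable_funD.
      by apply: measurable_funD => //; apply: measurable_funM => //; exact: measurable_indic.
    by apply: measurable_funM => //; apply: measurableT_comp => //; exact: measurable_funM.
  by move=> w _; rewrite lee_fin.
have := le_trans muT (le_trans TgI Ig).
have PA : P A = (fine (P A))%:E by rewrite fineK// fin_num_measure.
rewrite PA -EFinM -!EFinD sumEFin !lee_fin sumr_const card_ord -[leRHS]mulr_natl ler_pM2l//.
move: (fine (P A)) => p hp.
rewrite ler_pdivrMr//.
have : C / K * K0 <= e / 2.
  rewrite mulrAC ler_pdivrMr// /K mulrDr mulr1.
  have -> : e / 2 * (2 * (C * K0) / e) = C * K0 by field; exact: lt0r_neq0.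
  by rewrite lerDl divr_ge0// ltW.
move: (C / K * K0) hp => y; lra.
Qed.

Lemma prode_ge (n : nat) (a : nat -> \bar R) (b : R) : 0 <= b ->
  (forall k, (k < n)%N -> (b%:E <= a k)%E) -> ((b ^+ n)%:E <= \prod_(k < n) a k)%E.
Proof.
move=> b0; elim: n => [|n IH] ab; first by rewrite big_ord0.
rewrite big_ord_recr exprSr EFinM/=; apply: lee_pmul; rewrite ?lee_fin ?exprn_ge0//.
  by apply: IH => k kn; apply: ab; rewrite ltnS ltnW.
exact: ab.
Qed.

(** T n > n (mu + xi) as soon as all weights at the origin exceed n (xi + e) and
    the passage time for the erased weights exceeds n (mu - e). The two events
    are independent. The second has probability bounded away from 0 by
    [T_not_small], as the weights at the origin sum to at most n e / 2 with
    probability tending to 1. *)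
Lemma lower_tail_general (xi e : R) : 0 < e -> exists delta (n0 : nat), 0 < delta /\
  forall n, (n0 <= n)%N -> forall b : R, 0 <= b ->
  (forall a, (b%:E <= P [set w | (n%:R * (xi + e) < tau (origin_edge a) w)%R])%E) ->
  ((delta * b ^+ (d * 2))%:E <= P [set w | (n%:R * (mu + xi) < T n w)%R])%E.
Proof.
move=> e0; have e20 : 0 < e / 2 by rewrite divr_gt0.
have [delta delta0 Pdelta] := T_not_small e20.
pose N := (d * 2)%N.
pose K := Num.max K0 1.
have K1 : 1 <= K by rewrite le_max lexx orbT.
have th_gt0 := th0_gt0 H.
pose O := [seq origin_edge a | a : dir].
have size_O : size O = N by rewrite size_map -cardE card_prod card_ord card_bool.
have uO : uniq O by rewrite map_inj_uniq ?enum_uniq//; exact: origin_edge_inj.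
have OD f : f \in O -> edges d f by move=> /mapP[a _ ->]; exact: origin_edge_edges.
pose n0 := (Num.truncn ((th0 * (e / 2))^-1 * (2 * K ^+ N / delta))).+1.
exists (delta / 2), n0; split; first by rewrite divr_gt0.
move=> n nn0 b b0 Pb.
have n_gt0 : (0 < n)%N by exact: leq_trans nn0.
pose x := n%:R * (xi + e).
pose B := [set w | n%:R * (mu - e) < T_erased n w].
pose S := [set w | n%:R * (e / 2) < \sum_(f <- O) tau f w].
pose J2 := [set f : {fset V} | edges d f /\ 0 \notin f].
have mB' : measurable_fun setT (T_erased n : sigma_of tau J2 -> R).
  apply: (measurable_ptime (T := sigma_of tau J2)
    (X := fun f w => if 0 \in f then 0 else tau f w)).
    move=> f fD /=; case f0: (0 \in f); first exact: measurable_cst.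
    by apply: measurable_coord; split => //; rewrite f0.
  by move=> f fD w; case: ifP => // _; exact: (weight_nneg H).
have mB : measurable B.
  by apply: measurable_gt_event; exact: sigma_of_measurable_fun mB'.
have mS : measurable S by exact: measurable_sum_event.
have PS : (P S <= (delta / 2)%:E)%E.
  apply: le_trans (sum_tail H (th := th0) (beta := 0) (K := K) (B := setT)
    (n%:R * (e / 2)) th_gt0 measurableT uO OD _ _) _.
  - by move=> f _; rewrite setCT preimage_set0 measure0.
  - move=> f fD; under eq_integral do rewrite indicT mulr1.
    by apply: le_trans (weight_exp H fD) _; rewrite lee_fin le_max lexx.
  rewrite mulr0 add0r lee_fin size_O expRN ler_pdivrMl ?expR_gt0// -ler_pdivrMr ?divr_gt0//.
  have -> : K ^+ N / (delta / 2) = 2 * K ^+ N / delta by field; exact: lt0r_neq0.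
  apply: (@le_trans _ _ (th0 * (n%:R * (e / 2)))); last first.
    by rewrite (le_trans _ (expR_ge1Dx _))// lerDr.
  have -> : th0 * (n%:R * (e / 2)) = th0 * (e / 2) * n%:R by ring.
  rewrite -ler_pdivrMl ?mulr_gt0//; apply: ltW; apply: lt_le_trans (truncnS_gt _) _.
  by rewrite ler_nat.
have PB : ((delta / 2)%:E <= P B)%E.
  have : (delta%:E <= P (B `|` S))%E.
    apply: le_trans (Pdelta n n_gt0) _; apply: le_measure; rewrite ?inE.
    - apply: measurable_gt_event; exact: (measurable_T_axis H).
    - exact: measurableU.
    move=> w /= Tw; have [Sw|nSw] := pselect (S w); first by right.
    left; rewrite /B /=; have := T_le_erased n w.
    have : \sum_(f <- O) tau f w <= n%:R * (e / 2) by rewrite leNgt; apply/negP.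
    move: Tw; rewrite /O; have -> : n%:R * (mu - e) = n%:R * (mu - e / 2) - n%:R * (e / 2) by field.
    move: (n%:R * (mu - e / 2)) (n%:R * (e / 2)) => y z; lra.
  move=> /le_trans/(_ (measureU2 _ mB mS)) h.
  have := le_trans h (leeD (lexx (P B)) PS).
  have PBE : P B = (fine (P B))%:E by rewrite fineK// fin_num_measure.
  by rewrite PBE -EFinD !lee_fin; lra.
pose a0 : dir := (i0, false).
pose dr k := nth a0 (enum {: dir}) k.
have size_dirs : size (enum {: dir}) = N by rewrite -cardE card_prod card_ord card_bool.
have dr_inj k l : (k < N)%N -> (l < N)%N -> dr k = dr l -> k = l.
  move=> kN lN E; apply/eqP.
  by rewrite -(nth_uniq a0 (s := enum {: dir})) ?size_dirs ?enum_uniq//; exact/eqP.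
pose J k := if (k < N)%N then [set origin_edge (dr k)] else set0.
pose J1 := [set f | f \in O].
pose A k := if (k < N)%N then [set w | x < tau (origin_edge (dr k)) w] else setT.
have mA k : <<s cylinders tau (J k) >> (A k).
  rewrite /A /J; case kN: (k < N)%N; last exact: (@measurableT _ (sigma_of tau set0)).
  apply: (measurable_gt_event (T := sigma_of tau _)).
  exact: measurable_coord.
have PA : ((b ^+ N)%:E <= P (\bigcap_(k < N) A k))%E.
  rewrite (probability_bigcap (weight_indep H) (J := J))//.
  - apply: (prode_ge (a := fun k => P (A k))) => // k kN; rewrite /A kN; exact: Pb.
  - by move=> k f; rewrite /J; case: ifP => // _ ->; exact: origin_edge_edges.
  - move=> k l kl; rewrite /J; case: ifPn => kN; case: ifPn => lN;
      rewrite ?setI0 ?set0I//.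
    apply/seteqP; split=> // f [-> /= /origin_edge_inj/(dr_inj _ _ kN lN) E].
    by rewrite E eqxx in kl.
have mAI : <<s cylinders tau J1 >> (\bigcap_(k < N) A k).
  apply: (@fin_bigcap_measurable _ (sigma_of tau J1)); first exact: finite_II.
  move=> k /= kN; have := mA k; apply: sub_sigma_algebra2; apply: sub_cylinders.
  by rewrite /J kN => f ->; apply: map_f; rewrite mem_enum.
have PAB : P (\bigcap_(k < N) A k `&` B) = (P (\bigcap_(k < N) A k) * P B)%E.
  apply: (indep_sigma (weight_indep H) (J1 := J1) (J2 := J2)).
  - by move=> f /= fO; exact: OD.
  - by move=> f [].
  - apply/seteqP; split => // f [/= /mapP[a _ ->] [_]].
    by rewrite origin_edge0.
  - exact: mAI.
  - exact: (measurable_gt_event (T := sigma_of tau J2)).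
apply: (@le_trans _ _ (P (\bigcap_(k < N) A k `&` B))).
  rewrite PAB mulrC EFinM; apply: lee_pmul => //; rewrite lee_fin ?exprn_ge0//.
  by rewrite divr_ge0// ltW.
apply: le_measure; rewrite ?inE.
- apply: measurableI => //; exact: (sigma_of_measurable mAI).
- apply: measurable_gt_event; exact: (measurable_T_axis H).
move=> w [Aw Bw] /=.
have : x + T_erased n w <= T n w.
  apply: T_ge_erased => // a.
  have kN : (index a (enum {: dir}) < N)%N by rewrite -size_dirs index_mem mem_enum.
  have := Aw _ kN; rewrite /A kN /dr nth_index ?mem_enum//=.
  exact: ltW.
move: Bw; rewrite /B /= /x => Bw h.
have -> : n%:R * (mu + xi) = n%:R * (xi + e) + n%:R * (mu - e) by ring.
by apply: lt_le_trans h; rewrite ltrD2l.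
Qed.

End lower_bound.

(** * Densities *)

Section density.
Context (R : realType) (dO : measure_display)
    (Omega : measurableType dO) (P : probability Omega R).
Local Notation leb := (@lebesgue_measure R).

(** Integrating against a law with a density: the layer-cake formula turns the
    mean of g(X) into an integral of tail probabilities, hence of integrals of
    the density, and Fubini exchanges them. *)
Lemma integral_density (X : {RV P >-> R}) (f g : R -> R) :
  measurable_fun setT f -> (forall x, 0 <= f x) ->
  (forall B : set R, measurable B ->
     distribution P X B = (\int[leb]_(x in B) (f x)%:E)%E) ->
  measurable_fun setT g -> (forall x, 0 <= g x) ->
  (\int[P]_w (g (X w))%:E = \int[leb]_x (g x * f x)%:E)%E.
Proof.
move=> mf f0 law mg g0.
have mgX : measurable_fun setT (fun w => g (X w)) by exact: measurableT_comp.
pose Y : {RV P >-> R} := HB.pack (fun w => g (X w))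
  (isMeasurableFun.Build _ _ _ _ _ mgX).
pose S := [set z : R * R | 0 <= z.1] `&` [set z : R * R | 0 < g z.2 - z.1].
have mS : measurable S.
  apply: measurableI.
    rewrite (_ : [set z : R * R | _] = fst @^-1` `[0, +oo[%classic).
      by rewrite -[X in measurable X]setTI; exact: measurable_fst.
    by apply/seteqP; split => z /=; rewrite in_itv/= andbT.
  apply: measurable_gt_event; apply: measurable_funB => //.
  by apply: measurableT_comp => //.
pose F (z : R * R) : \bar R := (f z.2 * \1_S z)%:E.
have mF : measurable_fun [set: (R * R)%type] F.
  apply/measurable_EFinP; apply: measurable_funM; last exact: measurable_indic.
  exact: measurableT_comp.
have F0 z : (0 <= F z)%E by rewrite lee_fin mulr_ge0.
transitivity (\int[leb]_r \int[leb]_x F (r, x))%E; last first.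
  rewrite (fubini_tonelli (m1 := leb) (m2 := leb) F mF F0); apply: eq_integral => x _.
  transitivity (\int[leb]_r ((f x)%:E * (\1_(`[0, g x[%classic) r)%:E))%E.
    apply: eq_integral => r _; rewrite /F EFinM; congr (_ * (_)%:E)%E.
    rewrite !indicE; congr (_%:R); congr nat_of_bool.
    by apply/idP/idP; rewrite !inE /S/= in_itv/= subr_gt0 => /andP.
  rewrite ge0_integralZl//; last 2 first.
  - by apply/measurable_EFinP; exact: measurable_indic.
  - by rewrite lee_fin.
  rewrite integral_indic// setIT.
  transitivity ((f x)%:E * leb (`[0%R, g x[%classic))%E; first by [].
  rewrite lebesgue_measure_itv/= lte_fin mulrC EFinM.
  case: ltP => [_|gx0]; first by rewrite sube0 muleC.
  by rewrite (_ : g x = 0) ?mul0e ?mule0//; apply/le_anti; rewrite gx0 g0.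
transitivity ('E_P[Y])%E; first by rewrite expectation_def.
rewrite ge0_expectation_ccdf; last by move=> w; exact: g0.
rewrite integral_mkcond; apply: eq_integral => r _.
rewrite patchE; case: ifPn => [|]; rewrite ?inE ?notin_setE/= in_itv/= andbT => r0.
  have mB : measurable (g @^-1` `]r, +oo[).
    by rewrite -[X in measurable X]setTI; exact: mg.
  transitivity (distribution P X (g @^-1` `]r, +oo[)); first by [].
  rewrite law// integral_mkcond; apply: eq_integral => x _.
  rewrite patchE /F indicE; case: ifPn => [|]; rewrite ?inE ?notin_setE/= in_itv/= andbT => rx.
    by rewrite mem_set ?mulr1//; split => //=; rewrite subr_gt0.
  by rewrite memNset ?mulr0// => -[_ /=]; rewrite subr_gt0.
rewrite integral0_eq// => x _; rewrite /F indicE memNset ?mulr0// => -[/= h _].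
exact: r0.
Qed.

Lemma integral_exp_half_line (a : R) : 0 < a ->
  (\int[leb]_x ((expR (- (a * x)) * \1_(`[0, +oo[%classic) x)%:E) = (a^-1)%:E)%E.
Proof.
move=> a0; have := integral_exponential_pdf a0.
have -> : (\int[leb]_x (exponential_pdf a x)%:E =
    a%:E * \int[leb]_x ((expR (- (a * x)) * \1_(`[0, +oo[%classic) x)%:E))%E.
  rewrite -ge0_integralZl//.
  - apply: eq_integral => x _; rewrite /exponential_pdf patchE indicE -EFinM.
    by case: ifPn => _; rewrite ?mulr1 ?mulr0// mulNr.
  - apply/measurable_EFinP; apply: measurable_funM; last exact: measurable_indic.
    apply: measurableT_comp => //; under eq_fun do rewrite -mulNr.
    exact: measurable_funM.
  - by rewrite lee_fin ltW.
set I := (\int[leb]_x _)%E => aI.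
have I0 : (0 <= I)%E.
  by apply: integral_ge0 => x _; rewrite lee_fin mulr_ge0// expR_ge0.
move: aI I0; case: I => [r| |]//.
  rewrite -EFinM => -[ar] _; congr EFin; apply: (mulfI (lt0r_neq0 a0)).
  by rewrite ar mulfV// lt0r_neq0.
by rewrite gt0_muley ?lte_fin.
Qed.

End density.

(** * The alternating density *)

(* simplification would expand tower n into unary numbers of that size *)
Arguments tower : simpl never.

Section towers.

Lemma tower_lt n : (tower n < tower n.+1)%N.
Proof. exact: ltn_expl. Qed.

Lemma tower_le m n : (m <= n)%N -> (tower m <= tower n)%N.
Proof.
elim: n => [|n IH]; first by rewrite leqn0 => /eqP ->.
rewrite leq_eqVlt => /orP[/eqP -> //|/IH h].
exact: leq_trans h (ltnW (tower_lt n)).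
Qed.

Lemma tower_ge n : (n <= tower n)%N.
Proof. by elim: n => [//|n IH]; exact: leq_trans (tower_lt n). Qed.

Context (R : realType).
Implicit Types x : R.

Lemma tower_ex x : 0 <= x -> exists n, (tower n)%:R <= x < (tower n.+1)%:R.
Proof.
move=> x0; have [m xm Pm] : exists2 m, x < (tower m)%:R &
    forall k, x < (tower k)%:R -> (m <= k)%N.
  have ex : exists m, x < (tower m)%:R.
    exists (Num.truncn x).+1; apply: lt_le_trans (truncnS_gt x) _.
    by rewrite ler_nat tower_ge.
  by case: (ex_minnP ex) => m xm Pm; exists m.
case: m xm Pm => [|m] xm Pm; first by move: xm; rewrite ltNge x0.
exists m; rewrite xm andbT leNgt; apply/negP => /Pm; by rewrite ltnn.
Qed.

Lemma tower_uniq x m n : (tower m)%:R <= x < (tower m.+1)%:R ->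
  (tower n)%:R <= x < (tower n.+1)%:R -> m = n.
Proof.
move=> /andP[m1 m2] /andP[n1 n2]; apply/eqP; rewrite eqn_leq.
apply/andP; split; rewrite leqNgt; apply/negP => /tower_le; rewrite -(ler_nat R) => h.
  by have := lt_le_trans n2 (le_trans h m1); rewrite ltxx.
by have := lt_le_trans m2 (le_trans h n1); rewrite ltxx.
Qed.

End towers.

Section alternating.
Context (R : realType) (alpha1 alpha2 c3 : R).
Local Notation f := (alternating_density alpha1 alpha2 c3).

Lemma density_even k x : (tower (2 * k))%:R <= x < (tower (2 * k).+1)%:R ->
  f x = c3 * expR (- (alpha2 * x)).
Proof.
by move=> h; rewrite /alternating_density; case: asboolP => // -[]; exists k.
Qed.

Lemma density_odd k x : (tower (2 * k).+1)%:R <= x < (tower (2 * k).+2)%:R ->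
  f x = c3 * expR (- (alpha1 * x)).
Proof.
move=> h; rewrite /alternating_density; case: asboolP => [[l hl]|_].
  by have := tower_uniq h hl; lia.
case: asboolP => // -[]; exists k.+1; split => //.
by rewrite (_ : (2 * k.+1)%N = (2 * k).+2)//; lia.
Qed.

Lemma density_lt0 x : x < 0 -> f x = 0.
Proof.
move=> x0; have h k : (tower k)%:R <= x -> False.
  by move=> /le_lt_trans/(_ x0); rewrite ltNge ler0n.
rewrite /alternating_density; case: asboolP => [[l /andP[/h]]//|_].
by case: asboolP => [[l [_ /andP[/h]]]|].
Qed.

(** Every non-negative real lies between two consecutive values of the tower,
    whose parity decides the rate. *)
Lemma density_cases x : 0 <= x ->
  f x = c3 * expR (- (alpha1 * x)) \/ f x = c3 * expR (- (alpha2 * x)).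
Proof.
move=> x0; have [n hn] := tower_ex x0.
have nE := odd_double_half n; rewrite -mul2n in nE.
case: (odd n) nE; rewrite ?add1n ?add0n => nE.
  by left; apply: (@density_odd n./2); rewrite nE.
by right; apply: (@density_even n./2); rewrite nE.
Qed.

(** On both unions of intervals the density is continuous; they cover the
    non-negative reals, and it vanishes elsewhere. *)
Lemma measurable_density : measurable_fun setT f.
Proof.
pose A := \bigcup_k `[(tower (2 * k))%:R, (tower (2 * k).+1)%:R[%classic : set R.
pose B := \bigcup_k `[(tower (2 * k).+1)%:R, (tower (2 * k).+2)%:R[%classic : set R.
have mA : measurable A by apply: bigcup_measurable.
have mB : measurable B by apply: bigcup_measurable.
have mexp a : measurable_fun setT (fun x : R => c3 * expR (- (a * x))).
  apply: measurable_funM => //; apply: measurableT_comp => //.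
  by under eq_fun do rewrite -mulNr; exact: measurable_funM.
rewrite (_ : f = (fun x => c3 * expR (- (alpha2 * x)) * \1_A x +
   c3 * expR (- (alpha1 * x)) * \1_B x)).
  by apply: measurable_funD; apply: measurable_funM => //; exact: measurable_indic.
apply/funext => x.
have [x0|x0] := ltP x 0.
  have h k : (tower k)%:R <= x -> False.
    by move=> /le_lt_trans/(_ x0); rewrite ltNge ler0n.
  rewrite density_lt0// !indicE !memNset ?mulr0 ?addr0// => -[k _ /=];
    by rewrite in_itv/= => /andP[hk _]; case: (h _ hk).
have [n hn] := tower_ex x0.
have nE := odd_double_half n; rewrite -mul2n in nE.
case: (odd n) nE; rewrite ?add1n ?add0n => nE.
  have hn' : (tower (2 * n./2).+1)%:R <= x < (tower (2 * n./2).+2)%:R by rewrite nE.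
  rewrite (density_odd hn') !indicE memNset ?mulr0 ?add0r; last first.
    move=> [k _ /=]; rewrite in_itv/= => /(tower_uniq hn'); lia.
  by rewrite mem_set ?mulr1//; exists n./2.
have hn' : (tower (2 * n./2))%:R <= x < (tower (2 * n./2).+1)%:R by rewrite nE.
rewrite (density_even hn') !indicE mem_set ?mulr1; last by exists n./2.
rewrite memNset ?mulr0 ?addr0//.
move=> [k _ /=]; rewrite in_itv/= => /(tower_uniq hn'); lia.
Qed.

Hypotheses (h1 : 0 < alpha1) (h12 : alpha1 < alpha2) (hc3 : 0 < c3).

Lemma density_ge0 x : 0 <= f x.
Proof.
have [/density_lt0 ->//|/density_cases[] ->] := ltP x 0;
  by rewrite mulr_ge0 ?expR_ge0// ltW.
Qed.

Lemma density_le x : f x <= c3 * expR (- (alpha1 * x)) * \1_(`[0, +oo[%classic) x.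
Proof.
have [x0|x0] := ltP x 0.
  by rewrite density_lt0// !mulr_ge0 ?expR_ge0// ltW.
rewrite indicE mem_set/= ?in_itv/= ?x0// mulr1.
have [->//|->] := density_cases x0.
by rewrite ler_pM2l// ler_expR lerN2 ler_wpM2r// ltW.
Qed.

Lemma density_ge x : 0 <= x -> c3 * expR (- (alpha2 * x)) <= f x.
Proof.
move=> x0; have [->|->//] := density_cases x0.
by rewrite ler_pM2l// ler_expR lerN2 ler_wpM2r// ltW.
Qed.

End alternating.

Section single_weight.
Context (R : realType) (dO : measure_display)
    (Omega : measurableType dO) (P : probability Omega R).
Context (alpha1 alpha2 c3 : R).
Hypotheses (h1 : 0 < alpha1) (h12 : alpha1 < alpha2) (hc3 : 0 < c3).
Local Notation f := (alternating_density alpha1 alpha2 c3).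
Local Notation leb := (@lebesgue_measure R).
Hypothesis hprob : (\int[leb]_x (f x)%:E = 1)%E.
Variable X : {RV P >-> R}.
Hypothesis law : forall B : set R, measurable B ->
  distribution P X B = (\int[leb]_(x in B) (f x)%:E)%E.

Let mf := measurable_density alpha1 alpha2 c3.
Let f0 := density_ge0 alpha1 alpha2 hc3.

Let measurable_exp a : measurable_fun setT (fun x : R => expR (- (a * x))).
Proof.
by apply: measurableT_comp => //; under eq_fun do rewrite -mulNr; exact: measurable_funM.
Qed.

Let measurable_exp_half a c : measurable_fun setT
  (fun x : R => (c * (expR (- (a * x)) * \1_(`[0, +oo[%classic) x))%:E).
Proof.
by apply/measurable_EFinP; apply: measurable_funM => //; exact: measurable_funM.
Qed.

Let integral_exp_half a c : 0 < a -> 0 <= c ->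
  (\int[leb]_x (c * (expR (- (a * x)) * \1_(`[0, +oo[%classic) x))%:E = (c / a)%:E)%E.
Proof.
move=> a0 c0; rewrite EFinM -integral_exp_half_line//.
rewrite -(@ge0_integralZl _ _ _ leb _ measurableT
  (EFin \o (fun x => expR (- (a * x)) * \1_(`[0, +oo[%classic) x)))//.
- apply/measurable_EFinP; apply: measurable_funM (measurable_exp a) _.
  exact: measurable_indic.
- by move=> x _; rewrite lee_fin mulr_ge0 ?expR_ge0 ?f0//.
Qed.

Lemma exp_moment th : th < alpha1 ->
  (\int[P]_w (expR (th * X w))%:E <= (c3 / (alpha1 - th))%:E)%E.
Proof.
move=> tha; have mth : measurable_fun setT (fun x : R => expR (th * x)).
  by apply: measurableT_comp => //; exact: measurable_funM.
rewrite (integral_density mf f0 law (g := fun x => expR (th * x)))//.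
rewrite -integral_exp_half ?subr_gt0 ?(ltW hc3)//.
apply: ge0_le_integral => // [x _|||x _].
- by rewrite lee_fin mulr_ge0 ?expR_ge0 ?f0//.
- by apply/measurable_EFinP; exact: measurable_funM.
- exact: measurable_exp_half.
rewrite lee_fin.
apply: (@le_trans _ _ (expR (th * x) *
  (c3 * expR (- (alpha1 * x)) * \1_(`[0, +oo[%classic) x))).
  by rewrite ler_wpM2l ?expR_ge0//; exact: density_le.
have -> : - ((alpha1 - th) * x) = th * x + - (alpha1 * x) by ring.
by rewrite expRD le_eqVlt; apply/orP; left; apply/eqP; ring.
Qed.

(** Let a = tower 2k and b = tower (2k + 1). On [a, b[ the density is that of
    rate alpha2, and below a the exponential is at most exp(th a), where the
    total mass is 1. When a is negligible on the scale considered, th can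
    therefore be taken up to alpha2, although the Laplace transform of the
    untruncated weight is only finite below alpha1. *)
Lemma truncated_moment k th : 0 < th -> th < alpha2 ->
  (\int[P]_w (expR (th * X w) *
      \1_(`]-oo, (tower (2 * k).+1)%:R[%classic) (X w))%:E <=
   (expR (th * (tower (2 * k))%:R) + c3 / (alpha2 - th))%:E)%E.
Proof.
move=> th_gt0 tha; set a := (tower (2 * k))%:R; set b := (tower (2 * k).+1)%:R.
pose g x := expR (th * x) * \1_(`]-oo, b[%classic) x.
have mg : measurable_fun setT g.
  apply: measurable_funM; last exact: measurable_indic.
  by apply: measurableT_comp => //; exact: measurable_funM.
have g0 x : 0 <= g x by rewrite mulr_ge0// expR_ge0.
rewrite (integral_density mf f0 law mg g0).
have fint : (\int[leb]_x (expR (th * a) * f x)%:E = (expR (th * a))%:E)%E.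
  under eq_integral do rewrite EFinM.
  rewrite (@ge0_integralZl _ _ _ leb _ measurableT (EFin \o f)).
  - by rewrite hprob mule1.
  - exact/measurable_EFinP.
  - by move=> x _; rewrite lee_fin f0.
  - by rewrite lee_fin expR_ge0.
have mef : measurable_fun setT (fun x => (expR (th * a) * f x)%:E).
  by apply/measurable_EFinP; exact: measurable_funM.
rewrite EFinD -fint -integral_exp_half ?subr_gt0 ?(ltW hc3)//.
rewrite -ge0_integralD//; last 3 first.
- by move=> x _; rewrite lee_fin mulr_ge0 ?expR_ge0 ?f0.
- by move=> x _; rewrite lee_fin !mulr_ge0 ?expR_ge0 ?(ltW hc3).
- exact: measurable_exp_half.
apply: ge0_le_integral => //.
- by move=> x _; rewrite lee_fin mulr_ge0 ?g0 ?f0.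
- by apply/measurable_EFinP; exact: measurable_funM.
- by apply: emeasurable_funD => //; exact: measurable_exp_half.
move=> x _; rewrite -EFinD lee_fin.
have e0 : 0 <= c3 * (expR (- ((alpha2 - th) * x)) * \1_(`[0, +oo[%classic) x).
  by rewrite !mulr_ge0 ?expR_ge0// ltW.
have [xa|ax] := ltP x a.
  rewrite -[leLHS]addr0; apply: lerD => //; rewrite ler_wpM2r// /g.
  apply: (@le_trans _ _ (expR (th * x))).
    by rewrite ler_piMr ?expR_ge0// indicE; case: (_ \in _).
  by rewrite ler_expR ler_pM2l// ltW.
have x0 : 0 <= x by apply: le_trans ax; rewrite ler0n.
rewrite ler_wpDl ?mulr_ge0 ?expR_ge0//.
have [bx|xb] := leP b x.
  by rewrite /g indicE memNset ?mulr0 ?mul0r//= in_itv/=; move: bx; rewrite leNgt => /negP.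
rewrite (@density_even R alpha1 alpha2 c3 k x) ?ax//.
rewrite indicE mem_set/= ?in_itv/= ?x0//.
have -> : - ((alpha2 - th) * x) = th * x + - (alpha2 * x) by ring.
rewrite expRD mulr1 /g indicE mem_set/= ?in_itv//= mulr1.
by rewrite le_eqVlt; apply/orP; left; apply/eqP; ring.
Qed.

(** The rate alpha1 / 2 is far from optimal; it is applied at a b that exceeds
    the relevant scale by an arbitrary factor. *)
Lemma tail_upper b : (P (X @^-1` (~` `]-oo, b[%classic)) <=
  (c3 / (alpha1 / 2) * expR (- (alpha1 / 2 * b)))%:E)%E.
Proof.
apply: (@le_trans _ _ (((expR (alpha1 / 2 * b))^-1)%:E *
    \int[P]_w (expR (alpha1 / 2 * X w))%:E)%E).
  apply: markov_event => [|||//|w /=].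
  - by apply: measurable_funPTI; exact: measurableC.
  - by apply: measurableT_comp => //; exact: measurable_funM.
  - by move=> w; exact: expR_ge0.
  - exact: expR_gt0.
  rewrite in_itv/= => /negP; rewrite -leNgt => bX.
  by rewrite ler_expR ler_pM2l// divr_gt0.
rewrite -expRN (mulrC (c3 / _)) EFinM; apply: lee_wpmul2l; first by rewrite lee_fin expR_ge0.
have h : alpha1 / 2 < alpha1 by rewrite ltr_pdivrMr// ltr_pMr// ltr1n.
apply: le_trans (exp_moment h) _; rewrite lee_fin.
by have -> : alpha1 - alpha1 / 2 = alpha1 / 2 by field.
Qed.

Lemma tail_lower_ge x m : 0 <= m -> (forall t, x < t <= x + 1 -> m <= f t) ->
  (m%:E <= P [set w | (x < X w)%R])%E.
Proof.
move=> m0 mft.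
have -> : P [set w | x < X w] = distribution P X `]x, +oo[%classic.
  by congr (P _); apply/seteqP; split => w /=; rewrite in_itv/= andbT.
rewrite law//.
apply: (@le_trans _ _ (\int[leb]_(t in `]x, (x + 1)%R]) (cst m%:E t))%E).
  have -> : (\int[leb]_(t in `]x, (x + 1)%R]) (cst m%:E t) =
      m%:E * leb `]x, (x + 1)%R])%E by exact: integral_cst.
  rewrite lebesgue_measure_itv/= lte_fin ltrDl ltr01 -EFinB.
  by rewrite addrAC subrr add0r mule1.
apply: (@le_trans _ _ (\int[leb]_(t in `]x, (x + 1)%R]) (f t)%:E)%E).
  apply: ge0_le_integral => //.
  by apply/measurable_EFinP; exact: measurable_funTS.
apply: ge0_subset_integral => //.
- by apply/measurable_EFinP; exact: measurable_funTS.
- by move=> t _; rewrite lee_fin.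
- by move=> t /=; rewrite !in_itv/= andbT => /andP[].
Qed.

Lemma tail_lower x : 0 <= x ->
  ((c3 * expR (- (alpha2 * (x + 1))))%:E <= P [set w | (x < X w)%R])%E.
Proof.
move=> x0; apply: tail_lower_ge; first by rewrite mulr_ge0 ?expR_ge0// ltW.
move=> t /andP[xt tx]; apply: le_trans (density_ge h12 hc3 (ltW (le_lt_trans x0 xt))).
by rewrite ler_pM2l// ler_expR lerN2 ler_pM2l// (lt_trans h1).
Qed.

Lemma tail_lower_odd k x : (tower (2 * k).+1)%:R <= x -> x + 1 < (tower (2 * k).+2)%:R ->
  ((c3 * expR (- (alpha1 * (x + 1))))%:E <= P [set w | (x < X w)%R])%E.
Proof.
move=> kx xk; apply: tail_lower_ge; first by rewrite mulr_ge0 ?expR_ge0// ltW.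
move=> t /andP[xt tx]; rewrite (@density_odd R alpha1 alpha2 c3 k t).
  by rewrite ler_pM2l// ler_expR lerN2 ler_pM2l.
by rewrite (ltW (le_lt_trans kx xt)) (le_lt_trans tx xk).
Qed.

End single_weight.

(** * Exponential rates along subsequences *)

Section limits.
Context (R : realType).
Implicit Types (u : nat -> \bar R) (l : R).

Lemma limn_esup_le u l :
  (forall e, 0 < e -> exists n0, forall n, (n0 <= n)%N -> (u n <= (l + e)%:E)%E) ->
  (limn_esup u <= l%:E)%E.
Proof.
move=> ul; apply/lee_addgt0Pr => e /ul[n0 un0].
apply: (@le_trans _ _ (ereal_sup (u @` [set n | (n0 <= n)%N]))).
  apply: ereal_inf_lbound; exists [set n | (n0 <= n)%N] => //.
  by exists n0.
by apply: ge_ereal_sup => _ [n /= nn0 <-]; rewrite -EFinD; exact: un0.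
Qed.

Lemma limn_esup_ge u l :
  (forall e N, 0 < e -> exists2 n, (N <= n)%N & ((l - e)%:E <= u n)%E) ->
  (l%:E <= limn_esup u)%E.
Proof.
move=> ul; apply: le_ereal_inf_tmp => _ [B [N _ NB] <-].
apply/lee_subgt0Pr => e e0; have [n Nn un] := ul e N e0.
by apply: le_trans un _; apply: ereal_sup_ubound; exists n => //; exact: NB.
Qed.

Lemma limn_einf_ge u l :
  (forall e, 0 < e -> exists n0, forall n, (n0 <= n)%N -> ((l - e)%:E <= u n)%E) ->
  (l%:E <= limn_einf u)%E.
Proof.
move=> ul; rewrite /limn_einf leeNr -EFinN; apply: limn_esup_le => e /ul[n0 h].
by exists n0 => n /h; rewrite leeNl -EFinN opprD opprK.
Qed.

Lemma limn_einf_le u l :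
  (forall e N, 0 < e -> exists2 n, (N <= n)%N & (u n <= (l + e)%:E)%E) ->
  (limn_einf u <= l%:E)%E.
Proof.
move=> ul; rewrite /limn_einf leeNl -EFinN; apply: limn_esup_ge => e N /(ul e N)[n Nn h].
by exists n => //; rewrite leeNr -EFinN opprB opprK addrC.
Qed.

Lemma rate_le (p : \bar R) (s : R) n : (0 < n)%N -> (0 <= p)%E ->
  (p <= (expR (- (s * n%:R)))%:E)%E -> ((n%:R^-1)%:E * lne p <= (- s)%:E)%E.
Proof.
move=> n0 p0 ps; have n0R : 0 < n%:R^-1 :> R by rewrite invr_gt0 ltr0n.
have : (lne p <= (- (s * n%:R))%:E)%E.
  rewrite -[X in (_ <= X%:E)%E]expRK -lne_EFin ?expR_gt0// lee_lne//.
    by rewrite in_itv/= p0 leey.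
  by rewrite in_itv/= lee_fin expR_ge0 leey.
move=> /(lee_wpmul2l (ltW (n0R : (0 < (n%:R^-1)%:E)%E))) /le_trans; apply.
by rewrite -EFinM lee_fin mulrN mulrCA mulVf ?mulr1// pnatr_eq0 -lt0n.
Qed.

Lemma rate_ge (p : \bar R) (s : R) n : (0 < n)%N ->
  ((expR (- (s * n%:R)))%:E <= p)%E -> ((- s)%:E <= (n%:R^-1)%:E * lne p)%E.
Proof.
move=> n0 ps; have n0R : 0 < n%:R^-1 :> R by rewrite invr_gt0 ltr0n.
have : ((- (s * n%:R))%:E <= lne p)%E.
  rewrite -[X in (X%:E <= _)%E]expRK -lne_EFin ?expR_gt0// lee_lne//.
    by rewrite in_itv/= lee_fin expR_ge0 leey.
  by rewrite in_itv/= leey andbT; apply: le_trans ps; rewrite lee_fin expR_ge0.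
move=> /(lee_wpmul2l (ltW (n0R : (0 < (n%:R^-1)%:E)%E))); apply: le_trans.
by rewrite -EFinM lee_fin mulrN mulrCA mulVf ?mulr1// pnatr_eq0 -lt0n.
Qed.

End limits.

(** With q = a / 3, rounded down: a < 3 (q + 1) and (q + 1) ^ 3 <= 2 ^ (3 q). *)
Lemma pow2_square M a : (27 * M <= a)%N -> (M * a ^ 2 <= 2 ^ a)%N.
Proof.
move=> Ma; pose q := (a %/ 3)%N.
have aq : (a <= 3 * q.+1)%N by rewrite mulnC ltnW// ltn_ceil.
have q3 : (q.+1 ^ 3 <= 2 ^ a)%N.
  apply: (@leq_trans ((2 ^ q) ^ 3)); first by rewrite leq_exp2r// ltn_expl.
  by rewrite -expnM leq_exp2l// leq_divM.
rewrite -(leq_pmul2l (isT : (0 < 27)%N)).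
apply: leq_trans (leq_mul (leqnn 27) q3).
apply: (@leq_trans (a ^ 3)); first by rewrite mulnA expnS leq_mul2r Ma orbT.
by rewrite -[27%N]/(3 ^ 3)%N -expnMn leq_exp2r.
Qed.

Lemma light_times N : exists2 n, (N <= n)%N & exists k, n = (tower (2 * k) ^ 2)%N.
Proof.
exists (tower (2 * N) ^ 2)%N; last by exists N.
have h : (N <= tower (2 * N))%N by apply: leq_trans (tower_ge _); rewrite leq_pmull.
by apply: leq_trans h _; rewrite -mulnn; case: (tower _) => // a; rewrite leq_pmull.
Qed.

(** Take the first n with n x above A = tower (2k + 1): the interval from A to
    2 ^ A on which the rate is alpha1 is much longer than x + 1. *)
Lemma heavy_times (R : realType) (x : R) N : 0 < x -> exists2 n, (N <= n)%N &
  exists k, (tower (2 * k).+1)%:R <= n%:R * x /\ n%:R * x + 1 < (tower (2 * k).+2)%:R.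
Proof.
move=> x0; pose M := (Num.truncn x).+3.
(* N M <= A gives N <= n, and 27 M <= A gives M A ^ 2 <= 2 ^ A *)
pose k := (N * M + 27 * M)%N; pose A := tower (2 * k).+1.
have kA : (k <= A)%N.
  by apply: leq_trans (tower_ge _); rewrite leqW// leq_pmull.
have xM : x + 2 < M%:R by rewrite /M -(addn2 (Num.truncn x).+1) natrD ltrD2r truncnS_gt.
have A1 : (M * A ^ 2 <= tower (2 * k).+2)%N.
  by apply: pow2_square; apply: leq_trans kA; rewrite leq_addl.
pose n := (Num.truncn (A%:R / x)).+1.
have An : A%:R <= n%:R * x by rewrite -ler_pdivrMr// ltW// truncnS_gt.
have nA : n%:R * x <= A%:R + x.
  rewrite /n -natr1 mulrDl mul1r lerD2r -ler_pdivlMr//.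
  have /andP[] // := truncn_itv (divr_ge0 (ler0n R A) (ltW x0)).
exists n; last first.
  exists k; split => //; apply: (@lt_le_trans _ _ (M * A ^ 2)%N%:R); last by rewrite ler_nat.
  apply: le_lt_trans (_ : A%:R + (x + 1) < _); first by rewrite addrA lerD2r.
  have A_gt0 : (1 <= A)%N by apply: leq_trans (tower_ge _).
  apply: (@lt_le_trans _ _ (A%:R + (M.-1)%:R)).
    rewrite ltrD2l -(ltrD2r 1) natr1 prednK//; move: xM; lra.
  rewrite -natrD ler_nat -mulnn mulnA.
  apply: (@leq_trans (M * A)); last by rewrite leq_pmulr.
  by rewrite -[in leqRHS](prednK (isT : (0 < M)%N)) mulSn leq_add2l leq_pmulr.
have : (N * M)%:R <= n%:R * M%:R :> R.
  apply: (@le_trans _ _ A%:R); first by rewrite ler_nat (leq_trans _ kA)// leq_addr.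
  apply: le_trans An _; rewrite ler_wpM2l//; apply: ltW; apply: lt_trans xM; lra.
by rewrite -natrM ler_nat leq_pmul2r.
Qed.

Section rates.
Context (R : realType) (dO : measure_display)
    (Omega : measurableType dO) (P : probability Omega R)
    (d : nat) (tau : {fset 'rV[int]_d} -> {RV P >-> R}) (th0 K0 : R).
Hypothesis H : iid_weights tau th0 K0.
Variables (i0 i1 : 'I_d).
Hypothesis i00 : i0 = 0%N :> nat.
Hypothesis i01 : i1 != i0.
Variable xi : R.
Hypothesis hxi : 0 < xi.
Local Notation V := 'rV[int]_d.
Local Notation mu := (time_constant tau (e1 R d)).
Local Notation tail n := (P [set w | (n%:R * (mu + xi) < T_axis tau i0 n w)%R]).

(** [upper_tail_general] with b the bound on the sums of weights: its power 2d
    gives the factor 2d in the rate, and the tubes are chosen to fail at a rate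
    2d alpha xi. The set Q of times lets the same argument serve the limit
    superior (all times) and the limit inferior (sparse times). *)
Lemma upper_rate (alpha : R) (Q : set nat) : 0 < alpha ->
  (forall th (m : nat) e s, 0 < th -> th < alpha -> 0 < e -> 0 < s ->
    exists n0, forall n, (n0 <= n)%N -> Q n -> forall F : seq {fset V},
      uniq F -> (size F <= m)%N -> (forall f, f \in F -> edges d f) ->
      (P [set w | (n%:R * s < \sum_(f <- F) tau f w)%R] <=
        (expR (- ((th * s - e) * n%:R)))%:E)%E) ->
  forall e, 0 < e -> exists n0, forall n, (n0 <= n)%N -> Q n ->
    (tail n <= (expR (- ((2 * d%:R * alpha * xi - e) * n%:R)))%:E)%E.
Proof.
move=> alpha0 single e e0.
have d0 : (0 < d)%N by apply: leq_ltn_trans (ltn_ord i0).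
have d0R : 0 < d%:R :> R by rewrite ltr0n.
set S := 2 * d%:R * alpha * xi.
have S0 : 0 < S by rewrite !mulr_gt0.
(* the relative loss in th and in s; S (1 - eta) ^ 2 >= S - 2 S eta *)
pose eta := Num.min (1 / 2) (e / (8 * S)).
have eta0 : 0 < eta by rewrite lt_min !divr_gt0// mulr_gt0.
have eta12 : eta <= 1 / 2 by rewrite ge_min lexx.
have etaS : S * eta <= e / 8.
  rewrite -ler_pdivlMl//; apply: (@le_trans _ _ (e / (8 * S))).
    by rewrite ge_min lexx orbT.
  by rewrite le_eqVlt; apply/orP; left; apply/eqP; field; exact: lt0r_neq0.
pose th := alpha * (1 - eta); pose s := xi * (1 - eta).
have th_gt0 : 0 < th by rewrite mulr_gt0//; lra.
have th_lt : th < alpha by rewrite /th mulrBr mulr1 ltrBlDr ltrDl mulr_gt0.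
have s0 : 0 < s by rewrite mulr_gt0//; lra.
pose e' := e / (16 * d%:R).
have e'0 : 0 < e' by rewrite divr_gt0// mulr_gt0.
have xieta : 0 < xi * eta by rewrite mulr_gt0.
have [m [n1 up]] := upper_tail_general H i00 i01 xi S xieta.
have [n2 Fs] := single th m e' s th_gt0 th_lt e'0 s0.
pose C := (d * 2)%:R : R.
have C1 : 1 <= C by rewrite ler1n muln_gt0 d0.
pose c2 := C * (th * s - e').
have Sc2 : S - e < c2.
  have -> : c2 = S * (1 - eta) * (1 - eta) - e / 8.
    rewrite /c2 /C /th /s /e' /S natrM; field.
    by rewrite lt0r_neq0// d0R.
  have : 0 <= S * eta * eta by rewrite !mulr_ge0// ltW.
  nra.
have Sc1 : S - e < S by rewrite ltrBlDr ltrDl.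
have [n3 abs] := exp_absorb Sc1 Sc2 (le_trans ler01 C1).
exists (maxn n1 (maxn n2 n3)) => n; rewrite !geq_max => /and3P[nn1 nn2 nn3] Qn.
apply: le_trans (up n nn1 (expR (- ((th * s - e') * n%:R))) _) _.
  move=> F uF sF FD; have := Fs n nn2 Qn F uF sF FD.
  by rewrite (_ : xi - xi * eta = s)// /s mulrBr mulr1.
rewrite lee_fin; apply: le_trans (abs n nn3); apply: lerD => //.
rewrite -expRM_natl mulrN mulrA -/C -/c2.
by rewrite ler_peMl// expR_ge0.
Qed.

(** The counterpart from [lower_tail_general]. The margin e' is part of the
    condition on the times, as it shifts the level that a weight has to exceed. *)
Lemma lower_rate (alpha c : R) (Q : R -> set nat) : 0 < alpha -> 0 < c ->
  (forall e n, 0 < e -> (0 < n)%N -> Q e n -> forall f, edges d f ->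
    ((c * expR (- (alpha * (n%:R * (xi + e) + 1))))%:E <=
      P [set w | (n%:R * (xi + e) < tau f w)%R])%E) ->
  forall e, 0 < e -> exists2 e', 0 < e' & exists n0, forall n, (n0 <= n)%N -> Q e' n ->
    ((expR (- ((2 * d%:R * alpha * xi + e) * n%:R)))%:E <= tail n)%E.
Proof.
move=> alpha0 c0 single e e0.
have d0 : (0 < d)%N by apply: leq_ltn_trans (ltn_ord i0).
have d0R : 0 < d%:R :> R by rewrite ltr0n.
set S := 2 * d%:R * alpha * xi.
pose e' := e / (4 * d%:R * alpha).
have e'0 : 0 < e' by rewrite divr_gt0// !mulr_gt0.
have [delta [n1 [delta0 low]]] := lower_tail_general H i00 xi e'0.
pose D := delta * (c * expR (- alpha)) ^+ (d * 2).
have D0 : 0 < D by rewrite mulr_gt0// exprn_gt0// mulr_gt0// expR_gt0.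
have Se : S + e / 2 < S + e by rewrite ltrD2l; lra.
have Dinv0 : 0 <= D^-1 by rewrite invr_ge0 ltW.
have [n2 abs] := exp_absorb Se Se Dinv0.
exists e' => //; exists (maxn 1 (maxn n1 n2)) => n; rewrite !geq_max.
move=> /and3P[n0 nn1 nn2] Qn.
pose b := c * expR (- (alpha * (n%:R * (xi + e') + 1))).
have b0 : 0 <= b by rewrite mulr_ge0 ?expR_ge0// ltW.
apply: le_trans (low n nn1 b b0 _); last first.
  by move=> a; apply: single => //; exact: origin_edge_edges.
rewrite lee_fin.
have -> : delta * b ^+ (d * 2) = D * expR (- ((S + e / 2) * n%:R)).
  have -> : b = c * expR (- alpha) * expR (- (alpha * (xi + e') * n%:R)).
    by rewrite /b -mulrA -expRD; congr (_ * expR _); ring.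
  rewrite exprMn -expRM_natl /D -!mulrA; congr (_ * (_ * expR _)).
  rewrite natrM /S /e'; field.
  by rewrite !lt0r_neq0.
rewrite -ler_pdivrMl//; apply: le_trans (abs n nn2).
by rewrite lerDl mulr_ge0// expR_ge0.
Qed.

End rates.

(** * The alternating law *)

Section alternating_rates.
Context (R : realType) (dO : measure_display)
    (Omega : measurableType dO) (P : probability Omega R) (d : nat)
    (alpha1 alpha2 c3 : R).
Hypotheses (h1 : 0 < alpha1) (h12 : alpha1 < alpha2) (hc3 : 0 < c3).
Hypothesis hprob : (\int[lebesgue_measure]_x
                (alternating_density alpha1 alpha2 c3 x)%:E = 1)%E.
Variable tau : {fset 'rV[int]_d} -> {RV P >-> R}.
Hypothesis tau_ge0 : forall e, edges d e -> forall w, 0 <= tau e w.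
Hypothesis tau_indep : independent_family (edges d) tau.
Hypothesis tau_law : forall e, edges d e -> forall B : set R, measurable B ->
       distribution P (tau e) B =
       (\int[lebesgue_measure]_(x in B)
          (alternating_density alpha1 alpha2 c3 x)%:E)%E.
Local Notation V := 'rV[int]_d.

Lemma alternating_iid : iid_weights tau (alpha1 / 2) (c3 / (alpha1 - alpha1 / 2)).
Proof.
split => //.
- move=> e e' eD e'D B mB.
  by have := tau_law eD mB; rewrite -(tau_law e'D mB).
- by rewrite divr_gt0.
- move=> e eD; apply: (exp_moment h12 hc3 (tau_law eD)).
  by rewrite ltr_pdivrMr// ltr_pMr// ltr1n.
Qed.

(** The density is everywhere at most c3 exp(- alpha1 x). *)
Lemma sum_rate_all th (m : nat) e s : 0 < th -> th < alpha1 -> 0 < e -> 0 < s ->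
  exists n0, forall n, (n0 <= n)%N -> forall F : seq {fset V},
      uniq F -> (size F <= m)%N -> (forall f, f \in F -> edges d f) ->
      (P [set w | (n%:R * s < \sum_(f <- F) tau f w)%R] <=
        (expR (- ((th * s - e) * n%:R)))%:E)%E.
Proof.
move=> th_gt0 tha e0 s0.
pose K := Num.max 1 (c3 / (alpha1 - th)).
have K1 : 1 <= K by rewrite le_max lexx.
have K0 : 0 <= K ^+ m by rewrite exprn_ge0// (le_trans ler01).
have lt : th * s - e < th * s by rewrite ltrBlDr ltrDl.
have [n0 abs] := exp_absorb lt lt K0.
exists n0 => n nn0 F uF sF FD.
apply: le_trans (sum_tail alternating_iid (th := th) (beta := 0) (K := K) (B := setT)
    (n%:R * s) th_gt0 measurableT uF FD _ _) _.
- by move=> f _; rewrite setCT preimage_set0 measure0.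
- move=> f fD; under eq_integral do rewrite indicT mulr1.
  apply: le_trans (exp_moment h12 hc3 (tau_law fD) tha) _.
  by rewrite lee_fin le_max lexx orbT.
rewrite lee_fin mulr0 add0r; apply: le_trans (abs n nn0).
rewrite ler_wpDr ?mulr_ge0 ?expR_ge0// mulrC -mulrA (mulrC s).
rewrite mulrA -[th * _ * s]mulrA (mulrC n%:R s) mulrA ler_wpM2r ?expR_ge0//.
by rewrite ler_weXn2l.
Qed.

(** At the times n = (tower 2k) ^ 2 the density is light on the relevant scale:
    it has switched to rate alpha2 at tower 2k, which is o(n), and switches back
    only at 2 ^ tower 2k, which is so far away that a weight reaches it with a
    probability smaller than exp(- c n) for any given c, if k is large. *)
Lemma sum_rate_light th (m : nat) e s : 0 < th -> th < alpha2 -> 0 < e -> 0 < s ->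
  exists n0, forall n, (n0 <= n)%N -> (exists k, n = (tower (2 * k) ^ 2)%N) ->
    forall F : seq {fset V},
      uniq F -> (size F <= m)%N -> (forall f, f \in F -> edges d f) ->
      (P [set w | (n%:R * s < \sum_(f <- F) tau f w)%R] <=
        (expR (- ((th * s - e) * n%:R)))%:E)%E.
Proof.
move=> th_gt0 tha e0 s0.
pose C' := c3 / (alpha2 - th).
have C'0 : 0 <= C' by rewrite divr_ge0 ?ltW// subr_gt0.
pose K2 := 1 + C'.
have K21 : 1 <= K2 by rewrite lerDl.
pose B1 := m%:R * (c3 / (alpha1 / 2)).
have B10 : 0 <= B1 by rewrite mulr_ge0// !divr_ge0// ltW.
pose C := B1 + K2 ^+ m.
have K2m : 0 <= K2 ^+ m by rewrite exprn_ge0// (le_trans ler01).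
have C0 : 0 <= C by rewrite addr_ge0.
have lt1 : th * s - e < th * s by rewrite ltrBlDr ltrDl.
have lt2 : th * s - e < th * s - e / 2 by rewrite ltrD2l ltrN2; lra.
have [n1 abs] := exp_absorb lt1 lt2 C0.
(* n M <= 2 ^ a makes the truncation error of rate th s at least, and A1 <= a
   makes exp (m th a) at most exp (e n / 2) *)
pose M := (Num.truncn (th * s / (alpha1 / 2))).+1.
pose A1 := (Num.truncn (m%:R * th / (e / 2))).+1.
exists (maxn n1 ((maxn (27 * M) A1) ^ 2)) => n; rewrite geq_max => /andP[nn1 nA] [k nE].
set a := tower (2 * k) in nE.
have {nA} : (maxn (27 * M) A1 <= a)%N by move: nA; rewrite nE leq_exp2r.
rewrite geq_max => /andP[Ma A1a] F uF sF FD.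
pose K := expR (th * a%:R) + C'.
have ea1 : 1 <= expR (th * a%:R).
  by rewrite -expR0 ler_expR mulr_ge0// ltW.
have K1 : 1 <= K by rewrite (le_trans ea1)// lerDl.
pose beta := c3 / (alpha1 / 2) * expR (- (alpha1 / 2 * (tower (2 * k).+1)%:R)).
have beta0 : 0 <= beta by rewrite mulr_ge0 ?expR_ge0// !divr_ge0// ltW.
apply: le_trans (sum_tail alternating_iid (th := th) (beta := beta) (K := K)
    (B := `]-oo, (tower (2 * k).+1)%:R[%classic)
    (n%:R * s) th_gt0 _ uF FD _ _) _.
- by [].
- move=> f fD; exact: (tail_upper h1 h12 hc3 (tau_law fD)).
- move=> f fD; exact: (truncated_moment hc3 hprob (tau_law fD)).
rewrite lee_fin; apply: le_trans (abs n nn1); apply: lerD.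
  apply: (@le_trans _ _ (m%:R * beta)); first by rewrite ler_wpM2r// ler_nat.
  rewrite /beta mulrA -/B1; apply: (@le_trans _ _ (B1 * expR (- (th * s * n%:R)))).
    rewrite ler_wpM2l// ler_expR lerN2.
    apply: (@le_trans _ _ (alpha1 / 2 * (M * a ^ 2)%N%:R)); last first.
      by rewrite ler_pM2l ?divr_gt0// ler_nat; exact: pow2_square.
    rewrite natrM -nE mulrA ler_wpM2r// [leRHS]mulrC -ler_pdivrMr ?divr_gt0//.
    by apply: ltW; exact: truncnS_gt.
  by rewrite ler_wpM2r ?expR_ge0// lerDl.
apply: (@le_trans _ _ (expR (- (th * (n%:R * s))) * (expR (e / 2 * n%:R) * K2 ^+ m))).
  rewrite ler_wpM2l ?expR_ge0//.
  apply: (@le_trans _ _ (K ^+ m)); first by rewrite ler_weXn2l.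
  apply: (@le_trans _ _ ((expR (th * a%:R) * K2) ^+ m)).
    rewrite lerXn2r ?nnegrE ?mulr_ge0 ?expR_ge0 ?(le_trans ler01)//.
    by rewrite /K /K2 mulrDr mulr1 lerD2l ler_peMl.
  rewrite exprMn ler_wpM2r// -expRM_natl ler_expR nE natrX mulrA expr2 mulrA ler_wpM2r//.
  rewrite [leRHS]mulrC -ler_pdivrMr ?divr_gt0// ltW// (lt_le_trans (truncnS_gt _))// ler_nat.
  exact: A1a.
rewrite mulrA -expRD mulrC.
have -> : - (th * (n%:R * s)) + e / 2 * n%:R = - ((th * s - e / 2) * n%:R) by ring.
by rewrite ler_wpM2r ?expR_ge0// lerDr.
Qed.

End alternating_rates.

Theorem theorem1p2 (R : realType) (dO : measure_display)
    (Omega : measurableType dO) (P : probability Omega R)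
    (d : nat) (hd : (2 <= d)%N)
    (alpha1 alpha2 : R) (h1 : 0 < alpha1) (h12 : alpha1 < alpha2)
    (c3 : R) (hc3 : 0 < c3)
    (hprob : (\int[lebesgue_measure]_x
                (alternating_density alpha1 alpha2 c3 x)%:E = 1)%E)
    (tau : {fset 'rV[int]_d} -> {RV P >-> R})
    (tau_ge0 : forall e, edges d e -> forall w, 0 <= tau e w)
    (tau_indep : independent_family (edges d) tau)
    (tau_law : forall e, edges d e -> forall B : set R, measurable B ->
       distribution P (tau e) B =
       (\int[lebesgue_measure]_(x in B)
          (alternating_density alpha1 alpha2 c3 x)%:E)%E)
    (xi : R) (hxi : 0 < xi) :
  [/\ limn_esup (upper_tail_rate tau xi) = (- (2 * d%:R * alpha1 * xi))%:E,
      limn_einf (upper_tail_rate tau xi) = (- (2 * d%:R * alpha2 * xi))%:E &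
      [/\ (-oo < limn_einf (upper_tail_rate tau xi))%E,
          (limn_einf (upper_tail_rate tau xi)
             < limn_esup (upper_tail_rate tau xi))%E &
          (limn_esup (upper_tail_rate tau xi) < 0)%E]].
Proof.
have d0 : (0 < d)%N by apply: leq_trans hd.
pose i0 : 'I_d := Ordinal d0; pose i1 : 'I_d := Ordinal hd.
have i00 : i0 = 0%N :> nat by [].
have i01 : i1 != i0 by [].
have H := alternating_iid h1 h12 hc3 tau_ge0 tau_indep tau_law.
pose mu := time_constant tau (e1 R d).
pose p n := P [set w | (n%:R * (mu + xi) < T_axis tau i0 n w)%R].
have uE n : upper_tail_rate tau xi n = ((n%:R^-1)%:E * lne (p n))%E.
  rewrite /upper_tail_rate /p; congr (_ * lne (P _))%E.
  apply/seteqP; split => w /=;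
    by rewrite passage_timeE floor_rV0 (floor_axis i00)// natrK.
have h2 : 0 < alpha2 by exact: lt_trans h12.
have d0R : 0 < d%:R :> R by rewrite ltr0n.
pose s a := 2 * d%:R * a * xi.
have up1 e : 0 < e -> exists n0, forall n, (n0 <= n)%N ->
    (upper_tail_rate tau xi n <= (- s alpha1 + e)%:E)%E.
  move=> e0; have [|n0 up] := upper_rate H i00 i01 hxi (Q := setT) h1 _ e0.
    move=> th m e' x th_gt0 tha e'0 x0.
    have [n0 h] := sum_rate_all h1 h12 hc3 tau_ge0 tau_indep tau_law m th_gt0 tha e'0 x0.
    by exists n0 => n nn0 _; exact: h.
  exists (maxn 1 n0) => n; rewrite geq_max => /andP[n_gt0 nn0]; rewrite uE.
  by rewrite addrC -opprB; apply: rate_le => //; exact: up.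
have up2 e N : 0 < e -> exists2 n, (N <= n)%N &
    (upper_tail_rate tau xi n <= (- s alpha2 + e)%:E)%E.
  move=> e0; have [|n0 up] := upper_rate H i00 i01 hxi
      (Q := [set n | exists k, n = (tower (2 * k) ^ 2)%N]) h2 _ e0.
    move=> th m e' x th_gt0 tha e'0 x0.
    exact: (sum_rate_light h1 h12 hc3 hprob tau_ge0 tau_indep tau_law).
  have [n] := light_times (maxn (maxn 1 n0) N); rewrite !geq_max => /andP[/andP[n_gt0 nn0] Nn] nk.
  exists n => //; rewrite uE addrC -opprB; apply: rate_le => //; exact: up.
have low1 e : 0 < e -> exists n0, forall n, (n0 <= n)%N ->
    ((- s alpha2 - e)%:E <= upper_tail_rate tau xi n)%E.
  move=> e0; have [|e' e'0 [n0 low]] := lower_rate H i00 (xi := xi) (Q := fun=> setT) h2 hc3 _ e0.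
    move=> e' n e'0 n_gt0 _ f fD; apply: (tail_lower h1 h12 hc3 (tau_law f fD)).
    by rewrite mulr_ge0// ltW// addr_gt0.
  exists (maxn 1 n0) => n; rewrite geq_max => /andP[n_gt0 nn0]; rewrite uE.
  by rewrite -opprD; apply: rate_ge => //; exact: low.
have low2 e N : 0 < e -> exists2 n, (N <= n)%N &
    ((- s alpha1 - e)%:E <= upper_tail_rate tau xi n)%E.
  move=> e0; have [|e' e'0 [n0 low]] := lower_rate H i00 (xi := xi)
      (Q := fun e' => [set n | exists k, (tower (2 * k).+1)%:R <= n%:R * (xi + e') /\
         n%:R * (xi + e') + 1 < (tower (2 * k).+2)%:R]) h1 hc3 _ e0.
    move=> e' n e'0 n_gt0 [k [k1 k2]] f fD.
    exact: (tail_lower_odd h1 hc3 (tau_law f fD) k1 k2).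
  have [n] := heavy_times (maxn (maxn 1 n0) N) (addr_gt0 hxi e'0).
  rewrite !geq_max => /andP[/andP[n_gt0 nn0] Nn] nk.
  exists n => //; rewrite uE -opprD; apply: rate_ge => //; exact: low.
have esupE : limn_esup (upper_tail_rate tau xi) = (- s alpha1)%:E.
  by apply/le_anti; rewrite limn_esup_le// limn_esup_ge.
have einfE : limn_einf (upper_tail_rate tau xi) = (- s alpha2)%:E.
  by apply/le_anti; rewrite limn_einf_le// limn_einf_ge.
rewrite esupE einfE; split => //; split.
- exact: ltNyr.
- by rewrite lte_fin ltrN2 /s ltr_pM2r// ltr_pM2l// mulr_gt0.
- by rewrite lte_fin oppr_lt0 !mulr_gt0.
Qed.
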